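(* Let $\{B_t; t\ge 0\}$ be standard $\mathbb{R}^2$-valued Brownian motion without drift started at $B_0=\rho_1(\cos\mu_1,\sin\mu_1)'$, where $0\le\rho_1<1$ and $-\pi\le\mu_1<\pi$. Let $\tau_1=\inf\{t;\|B_t\|=1\}$ and $\tau_2=\inf\{t;\|B_t\|=\rho_2^{-1}\}$, where $0<\rho_2<1$. Let $\Theta$ be the $[-\pi,\pi)$-valued random variable defined by $B_{\tau_1}=(\cos\Theta,\sin\Theta)'$. Then, for $-\pi\le\mu_2<\pi$, the conditional density of $\Theta$ given $B_{\tau_2}=\rho_2^{-1}(\cos\mu_2,\sin\mu_2)'$ is $$f(\theta)=C\left[\{1+\rho_1^2-2\rho_1\cos(\theta-\mu_1)\}\{1+\rho_2^2-2\rho_2\cos(\theta-\mu_2)\}\right]^{-1},\qquad -\pi\le\theta<\pi,$$ where $$C=\frac{(1-\rho_1^2)(1-\rho_2^2)\{1+\rho_1^2\rho_2^2-2\rho_1\rho_2\cos(\mu_1-\mu_2)\}}{2\pi(1-\rho_1^2\rho_2^2)}.$$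
   Context: The density is with respect to Lebesgue measure on $[-\pi,\pi)$. Note $\tau_2>\tau_1$ almost surely since the particle starts inside the unit disc. *)

(* Defs.v *)
From HB Require Import structures.
From mathcomp Require Import all_boot all_order all_algebra.
From mathcomp Require Import all_classical all_reals all_analysis.
Set Implicit Arguments. Unset Strict Implicit. Unset Printing Implicit Defensive.
Import Order.TTheory GRing.Theory Num.Theory.
Import numFieldNormedType.Exports.
Local Open Scope classical_set_scope.
Local Open Scope ring_scope.

Section BM.
Context {R : realType} {d : measure_display} {T : measurableType d}.

Definition norm2 (p : R * R) : R := Num.sqrt (p.1 ^+ 2 + p.2 ^+ 2).

(** Standard (driftless, identity covariance) R^2-valued Brownian motion
    started at x0, on the probability space (T, P): B t is the position at
    time t >= 0.  Paths are continuous on [0, +oo), B_0 = x0, each B_t is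
    measurable, and for all times 0 = s_0 < s_1 < ... < s_n the 2n coordinate
    increments are independent, the increments over [s_i, s_{i+1}] being
    N(0, s_{i+1} - s_i) (normal_prob takes the standard deviation). *)
Definition is_BM2 (P : probability T R) (B : R -> T -> R * R) (x0 : R * R) :=
  [/\ (forall w, B 0 w = x0),
      (forall w, {within `[0, +oo[, continuous (fun t => B t w)}),
      (forall t, 0 <= t -> measurable_fun setT (fun w => (B t w).1)
                          /\ measurable_fun setT (fun w => (B t w).2)) &
      (forall (n : nat) (s : nat -> R), s 0%N = 0 ->
         (forall i, (i < n)%N -> s i < s i.+1) ->
         forall (A C : nat -> set R),
           (forall i, measurable (A i)) -> (forall i, measurable (C i)) ->
           P (\bigcap_(i in [set i | (i < n)%N])
                [set w | A i ((B (s i.+1) w).1 - (B (s i) w).1)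
                         /\ C i ((B (s i.+1) w).2 - (B (s i) w).2)])
           = \big[*%E/1%E]_(i < n)
               (normal_prob 0 (Num.sqrt (s i.+1 - s i)) (A i)
                * normal_prob 0 (Num.sqrt (s i.+1 - s i)) (C i))%E)].

Definition hit_time (B : R -> T -> R * R) (r : R) (w : T) : \bar R :=
  ereal_inf [set t%:E | t in [set t : R | 0 <= t /\ norm2 (B t w) = r]].

(** Position at the hitting time (meaningful when hit_time is finite). *)
Definition hit_pos (B : R -> T -> R * R) (r : R) (w : T) : R * R :=
  B (fine (hit_time B r w)) w.

Definition angle_of (p : R * R) : R :=
  xget 0 [set th : R | -pi <= th < pi
                       /\ p = (norm2 p * cos th, norm2 p * sin th)].

Definition cond_dens (rho1 mu1 rho2 mu2 th : R) : R :=
  let C := (1 - rho1 ^+ 2) * (1 - rho2 ^+ 2)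
           * (1 + rho1 ^+ 2 * rho2 ^+ 2 - 2 * rho1 * rho2 * cos (mu1 - mu2))
           / (2 * pi * (1 - rho1 ^+ 2 * rho2 ^+ 2)) in
  C / ((1 + rho1 ^+ 2 - 2 * rho1 * cos (th - mu1))
       * (1 + rho2 ^+ 2 - 2 * rho2 * cos (th - mu2))).

End BM.

(* Main.v *)
(* The Poisson kernels of the disc are harmonic.  Averaging a harmonic function
   over the four quarter turns of an increment leaves an error of order four in
   the increment, so along a grid of mesh h = 4 ^- k the expected error of a
   Brownian step is of order h ^+ 2, and summing 8 ^ k of them still gives a
   vanishing total.  Refining the grid and exhausting the disc from inside thus
   yields optional stopping for these test functions at the hitting times of the
   two circles, in the form
     E[g(B_tau1) (f(B_tau2) - f(B_tau1))] = 0.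
   With Theta and Phi the two exit angles and K_s the Poisson kernel, this gives
     E[K_s(Theta - a)] = K_(s rho1)(mu1 - a),
     E[K_s(Phi - a)] = K_(s rho1 rho2)(mu1 - a),
     E[K_s'(Theta - a') K_s(Phi - a)] = E[K_s'(Theta - a') K_(s rho2)(Theta - a)].
   Integrating in a and letting s tend to 1 turns the kernel into the indicator
   of an interval, so that Poisson transforms determine laws on the circle.  The
   joint density of (Theta, Phi) is therefore a product of two Poisson kernels,
   and dividing by the density of Phi gives the conditional density. *)
Require Import Defs.
From HB Require Import structures.
From mathcomp Require Import all_boot all_order all_algebra.
From mathcomp Require Import all_classical all_reals all_analysis.
From mathcomp Require Import measurable_realfun normal_distribution ring lra complex.
Set Implicit Arguments. Unset Strict Implicit. Unset Printing Implicit Defensive.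
Import Order.TTheory GRing.Theory Num.Theory.
Import numFieldNormedType.Exports.
Local Open Scope classical_set_scope.
Local Open Scope ring_scope.

(** The hypotheses supply only continuous paths and independent Gaussian increments at fixed times.
    The strong Markov property at the first circle is therefore replaced by the weight g(B_tau1),
    carried through a telescoping sum over the grid as a coefficient that depends on the past alone.
    Two obstacles shape the limits. A grid detects strict excess over a level but misses exact hits,
    so the walk is stopped on exceeding a level below the radius; the mesh is refined with this
    level fixed, and only afterwards does the level rise to the radius. Moreover a Poisson function
    has a pole outside the circle, which a Gaussian step may overshoot. The test functions are
    therefore set to zero beyond a radius between circle and pole; the resulting jump is absorbed by
    the fourth-order bound, since only large increments can reach it. The inversion of the Poisson
    transform rests on an explicit arctangent primitive of the kernel. It is bounded uniformly in
    the radius and still makes sense at radius one, where it is a step function, so bounded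
    convergence suffices. *)

Section bounded_random_variables.
Context {R : realType} {d : measure_display} {T : measurableType d}
  (P : probability T R).

Lemma bounded_integrable (f : T -> R) (M : R) : measurable_fun setT f ->
  (forall w, `|f w| <= M) -> P.-integrable setT (EFin \o f).
Proof.
move=> mf fM; apply: measurable_bounded_integrable => //.
  by rewrite (le_lt_trans (probability_le1 P _)) ?ltry.
exists M; split; rewrite ?num_real// => x Mx w _.
exact: le_trans (fM _) (ltW Mx).
Qed.

Lemma bounded_cvg_Rintegral (f_ : nat -> T -> R) (f : T -> R) (M : R) :
  (forall n, measurable_fun setT (f_ n)) -> measurable_fun setT f ->
  (forall n w, `|f_ n w| <= M) -> {ae P, forall w, f_ ^~ w @ \oo --> f w} ->
  (fun n => \int[P]_w f_ n w) @ \oo --> \int[P]_w f w.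
Proof.
move=> mf_ mf fM f_f.
have [|||intf _ cvf] := @dominated_convergence _ _ _ P setT measurableT
  (fun n => EFin \o f_ n) (EFin \o f) (cst M%:E)
  (fun n => (measurable_EFinP _ _).2 (mf_ n)) ((measurable_EFinP _ _).2 mf).
- apply: filterS f_f => w fw _; apply/fine_cvgP; split; first exact: nearW.
  exact: fw.
- exact: (@bounded_integrable _ `|M|).
- by apply: aeW => w n _; rewrite lee_fin.
apply: fine_cvg; rewrite /Rintegral fineK//; exact: integrable_fin_num.
Qed.

End bounded_random_variables.

(** * Laws of random variables and product laws *)

Section law.
Context {R : realType} {d d' : measure_display} {T : measurableType d}
  {T' : measurableType d'}.

Definition law (P : probability T R) (f : T -> T') (mf : measurable_fun setT f)
  : probability T' R := distribution P (mfun_Sub (mem_set mf)).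

Lemma lawE (P : probability T R) (f : T -> T') (mf : measurable_fun setT f) A :
  law P mf A = P (f @^-1` A).
Proof. by []. Qed.

Lemma integral_law (P : probability T R) (f : T -> T')
    (mf : measurable_fun setT f) (g : T' -> \bar R) :
  measurable_fun setT g -> P.-integrable setT (g \o f) ->
  (\int[law P mf]_y g y = \int[P]_x g (f x))%E.
Proof. by move=> mg intg; rewrite integral_distribution. Qed.

Lemma ge0_integral_law (P : probability T R) (f : T -> T')
    (mf : measurable_fun setT f) (g : T' -> \bar R) :
  measurable_fun setT g -> (forall x, 0 <= g x)%E ->
  (\int[law P mf]_y g y = \int[P]_x g (f x))%E.
Proof. by move=> mg intg; rewrite ge0_integral_distribution. Qed.

Definition image_measure (m : {measure set T -> \bar R}) (f : T -> T')
    (mf : measurable_fun setT f) : {measure set T' -> \bar R} :=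
  @measure_function_pushforward__canonical__measure_function_Measure
    _ _ _ _ _ m f mf.

End law.

Section prod_law.
Context {R : realType} {d1 d2 : measure_display} {T1 : measurableType d1}
  {T2 : measurableType d2}.

Definition prod_law (P1 : probability T1 R) (P2 : probability T2 R) :
  probability (T1 * T2)%type R := (P1 \x P2)%E.

Lemma prod_lawE (P1 : probability T1 R) (P2 : probability T2 R) A C :
  measurable A -> measurable C -> prod_law P1 P2 (A `*` C) = (P1 A * P2 C)%E.
Proof. by move=> mA mC; rewrite /prod_law /= product_measure1E. Qed.

(** Rectangles are stable under intersection, generate the product sigma-algebra and include the
    whole space, so Dynkin's uniqueness theorem applies to finite measures. *)
Lemma rectangle_measure_unique (m1 m2 : {measure set (T1 * T2) -> \bar R}) :
  (m1 setT < +oo)%E ->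
  (forall A C, measurable A -> measurable C -> m1 (A `*` C) = m2 (A `*` C)) ->
  forall Z, measurable Z -> m1 Z = m2 Z.
Proof.
move=> m1oo m12.
pose G : set (set (T1 * T2)) :=
  [set A `*` C | A in measurable & C in measurable].
move=> Z mZ; apply: (measure_unique G (fun=> setT)) => //.
- by rewrite measurable_prod_measurableType.
- move=> _ _ [A1 mA1 [C1 mC1 <-]] [A2 mA2 [C2 mC2 <-]].
  rewrite -setXI; exists (A1 `&` A2); first exact: measurableI.
  by exists (C1 `&` C2); first exact: measurableI.
- by move=> _; exists setT => //; exists setT => //; rewrite setXTT.
- by rewrite bigcup_const.
- by move=> _ [A mA [C mC <-]]; exact: m12.
Qed.

End prod_law.

(** * Independence of an increment from the past, and its invariance under quarter turns *)

Section past_of_increments.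
Context {R : realType} {d : measure_display} {T : measurableType d}.
Context (P : probability T R) (N : probability (R) R).
Context (X Y : nat -> T -> R).

(** An intersection-stable generator of the past, of exactly the shape to which the product formula
    of [iid_pairs] applies. The sequences run over all of [nat], but only their first [j] terms
    matter. *)
Definition cylinder (j : nat) : set (set T) :=
  [set E | exists A C : nat -> set R,
    [/\ forall i, measurable (A i), forall i, measurable (C i) &
     E = \bigcap_(i in [set i | (i < j)%N])
           [set w | A i (X i w) /\ C i (Y i w)]]].

(** The points of [T] with the coarser sigma-algebra of the first [j] pairs: being adapted becomes
    plain measurability of a function on this type. *)
Definition pastType (j : nat) := g_sigma_algebraType (cylinder j).

Definition iid_pairs :=
  [/\ forall i, measurable_fun setT (X i), forall i, measurable_fun setT (Y i) &
  forall n (A C : nat -> set R),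
    (forall i, measurable (A i)) -> (forall i, measurable (C i)) ->
    P (\bigcap_(i in [set i | (i < n)%N]) [set w | A i (X i w) /\ C i (Y i w)])
    = \big[*%E/1%E]_(i < n) (N (A i) * N (C i))%E].

Context (iid : iid_pairs).

Lemma measurable_past_fst i j : (i < j)%N ->
  measurable_fun setT (X i : pastType j -> R).
Proof.
move=> ij _ A mA; rewrite setTI; apply: sub_sigma_algebra.
exists (fun k => if k == i then A else setT), (fun=> setT); split => //.
  by move=> k; case: ifP.
apply/seteqP; split => [w Aw k /= kj|w /= H].
  by split => //; case: ifP => // /eqP ->.
by have [] := H i ij; rewrite eqxx.
Qed.

Lemma measurable_past_snd i j : (i < j)%N ->
  measurable_fun setT (Y i : pastType j -> R).
Proof.
move=> ij _ A mA; rewrite setTI; apply: sub_sigma_algebra.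
exists (fun=> setT), (fun k => if k == i then A else setT); split => //.
  by move=> k; case: ifP.
apply/seteqP; split => [w Aw k /= kj|w /= H].
  by split => //; case: ifP => // /eqP ->.
by have [] := H i ij; rewrite eqxx.
Qed.

Lemma cylinder_setI j : setI_closed (cylinder j).
Proof.
move=> _ _ [A [C [mA mC ->]]] [A' [C' [mA' mC' ->]]].
exists (fun i => A i `&` A' i), (fun i => C i `&` C' i); split.
- by move=> i; exact: measurableI.
- by move=> i; exact: measurableI.
apply/seteqP; split => [w [H H'] i ij|w H].
  by have [? ?] := H i ij; have [? ?] := H' i ij.
by split => i ij; have [[? ?] [? ?]] := H i ij.
Qed.

Lemma measurable_pair_event (A C : set R) i : measurable A -> measurable C ->
  measurable [set w | A (X i w) /\ C (Y i w)].
Proof.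
case: iid => mX mY _ mA mC.
rewrite (_ : [set _ | _] = X i @^-1` A `&` Y i @^-1` C)//.
by apply: measurableI; rewrite -[_ @^-1` _]setTI; [exact: mX|exact: mY].
Qed.

Lemma cylinder_measurable j E : cylinder j E -> measurable E.
Proof.
move=> [A [C [mA mC ->]]]; apply: bigcap_measurableType => i _.
exact: measurable_pair_event.
Qed.

Lemma past_measurable j E : (<<s cylinder j>>) E -> measurable E.
Proof.
apply: smallest_sub; first exact: sigma_algebra_measurable.
exact: cylinder_measurable.
Qed.

Lemma measurable_to_past j : measurable_fun setT (id : T -> pastType j).
Proof. by move=> _ A mA; rewrite setTI preimage_id; exact: past_measurable mA. Qed.

(** For fixed [A] and [C] both sides are finite measures in [E]. On a cylinder of length [j] they
    agree, since adjoining [A] and [C] at index [j] gives a cylinder of length [j.+1], whose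
    probability has one more factor. *)
Lemma past_independent j (E : set T) (A C : set R) : (<<s cylinder j>>) E ->
  measurable A -> measurable C ->
  P (E `&` [set w | A (X j w) /\ C (Y j w)]) = (P E * (N A * N C))%E.
Proof.
move=> sE mA mC.
have [mX mY ind] := iid.
have mF := measurable_pair_event j mA mC.
have NAC : (N A * N C)%E \is a fin_num by rewrite fin_numM// fin_num_measure.
have NAC0 : (0 <= N A * N C)%E by rewrite mule_ge0.
have [k kE] : exists k : {nonneg R}, (k%:num)%:E = (N A * N C)%E.
  by exists (NngNum (fine_ge0 NAC0)); rewrite /= fineK.
(* The two measures in [E]: [P] restricted to the event of the [j]-th pair, and [P] scaled by the
   probability of that event. *)
suff : mrestr P mF E = mscale k P E by rewrite /mscale kE muleC.
apply: (g_sigma_algebra_measure_unique (cylinder j) _ (fun=> setT)) => //.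
- by move=> F; exact: cylinder_measurable.
- by move=> _; exists (fun=> setT), (fun=> setT); split => //; apply/seteqP; split.
- by rewrite bigcup_const.
- exact: cylinder_setI.
- move=> F [A0 [C0 [mA0 mC0 ->]]].
  pose A1 i := if i == j then A else A0 i.
  pose C1 i := if i == j then C else C0 i.
  have mA1 i : measurable (A1 i) by rewrite /A1; case: ifP.
  have mC1 i : measurable (C1 i) by rewrite /C1; case: ifP.
  rewrite /mrestr /= /mscale kE; have := ind j.+1 _ _ mA1 mC1.
  rewrite big_ord_recr/= {3}/A1 {3}/C1 eqxx
    (eq_bigr (fun i : 'I_j => N (A0 i) * N (C0 i))%E); last first.
    by move=> i _; rewrite /A1 /C1 (ltn_eqF (ltn_ord i)).
  rewrite -(ind j A0 C0)// muleC => <-; congr (P _).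
  apply/seteqP; split => [w [H [Aw Cw]] i /=|w H].
    rewrite ltnS leq_eqVlt => /orP[/eqP ->|ij]; first by rewrite /A1 /C1 eqxx.
    by rewrite /A1 /C1 (ltn_eqF ij); exact: H.
  split => [i /= ij|].
    by have := H i (ltnW ij); rewrite /A1 /C1 (ltn_eqF ij).
  by have := H j (ltnSn j); rewrite /= /A1 /C1 eqxx.
- by move=> _ /=; rewrite (le_lt_trans (probability_le1 _ _))// ?ltry// setTI.
Qed.

Let past j : probability (pastType j) R := law P (@measurable_to_past j).

Lemma measurable_past_pair j (X' Y' : T -> R) : measurable_fun setT X' ->
  measurable_fun setT Y' ->
  measurable_fun setT ((fun w => (w, (X' w, Y' w))) : T -> pastType j * (R * R)).
Proof.
move=> mX' mY'.
apply: (@measurable_fun_pair _ _ _ T (pastType j) (R * R)%type).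
  exact: measurable_to_past.
exact: measurable_fun_pair.
Qed.

(** Stated for an arbitrary pair, so that it covers both the increment and its quarter turn.
    Independence is known for rectangles of the plane only, hence uniqueness on rectangles is used
    twice, once for past times plane and once inside the plane. *)
Lemma past_pair_law j (X' Y' : T -> R) (mX' : measurable_fun setT X')
  (mY' : measurable_fun setT Y') :
  (forall (E : set T) (A C : set R), (<<s cylinder j>>) E ->
    measurable A -> measurable C ->
    P (E `&` [set w | A (X' w) /\ C (Y' w)]) = (P E * (N A * N C))%E) ->
  forall Z : set (pastType j * (R * R)), measurable Z ->
  law P (@measurable_past_pair j _ _ mX' mY') Z = prod_law (past j) (prod_law N N) Z.
Proof.
move=> ind Z mZ; have mXY := measurable_fun_pair mX' mY'.
apply: rectangle_measure_unique => //.
  apply: (@le_lt_trans _ _ 1%E); last exact: ltry.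
  exact: (@probability_le1 _ _ _ (law P (@measurable_past_pair j _ _ mX' mY'))).
move=> E D mE mD; apply: (etrans _ (esym (prod_lawE _ _ mE mD))).
rewrite -[LHS]/(P ((fun w : T => (w, (X' w, Y' w))) @^-1` (E `*` D))).
rewrite [X in (X * _)%E](_ : _ = P E)//.
have mE' := past_measurable mE.
have [k kE] : exists k : {nonneg R}, (k%:num)%:E = P E.
  by exists (NngNum (fine_ge0 (measure_ge0 P E))); rewrite /= fineK// fin_num_measure.
(* With [E] fixed, both sides are now read as finite measures in [D]. *)
have -> : P ((fun w : T => (w, (X' w, Y' w))) @^-1` (E `*` D)) =
   image_measure (mrestr P mE') mXY D.
  rewrite /= /pushforward /mrestr; congr (P _).
  by apply/seteqP; split => w /= [].
rewrite -kE.
have -> : (k%:num%:E * prod_law N N D = mscale k (prod_law N N) D)%E by [].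
apply: rectangle_measure_unique => //.
  by rewrite /= /pushforward /mrestr preimage_setT setTI (le_lt_trans (probability_le1 _ _)) ?ltry.
move=> A C mA mC; rewrite /= /pushforward /mrestr /mscale /= product_measure1E//.
rewrite kE -(ind E)//; congr (P _).
by apply/seteqP; split => w /= [].
Qed.

Context (Nsym : forall A : set R, measurable A -> N (-%R @^-1` A) = N A).

(* Averaging a test function over the four quarter turns of an increment leaves,
   when the function is harmonic, only an error of order four. *)
Lemma quarter_turn_expectation j (H : pastType j * (R * R) -> R) (M : R) :
  measurable_fun setT H -> (forall z, `|H z| <= M) ->
  \int[P]_w H (w, (X j w, Y j w)) = \int[P]_w H (w, (- Y j w, X j w)).
Proof.
move=> mH HM; have [mX mY ind] := iid.
have mNY : measurable_fun setT (fun w => - Y j w) by exact: measurableT_comp.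
have iH (X' Y' : T -> R) : measurable_fun setT X' -> measurable_fun setT Y' ->
    P.-integrable setT ((EFin \o H) \o (fun w => (w, (X' w, Y' w)))).
  move=> mX' mY'; apply: bounded_integrable => //.
    exact: (measurableT_comp mH (@measurable_past_pair j _ _ mX' mY')).
have mEH : measurable_fun setT (EFin \o H) by exact/measurable_EFinP.
rewrite /Rintegral; congr fine.
rewrite -(integral_law (@measurable_past_pair j _ _ (mX j) (mY j)) mEH)//; last exact: iH.
rewrite -(integral_law (@measurable_past_pair j _ _ mNY (mX j)) mEH)//; last exact: iH.
apply: eq_measure_integral => Z mZ _.
(* Jointly with the past, the increment and its quarter turn have the same product law; for the
   turned one this uses the evenness of [N] and the symmetry of the product. *)
transitivity (prod_law (past j) (prod_law N N) Z).
  apply: past_pair_law => // E A C sE mA mC; exact: past_independent.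
apply/esym; apply: past_pair_law => // E A C sE mA mC.
have mNA : measurable (-%R @^-1` A : set R).
  by rewrite -[X in measurable X]setTI; exact: oppr_measurable.
rewrite -(Nsym mA) [X in (_ * X)%E]muleC -(past_independent sE mC mNA).
by congr (P _); apply/seteqP; split => w /= [? []].
Qed.
End past_of_increments.

Lemma Rintegral_sum {R : realType} {d : measure_display} {T : measurableType d}
    (P : probability T R) (F : nat -> T -> R) (n : nat) :
  (forall j, P.-integrable setT (EFin \o F j)) ->
  \int[P]_w (\sum_(j < n) F j w) = \sum_(j < n) \int[P]_w F j w.
Proof.
move=> iF; rewrite /Rintegral; under eq_integral do rewrite -sumEFin.
rewrite (@integral_sum _ _ _ _ _ _ _ (fun j : 'I_n => EFin \o F j))//.
by apply/esym/sum_fine => j _; apply: (integrable_fin_num _ (iF j)).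
Qed.

(** * The planar walk stopped on leaving a disc *)

Section plane_walk.
Context {R : realType} {d : measure_display} {T : measurableType d}.
Context (P : probability T R) (N : probability R R).
Context (X Y : nat -> T -> R) (iid : iid_pairs P N X Y).
Context (Nsym : forall A : set R, measurable A -> N (-%R @^-1` A) = N A).
Context (x0 : R * R).

Definition walk (j : nat) (w : T) : R * R :=
  (x0.1 + \sum_(i < j) X i w, x0.2 + \sum_(i < j) Y i w).

Lemma walkS j w :
  walk j.+1 w = ((walk j w).1 + X j w, (walk j w).2 + Y j w).
Proof. by rewrite /walk !big_ord_recr /= !addrA. Qed.

Lemma walk_past_measurable i j : (i <= j)%N ->
  measurable_fun setT (walk i : pastType X Y j -> R * R).
Proof.
move=> ij; apply: measurable_fun_pair; apply: measurable_funD => //.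
  apply: measurable_sum => k; apply: measurable_past_fst.
  exact: leq_trans (ltn_ord k) ij.
apply: measurable_sum => k; apply: measurable_past_snd.
exact: leq_trans (ltn_ord k) ij.
Qed.

Lemma measurable_walk j : measurable_fun setT (walk j).
Proof.
have [mX mY _] := iid.
by apply: measurable_fun_pair; apply: measurable_funD => //; apply: measurable_sum.
Qed.

Lemma measurable_norm2 : measurable_fun setT (@norm2 R).
Proof.
apply: (@measurableT_comp _ _ _ _ _ _ (@Num.sqrt R)).
  exact: (continuous_measurable_fun (@sqrt_continuous R)).
by apply: measurable_funD; apply: measurable_funX.
Qed.

(** The value is [n] when the walk stays within radius [c] at all indices below [n], so this is a
    bounded stopping index. *)
Definition exit_index (c : R) (n : nat) (w : T) : nat :=
  find (fun j => c < norm2 (walk j w)) (iota 0 n).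

Lemma exit_index_le c n w : (exit_index c n w <= n)%N.
Proof. by rewrite -[leqRHS](size_iota 0 n) find_size. Qed.

(** Only positions up to index [i] occur on the right, which is what makes [exit_index] a stopping
    index. *)
Lemma exit_index_gt c n w i : (i < exit_index c n w)%N =
  (i < n)%N && all (fun k => norm2 (walk k w) <= c) (iota 0 i.+1).
Proof.
have [ni|ni] := leqP n i.
  by apply/negbTE; rewrite -leqNgt (leq_trans (exit_index_le _ _ _)).
rewrite /exit_index ltnNge -ltnS -has_take_leq ?size_iota// take_iota.
by rewrite (minn_idPl ni) -all_predC; apply: eq_all => k /=; rewrite leNgt.
Qed.

Lemma exit_index_exit c n w : (exit_index c n w < n)%N ->
  c < norm2 (walk (exit_index c n w) w).
Proof.
move=> h; have hs : has (fun j => c < norm2 (walk j w)) (iota 0 n).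
  by rewrite has_find size_iota.
by have := nth_find 0%N hs; rewrite nth_iota// add0n.
Qed.

Lemma exit_index_mono c1 c2 n w : c1 <= c2 ->
  (exit_index c1 n w <= exit_index c2 n w)%N.
Proof.
move=> c12; rewrite leqNgt; apply/negP => h.
have := h; rewrite exit_index_gt => /andP[hn /allP ha].
have := exit_index_exit hn; rewrite ltNge (le_trans _ c12)// ha// mem_iota.
by rewrite add0n ltnS leqnn.
Qed.

Lemma exit_index_past_measurable c n i j : (i <= j)%N ->
  measurable_fun setT ((fun w => (i < exit_index c n w)%N) : pastType X Y j -> bool).
Proof.
move=> ij; under eq_fun do rewrite exit_index_gt.
apply: measurable_and => //.
have : {subset iota 0 i.+1 <= [pred k | (k <= j)%N]}.
  by move=> k; rewrite mem_iota add0n ltnS inE => /leq_trans; exact.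
elim: (iota 0 i.+1) => [_|k s IH hs] //=.
apply: measurable_and; last by apply: IH => l ls; apply: hs; rewrite inE ls orbT.
apply: measurable_fun_ler => //; apply: (measurableT_comp measurable_norm2).
by apply: walk_past_measurable; apply: hs; rewrite mem_head.
Qed.

Definition four_point (f : R * R -> R) (p q : R * R) : R :=
  f (p.1 + q.1, p.2 + q.2) + f (p.1 - q.2, p.2 + q.1)
  + f (p.1 - q.1, p.2 - q.2) + f (p.1 + q.2, p.2 - q.1) - 4 * f p.

(** Conditionally on the past, the increment may be turned by any quarter turn, so four times the
    left-hand expectation is that of [V] times [four_point]. The weight vanishes when the walk is
    outside the disc, so the estimate on [f] is only required inside it. The factor 4 is given away
    in the bound. *)
Lemma walk_step_expectation (f : R * R -> R) (M C K c Mv : R) j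
    (V : pastType X Y j -> R) :
  measurable_fun setT f -> (forall p, `|f p| <= M) -> 0 <= C -> 0 <= Mv ->
  (forall p q, norm2 p <= c ->
     `|four_point f p q| <= C * (q.1 ^+ 4 + q.2 ^+ 4)) ->
  (\int[P]_w (X j w ^+ 4 + Y j w ^+ 4)%:E <= K%:E)%E ->
  measurable_fun setT V -> (forall w, `|V w| <= Mv) ->
  (forall w, V w != 0 -> norm2 (walk j w) <= c) ->
  `|\int[P]_w (V w * (f (walk j.+1 w) - f (walk j w)))| <= Mv * C * K.
Proof.
move=> mf fM C0 Mv0 fC XYK mV VM Vc; have [mX mY _] := iid.
pose H (z : pastType X Y j * (R * R)) : R :=
  V z.1 * (f ((walk j z.1).1 + z.2.1, (walk j z.1).2 + z.2.2) - f (walk j z.1)).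
pose rot (z : pastType X Y j * (R * R)) : pastType X Y j * (R * R) :=
  (z.1, (- z.2.2, z.2.1)).
have mrot : measurable_fun setT rot.
  apply: measurable_fun_pair => //; apply: measurable_fun_pair.
    apply: measurableT_comp => //; exact: (measurableT_comp measurable_snd).
  exact: (measurableT_comp measurable_fst).
have mw1 : measurable_fun setT (fun z : pastType X Y j * (R * R) => walk j z.1).
  exact: (measurableT_comp (walk_past_measurable (leqnn j))).
have mH : measurable_fun setT H.
  apply: measurable_funM; first exact: measurableT_comp mV _.
  apply: measurable_funB; last exact: (measurableT_comp mf).
  apply: (measurableT_comp mf); apply: measurable_fun_pair;
    apply: measurable_funD.
  - exact: (measurableT_comp measurable_fst).
  - exact: (measurableT_comp measurable_fst).
  - exact: (measurableT_comp measurable_snd).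
  - exact: (measurableT_comp measurable_snd).
have HM z : `|H z| <= Mv * (M + M).
  by rewrite normrM ler_pM// (le_trans (ler_normB _ _))// lerD.
have mHr g : measurable_fun setT g -> measurable_fun setT (H \o g : pastType X Y j * (R * R) -> R).
  by move=> mg; exact: measurableT_comp.
(* The quarter turn is applied to [H], to [H] after one turn and to [H] after two turns, which makes
   the expectations of [h0], [h1], [h2] and [h3] equal. *)
have E1 := quarter_turn_expectation iid Nsym mH HM.
have E2 := quarter_turn_expectation iid Nsym (mHr _ mrot) (fun z => HM _).
have E3 := quarter_turn_expectation iid Nsym
  (mHr _ (measurableT_comp mrot mrot)) (fun z => HM _).
pose h0 w := H (w, (X j w, Y j w)).
pose h1 w := H (w, (- Y j w, X j w)).
pose h2 w := H (w, (- X j w, - Y j w)).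
pose h3 w := H (w, (Y j w, - X j w)).
have I01 : \int[P]_w h0 w = \int[P]_w h1 w by [].
have I12 : \int[P]_w h1 w = \int[P]_w h2 w by exact: E2.
have I23 : \int[P]_w h2 w = \int[P]_w h3 w.
  by rewrite [LHS]E3; apply: eq_Rintegral => w _; rewrite /= /rot /h3/= opprK.
have mh (U W : T -> R) : measurable_fun setT U -> measurable_fun setT W ->
    measurable_fun setT ((fun w => H (w, (U w, W w))) : T -> R).
  move=> mU mW; exact: (measurableT_comp mH (measurable_past_pair iid mU mW)).
have mNX : measurable_fun setT (fun w => - X j w) by exact: measurableT_comp.
have mNY : measurable_fun setT (fun w => - Y j w) by exact: measurableT_comp.
have mh0 : measurable_fun setT h0 by exact: mh.
have mh1 : measurable_fun setT h1 by exact: mh.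
have mh2 : measurable_fun setT h2 by exact: mh.
have mh3 : measurable_fun setT h3 by exact: mh.
have ih0 : P.-integrable setT (EFin \o h0) by exact: bounded_integrable (fun=> HM _).
have ih1 : P.-integrable setT (EFin \o h1) by exact: bounded_integrable (fun=> HM _).
have ih2 : P.-integrable setT (EFin \o h2) by exact: bounded_integrable (fun=> HM _).
have ih3 : P.-integrable setT (EFin \o h3) by exact: bounded_integrable (fun=> HM _).
have iD (u v : T -> R) : P.-integrable setT (EFin \o u) ->
    P.-integrable setT (EFin \o v) -> P.-integrable setT (EFin \o (u \+ v)).
  by move=> iu iv; have := integrableD measurableT iu iv; exact: eq_integrable.
have ih01 : P.-integrable setT (EFin \o (h0 \+ h1)) by exact: iD.
have ih23 : P.-integrable setT (EFin \o (h2 \+ h3)) by exact: iD.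
pose g := (h0 \+ h1) \+ (h2 \+ h3).
have gE : \int[P]_w g w = 4 * \int[P]_w h0 w.
  rewrite /g RintegralD// !RintegralD// -I23 -I12 -I01; ring.
have mg : measurable_fun setT g by do 2! apply: measurable_funD.
have ig : P.-integrable setT (EFin \o g) by exact: iD.
have gF w : g w = V w * four_point f (walk j w) (X j w, Y j w).
  by rewrite /g /h0 /h1 /h2 /h3 /H /four_point /=; ring.
have gK : `|\int[P]_w g w| <= Mv * C * K.
  rewrite -lee_fin EFin_normr_Rintegral//.
  apply: le_trans (le_abse_integral _ _ _) _ => //; first exact/measurable_EFinP.
  apply: (@le_trans _ _ (\int[P]_w ((Mv * C)%:E * (X j w ^+ 4 + Y j w ^+ 4)%:E))%E).
    have mXY : measurable_fun setT (fun w => X j w ^+ 4 + Y j w ^+ 4).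
      by apply: measurable_funD; exact: measurable_funX.
    apply: ge0_le_integral => //.
    - by apply: measurableT_comp => //; exact/measurable_EFinP.
    - by apply: emeasurable_funM => //; exact/measurable_EFinP.
    - move=> w _; rewrite -EFinM lee_fin gF normrM -mulrA.
      have [->|V0] := eqVneq (V w) 0.
        rewrite normr0 mul0r mulr_ge0// mulr_ge0// addr_ge0// exprn_even_ge0//.
      by rewrite ler_pM//; apply: fC; exact: Vc.
  rewrite ge0_integralZl//.
  - by rewrite [leRHS]EFinM; apply: lee_wpmul2l => //; rewrite lee_fin mulr_ge0.
  - by apply/measurable_EFinP; apply: measurable_funD; exact: measurable_funX.
  - by move=> w _; rewrite lee_fin addr_ge0// exprn_even_ge0.
  - by rewrite lee_fin mulr_ge0.
have -> : \int[P]_w (V w * (f (walk j.+1 w) - f (walk j w))) = \int[P]_w h0 w.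
  by apply: eq_Rintegral => w _; rewrite walkS.
move: gK; rewrite gE normrM ger0_norm//.
have := normr_ge0 (\int[P]_w h0 w); lra.
Qed.

Lemma exit_index_eq_past_measurable c n i j : (i <= j)%N ->
  measurable_fun setT ((fun w => exit_index c n w == i) : pastType X Y j -> bool).
Proof.
move=> ij; case: i ij => [|i] ij.
  under eq_fun do rewrite -leqn0 leqNgt.
  by apply: measurable_neg; exact: exit_index_past_measurable.
under eq_fun do rewrite eqn_leq [X in X && _]leqNgt.
apply: measurable_and; last by apply: exit_index_past_measurable; exact: ltnW.
by apply: measurable_neg; exact: exit_index_past_measurable.
Qed.

(** The index takes finitely many values, so the stopped position is a finite sum of positions at
    fixed indices, each multiplied by the indicator of one value. *)
Lemma measurable_walk_exit_index c n :
  measurable_fun setT (fun w => walk (exit_index c n w) w).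
Proof.
rewrite (_ : (fun w => _) = (fun w => (\sum_(i < n.+1)
    if exit_index c n w == i then (walk i w).1 else 0,
  \sum_(i < n.+1) if exit_index c n w == i then (walk i w).2 else 0))); last first.
  apply/funext => w.
  have h : (exit_index c n w < n.+1)%N by rewrite ltnS exit_index_le.
  have e (F : nat -> R) : \sum_(i < n.+1)
      (if exit_index c n w == i then F i else 0) = F (exit_index c n w).
    rewrite (bigD1 (Ordinal h))//= eqxx big1 ?addr0// => i ni.
    by case: eqP => // ei; case/eqP: ni; apply: val_inj; rewrite /= ei.
  by rewrite (e (fun i => (walk i w).1)) (e (fun i => (walk i w).2)) -surjective_pairing.
have mJ i : measurable_fun setT (fun w => exit_index c n w == i).
  exact: (measurableT_comp (exit_index_eq_past_measurable c n (leqnn i))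
    (measurable_to_past iid (j := i))).
apply: measurable_fun_pair; apply: measurable_sum => i;
  apply: measurable_fun_ifT => //.
  exact: (measurableT_comp measurable_fst (measurable_walk i)).
exact: (measurableT_comp measurable_snd (measurable_walk i)).
Qed.

(** Approximate optional stopping. The increment of [f] between the two exits telescopes over the
    steps [j] after the first exit and before the second. At such steps the value of [g] at the
    first exit is already known, so each step costs at most [Mg * C * K], and there are at most [n]
    of them. *)
Lemma exit_expectation (f g : R * R -> R) (M Mg C K c1 c2 : R) n :
  measurable_fun setT f -> (forall p, `|f p| <= M) ->
  measurable_fun setT g -> (forall p, `|g p| <= Mg) -> 0 <= C -> c1 <= c2 ->
  (forall p q, norm2 p <= c2 ->
     `|four_point f p q| <= C * (q.1 ^+ 4 + q.2 ^+ 4)) ->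
  (forall j, \int[P]_w (X j w ^+ 4 + Y j w ^+ 4)%:E <= K%:E)%E ->
  `|\int[P]_w (g (walk (exit_index c1 n w) w) *
     (f (walk (exit_index c2 n w) w) - f (walk (exit_index c1 n w) w)))|
  <= n%:R * (Mg * C * K).
Proof.
move=> mf fM mg gM C0 c12 fC XYK.
have Mg0 : 0 <= Mg by exact: le_trans (gM (0, 0)).
pose V j w := if (exit_index c1 n w <= j < exit_index c2 n w)%N
  then g (walk (exit_index c1 n w) w) else 0.
(* Splitting by the value [i] of the first exit index shows that the weight depends on the first [j]
   increments only. *)
have VE j w : V j w = \sum_(i < j.+1)
    if (exit_index c1 n w == i) && (j < exit_index c2 n w)%N then g (walk i w) else 0.
  rewrite /V; have [h|h] := leqP (exit_index c1 n w) j; last first.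
    rewrite big1// => i _; case: eqP => //= e.
    by move: h; rewrite e ltnNge -ltnS ltn_ord.
  rewrite /= (bigD1 (Ordinal (h : exit_index c1 n w < j.+1)%N))//= eqxx /=.
  rewrite big1 ?addr0// => i ni; case: eqP => //= e.
  by case/eqP: ni; apply: val_inj; rewrite /= e.
have mV j : measurable_fun setT (V j : pastType X Y j -> R).
  rewrite (_ : V j = fun w => \sum_(i < j.+1)
    if (exit_index c1 n w == i) && (j < exit_index c2 n w)%N then g (walk i w) else 0); last first.
    by apply/funext => w; exact: VE.
  apply: measurable_sum => i; apply: measurable_fun_ifT => //.
    apply: measurable_and; last exact: exit_index_past_measurable.
    by apply: exit_index_eq_past_measurable; rewrite -ltnS.
  apply: (measurableT_comp mg); apply: walk_past_measurable.
  by rewrite -ltnS.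
have VM j w : `|V j w| <= Mg by rewrite /V; case: ifP; rewrite ?normr0.
(* A step taken before the second exit starts within radius [c2]. *)
have Vc j w : V j w != 0 -> norm2 (walk j w) <= c2.
  rewrite /V; case: ifP; rewrite ?eqxx// => /andP[_].
  rewrite exit_index_gt => /andP[_ /allP h] _; apply: h.
  by rewrite mem_iota add0n ltnS leqnn.
have step j := walk_step_expectation mf fM C0 Mg0 fC (XYK j) (mV j) (VM j) (Vc j).
have telescope w : g (walk (exit_index c1 n w) w) *
    (f (walk (exit_index c2 n w) w) - f (walk (exit_index c1 n w) w)) =
    \sum_(j < n) V j w * (f (walk j.+1 w) - f (walk j w)).
  have J12 := exit_index_mono n w c12; have J2n := exit_index_le c2 n w.
  rewrite -(telescope_sumr (fun j => f (walk j w)) J12) mulr_sumr.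
  rewrite (big_nat_widenl _ 0)//= (big_nat_widen _ _ n)//= big_mkord big_mkcond /=.
  by apply: eq_bigr => j _; rewrite /V; case: ifP; rewrite // mul0r.
have mw j : measurable_fun setT (fun w => f (walk j w)).
  exact: (measurableT_comp mf (measurable_walk j)).
have iV j : P.-integrable setT
    (EFin \o (fun w => V j w * (f (walk j.+1 w) - f (walk j w)))).
  apply: (@bounded_integrable _ _ _ P _ (Mg * (M + M))).
    apply: measurable_funM; last exact: measurable_funB.
    exact: (measurableT_comp (mV j) (measurable_to_past iid (j := j))).
  by move=> w; rewrite normrM ler_pM// (le_trans (ler_normB _ _))// lerD.
rewrite (eq_Rintegral _ (fun w _ => telescope w)) (Rintegral_sum n iV).
apply: le_trans (ler_norm_sum _ _ _) _.
rewrite mulr_natl -[X in _ *+ X]card_ord -sumr_const.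
by apply: ler_sum => j _; exact: step.
Qed.

End plane_walk.

(** * The Poisson function of the plane and its four-point estimate *)

Section poisson_function.
Context {R : realType}.
Local Open Scope complex_scope.
Import ComplexField ComplexField.Normc.

(** As a function of [p], the Poisson kernel with its pole at distance [1 / t] in direction [a]; on
    a circle of radius [r] it becomes [pkernel (t * r)] of the angle relative to [a]. *)
Definition poisson (t a : R) (p : R * R) : R :=
  (1 - t ^+ 2 * (p.1 ^+ 2 + p.2 ^+ 2)) /
  (1 + t ^+ 2 * (p.1 ^+ 2 + p.2 ^+ 2) - 2 * t * (p.1 * cos a + p.2 * sin a)).

Let z (p : R * R) : R[i] := p.1 +i* p.2.
(** The complex number of modulus [t] and argument [- a], for [t >= 0]. The denominator of [poisson]
    is then the squared modulus of [1 - tau t a * z p]. *)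
Let tau (t a : R) : R[i] := (t * cos a) +i* (- (t * sin a)).

Lemma normc_pair p : normc (z p) = norm2 p.
Proof. by []. Qed.

Lemma normc_tau t a : 0 <= t -> normc (tau t a) = t.
Proof.
move=> t0; rewrite /tau /= sqrrN !exprMn -mulrDr cos2Dsin2 mulr1 sqrtr_sqr.
exact: ger0_norm.
Qed.

Lemma Re_normc (x : R[i]) : `|complex.Re x| <= normc x.
Proof.
by case: x => a b /=; rewrite -sqrtr_sqr ler_wsqrtr// lerDl sqr_ge0.
Qed.

Lemma normc_ge0 (x : R[i]) : 0 <= normc x.
Proof. by case: x => a b /=; exact: sqrtr_ge0. Qed.

Lemma normc_gt0_neq0 (x : R[i]) : 0 < normc x -> x != 0.
Proof. by apply: contraTneq => ->; rewrite normc0 ltxx. Qed.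

Lemma ler_normcB (x y : R[i]) : normc x - normc y <= normc (x - y).
Proof. by rewrite lerBlDr; have := le_normcD (x - y) y; rewrite subrK. Qed.

Lemma poisson_den (t a : R) (p : R * R) :
  1 + t ^+ 2 * (p.1 ^+ 2 + p.2 ^+ 2) - 2 * t * (p.1 * cos a + p.2 * sin a) =
  (1 - (t * cos a * p.1 + t * sin a * p.2)) ^+ 2 +
    (t * sin a * p.1 - t * cos a * p.2) ^+ 2.
Proof.
have -> : 1 + t ^+ 2 * (p.1 ^+ 2 + p.2 ^+ 2) =
  1 + (cos a ^+ 2 + sin a ^+ 2) * (t ^+ 2 * (p.1 ^+ 2 + p.2 ^+ 2)).
  by rewrite cos2Dsin2 mul1r.
ring.
Qed.

Lemma normc_poisson_gt (t a : R) (p : R * R) : 0 <= t ->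
  1 - t * norm2 p <= normc (1 - tau t a * z p).
Proof.
move=> t0; apply: le_trans (ler_normcB _ _).
by rewrite normcM normc_tau// normc1 normc_pair.
Qed.

Lemma poisson_den_gt0 (t a : R) (p : R * R) : 0 <= t -> t * norm2 p < 1 ->
  0 < 1 + t ^+ 2 * (p.1 ^+ 2 + p.2 ^+ 2) - 2 * t * (p.1 * cos a + p.2 * sin a).
Proof.
move=> t0 tp; have := @normc_poisson_gt t a p t0.
rewrite /normc /tau /z /= add0r poisson_den.
have -> : 1 - (t * cos a * p.1 - - (t * sin a) * p.2)
  = 1 - (t * cos a * p.1 + t * sin a * p.2) by ring.
have -> : - (t * cos a * p.2 + - (t * sin a) * p.1) =
  t * sin a * p.1 - t * cos a * p.2 by ring.
move=> h; rewrite -sqrtr_gt0; apply: lt_le_trans h; lra.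
Qed.

(** With [w = tau t a * z p] the kernel is the real part of [(1 + w) / (1 - w) = 2 / (1 - w) - 1].
    Harmonicity thus reduces to algebra with complex inverses. *)
Lemma poissonE (t a : R) (p : R * R) : 0 <= t -> t * norm2 p < 1 ->
  poisson t a p = 2 * complex.Re (1 - tau t a * z p)^-1 - 1.
Proof.
move=> t0 tp; have := @poisson_den_gt0 t a p t0 tp.
have -> : poisson t a p = (2 * (1 - (t * cos a * p.1 + t * sin a * p.2))) /
  (1 + t ^+ 2 * (p.1 ^+ 2 + p.2 ^+ 2) - 2 * t * (p.1 * cos a + p.2 * sin a)) - 1.
  rewrite /poisson; have := @poisson_den_gt0 t a p t0 tp.
  move=> /gt_eqF/negbT D0.
  apply: (canLR (mulfK D0)); rewrite mulrBl divfK//; ring.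
rewrite poisson_den => D0; rewrite /tau /z /= -mulrA; congr (_ * (_ / _) - _); ring.
Qed.

(** Summing the inverses over the four turns of [W] gives exactly [4 U^3 / (U^4 - W^4)], so the
    defect is [4 W^4 / (U (U^4 - W^4))]. From [2 |W| <= |U|] follows [|U^4 - W^4| >= 15/16 |U|^4],
    and [4 * 16/15 <= 5]. *)
Lemma four_point_inverse (U W : R[i]) : 2 * normc W <= normc U -> 0 < normc U ->
  `|complex.Re ((U - W)^-1 + (U - 'i * W)^-1 + (U + W)^-1 + (U + 'i * W)^-1
       - 4 * U^-1)|
  <= 5 * normc W ^+ 4 / normc U ^+ 5.
Proof.
move=> WU U0; apply: le_trans (Re_normc _) _.
have W0 := normc_ge0 W.
have i2 : 'i ^+ 2 = -1 :> R[i] by exact: sqr_i.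
have ni : normc ('i : R[i]) = 1 by rewrite /= expr0n add0r expr1n sqrtr1.
have nz V : normc V <= normc W -> U - V != 0.
  move=> VW; apply: normc_gt0_neq0; apply: lt_le_trans (ler_normcB _ _); lra.
have n1 := nz W (lexx _).
have n2 : U - 'i * W != 0 by apply: nz; rewrite normcM ni mul1r.
have n3 : U + W != 0 by rewrite -[W]opprK; apply: nz; rewrite normcN.
have n4 : U + 'i * W != 0.
  by rewrite -['i * W]opprK; apply: nz; rewrite normcN normcM ni mul1r.
have nU := normc_gt0_neq0 U0.
have n13 : U ^+ 2 - W ^+ 2 != 0 by rewrite subr_sqr mulf_neq0.
have n24E : U ^+ 2 + W ^+ 2 = (U - 'i * W) * (U + 'i * W).
  by rewrite -subr_sqr exprMn i2 mulN1r opprK.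
have n24 : U ^+ 2 + W ^+ 2 != 0 by rewrite n24E mulf_neq0.
have E1 : (U - W)^-1 + (U + W)^-1 = 2 * U / (U ^+ 2 - W ^+ 2).
  by field; rewrite n13 n1 n3.
have E2 : (U - 'i * W)^-1 + (U + 'i * W)^-1 = 2 * U / (U ^+ 2 + W ^+ 2).
  by rewrite n24E; field; rewrite n2 n4.
have -> : (U - W)^-1 + (U - 'i * W)^-1 + (U + W)^-1 + (U + 'i * W)^-1 - 4 * U^-1
   = 4 * (W ^+ 4) * (U * ((U ^+ 2 - W ^+ 2) * (U ^+ 2 + W ^+ 2)))^-1.
  have -> : (U - W)^-1 + (U - 'i * W)^-1 + (U + W)^-1 + (U + 'i * W)^-1 =
    ((U - W)^-1 + (U + W)^-1) + ((U - 'i * W)^-1 + (U + 'i * W)^-1) by ring.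
  by rewrite E1 E2; field; rewrite nU n13 n24.
have nX (x : R[i]) k : normc (x ^+ k) = normc x ^+ k.
  by elim: k => [|k IH]; rewrite ?normc1// !exprS normcM IH.
have n4E : normc (4 : R[i]) = 4.
  by rewrite (_ : 4 = (1 : R[i]) *+ 4)// normcMn normc1.
have -> : (U ^+ 2 - W ^+ 2) * (U ^+ 2 + W ^+ 2) = U ^+ 4 - W ^+ 4 by ring.
rewrite normcM normcV [normc (4 * _)]normcM [normc (U * _)]normcM n4E nX.
have UW4 : 16 * normc W ^+ 4 <= normc U ^+ 4.
  rewrite (_ : 16 * _ = (2 * normc W) ^+ 4); last by ring.
  by rewrite lerXn2r ?nnegrE ?mulr_ge0// normc_ge0.
have D1 : 15 / 16 * normc U ^+ 4 <= normc (U ^+ 4 - W ^+ 4).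
  by apply: le_trans (ler_normcB _ _); rewrite !nX; lra.
have U4 : 0 < normc U ^+ 4 by rewrite exprn_gt0.
have W4 : 0 <= normc W ^+ 4 by rewrite exprn_ge0.
have D0 : 0 < normc (U ^+ 4 - W ^+ 4) by apply: lt_le_trans D1; lra.
rewrite -[5 * _ / _]mulrA -[4 * _ / _]mulrA.
set D := normc (U ^+ 4 - W ^+ 4) in D0 D1 *; set u := normc U in U0 U4 D1 *.
have -> : (u ^+ 5)^-1 = u^-1 * (u ^+ 4)^-1 by rewrite exprS invfM.
have DU : D^-1 <= 16 / 15 * (u ^+ 4)^-1.
  rewrite -[16 / 15]invrK -invfM lef_pV2 ?posrE//; last by rewrite mulr_gt0//; lra.
  by rewrite invf_div.
have ui : 0 < u^-1 by rewrite invr_gt0.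
have u4i : 0 < (u ^+ 4)^-1 by rewrite invr_gt0.
rewrite invfM.
have : normc W ^+ 4 * u^-1 * D^-1 <= normc W ^+ 4 * u^-1 * (16 / 15 * (u ^+ 4)^-1).
  by apply: ler_wpM2l => //; rewrite mulr_ge0// ltW.
have : 0 <= normc W ^+ 4 * u^-1 * (u ^+ 4)^-1 by rewrite !mulr_ge0// ltW.
move: (normc W ^+ 4) (u^-1) (D^-1) ((u ^+ 4)^-1) => A B' C' D'; lra.
Qed.

(** A bounded function on the whole plane as soon as [t * r < 1], whatever the overshoot of the
    walk. It may jump at radius [r], which is always chosen beyond the disc of interest. *)
Definition poisson_cut (r t a : R) (p : R * R) : R :=
  if norm2 p <= r then poisson t a p else 0.

Lemma norm2_ge0 (p : R * R) : 0 <= norm2 p. Proof. exact: sqrtr_ge0. Qed.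

Lemma norm2D (p q : R * R) : norm2 (p.1 + q.1, p.2 + q.2) <= norm2 p + norm2 q.
Proof. exact: (le_normcD (z p) (z q)). Qed.

Lemma poisson_cut_bounded (r t a : R) (p : R * R) : 0 <= t -> t * r < 1 ->
  `|poisson_cut r t a p| <= 2 / (1 - t * r) + 1.
Proof.
move=> t0 tr; have tr0 : 0 < 1 - t * r by lra.
rewrite /poisson_cut; case: ifPn => [pr|_]; last first.
  by rewrite normr0 addr_ge0// divr_ge0// ltW.
have tp : t * norm2 p <= t * r by rewrite ler_wpM2l.
rewrite poissonE//; last exact: le_lt_trans tr.
apply: le_trans (ler_normB _ _) _; rewrite normr1 lerD2r normrM ger0_norm//.
rewrite ler_wpM2l//; apply: le_trans (Re_normc _) _.
have := @normc_poisson_gt t a p t0 => h; rewrite normcV lef_pV2 ?posrE//; last first.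
  by apply: lt_le_trans h; lra.
by apply: le_trans h; lra.
Qed.

(** Small increments keep all five points inside the cut, where [four_point_inverse] applies. For
    large ones the crude bound [8 * M] is already dominated by a multiple of the fourth power of
    [norm2 q], so neither the jump nor the pole matters. *)
Lemma poisson_cut_four_point (r t a c : R) : 0 <= t -> c < r -> t * r < 1 ->
  exists2 C, 0 <= C & forall p q, norm2 p <= c ->
    `|four_point (poisson_cut r t a) p q| <= C * (q.1 ^+ 4 + q.2 ^+ 4).
Proof.
move=> t0 cr tr.
have m0 : 0 < 1 - t * r by lra.
set m := 1 - t * r in m0.
pose M := 2 / m + 1.
have M0 : 0 <= M by rewrite /M addr_ge0// divr_ge0// ltW.
(* The first term keeps the displaced points within radius [r]; the second ensures [2 |W| <= |U|],
   since [|W| = t * norm2 q] and [|U| >= m]. *)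
pose delta := Num.min (r - c) (m / (2 * (t + 1))).
have delta0 : 0 < delta.
  by rewrite /delta lt_min subr_gt0 cr divr_gt0// mulr_gt0// ltr_wpDl.
(* Here [20 = 2 * 5 * 2]: the factor 2 of [poissonE], the 5 of [four_point_inverse], and the 2 in
   [norm2 q ^+ 4 <= 2 * (q.1 ^+ 4 + q.2 ^+ 4)]. The last factor also turns [8 * M] into [16 * M]. *)
exists (20 * t ^+ 4 / m ^+ 5 + 16 * M / delta ^+ 4).
  by rewrite addr_ge0// divr_ge0// ?mulr_ge0 ?exprn_ge0// ltW.
move=> p q pc.
have q4 : norm2 q ^+ 4 <= 2 * (q.1 ^+ 4 + q.2 ^+ 4).
  rewrite /norm2 (exprM _ 2 2) sqr_sqrtr ?addr_ge0 ?sqr_ge0//.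
  have := sqr_ge0 (q.1 ^+ 2 - q.2 ^+ 2); rewrite -subr_ge0 => h.
  by rewrite -subr_ge0; apply: le_trans h _; rewrite le_eqVlt; apply/orP; left; apply/eqP; ring.
have A1 : 0 <= 20 * t ^+ 4 / m ^+ 5.
  by rewrite divr_ge0// ?mulr_ge0 ?exprn_ge0// ltW.
have A2 : 0 <= 16 * M / delta ^+ 4.
  by rewrite divr_ge0// ?mulr_ge0 ?exprn_ge0// ltW.
have Q0 : 0 <= q.1 ^+ 4 + q.2 ^+ 4 by rewrite addr_ge0// exprn_even_ge0.
have [qd|qd] := leP (norm2 q) delta; last first.
  have fM x : `|poisson_cut r t a x| <= M by exact: poisson_cut_bounded.
  apply: (@le_trans _ _ (8 * M)).
    rewrite /four_point.
    move: (fM (p.1 + q.1, p.2 + q.2)) (fM (p.1 - q.2, p.2 + q.1))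
      (fM (p.1 - q.1, p.2 - q.2)) (fM (p.1 + q.2, p.2 - q.1)) (fM p).
    rewrite !ler_norml; move=> /andP[? ?] /andP[? ?] /andP[? ?] /andP[? ?] /andP[? ?].
    by apply/andP; split; lra.
  apply: (@le_trans _ _ (16 * M / delta ^+ 4 * (q.1 ^+ 4 + q.2 ^+ 4))); last first.
    by apply: ler_wpM2r => //; rewrite lerDr.
  rewrite mulrAC ler_pdivlMr ?exprn_gt0//.
  have : delta ^+ 4 <= norm2 q ^+ 4.
    by rewrite lerXn2r ?nnegrE ?norm2_ge0// ltW.
  move=> h; have {}h : delta ^+ 4 <= 2 * (q.1 ^+ 4 + q.2 ^+ 4) by exact: le_trans q4.
  have := ler_wpM2l M0 h; lra.
have qr : norm2 q <= r - c by apply: le_trans qd _; rewrite /delta ge_min lexx.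
have qm : norm2 q <= m / (2 * (t + 1)).
  by apply: le_trans qd _; rewrite /delta ge_min lexx orbT.
pose U := 1 - tau t a * z p; pose W := tau t a * z q.
have Wq : normc W = t * norm2 q by rewrite normcM normc_tau.
have Um : m <= normc U.
  apply: le_trans (normc_poisson_gt a p t0).
  by rewrite lerB// ler_wpM2l// (le_trans pc)// ltW.
have cutE q' : norm2 q' = norm2 q ->
    poisson_cut r t a (p.1 + q'.1, p.2 + q'.2) =
    2 * complex.Re (U - tau t a * z q')^-1 - 1.
  move=> q'q; have pqr : norm2 (p.1 + q'.1, p.2 + q'.2) <= r.
    by apply: le_trans (norm2D _ _) _; rewrite q'q; lra.
  rewrite /poisson_cut pqr poissonE//.
    congr (2 * complex.Re _^-1 - 1); rewrite /U -addrA -opprD -mulrDr.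
    by congr (1 - _ * _).
  by apply: le_lt_trans tr; rewrite ler_wpM2l.
have e0 := cutE q erefl.
have e1 : poisson_cut r t a (p.1 - q.2, p.2 + q.1) =
    2 * complex.Re (U - 'i * W)^-1 - 1.
  rewrite (cutE (- q.2, q.1)); last by rewrite /norm2 /= sqrrN addrC.
  have -> : z (- q.2, q.1) = 'i * z q by rewrite /z; simpc.
  by rewrite [tau _ _ * ('i * _)]mulrCA.
have e2 : poisson_cut r t a (p.1 - q.1, p.2 - q.2) =
    2 * complex.Re (U + W)^-1 - 1.
  rewrite (cutE (- q.1, - q.2)); last by rewrite /norm2 /= !sqrrN.
  have -> : z (- q.1, - q.2) = - z q by rewrite /z; simpc.
  by rewrite mulrN opprK.
have e3 : poisson_cut r t a (p.1 + q.2, p.2 - q.1) =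
    2 * complex.Re (U + 'i * W)^-1 - 1.
  rewrite (cutE (q.2, - q.1)); last by rewrite /norm2 /= sqrrN addrC.
  have -> : z (q.2, - q.1) = - ('i * z q) by rewrite /z; simpc.
  by rewrite mulrN opprK [tau _ _ * ('i * _)]mulrCA.
have e4 : poisson_cut r t a p = 2 * complex.Re U^-1 - 1.
  rewrite /poisson_cut (le_trans pc (ltW cr)) poissonE//.
  by apply: le_lt_trans tr; rewrite ler_wpM2l// (le_trans pc)// ltW.
have U0 : 0 < normc U by exact: lt_le_trans Um.
have WU : 2 * normc W <= normc U.
  apply: le_trans Um; rewrite Wq.
  have t1 : 0 < t + 1 by rewrite ltr_wpDl.
  move: qm; rewrite ler_pdivlMr ?mulr_gt0// => qm.
  have := norm2_ge0 q; lra.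
have := four_point_inverse WU U0.
have -> : four_point (poisson_cut r t a) p q = 2 * complex.Re
   ((U - W)^-1 + (U - 'i * W)^-1 + (U + W)^-1 + (U + 'i * W)^-1 - 4 * U^-1).
  rewrite /four_point e0 e1 e2 e3 e4 -[tau t a * z q]/W.
  move: ((U - W)^-1) ((U - 'i * W)^-1) ((U + W)^-1) ((U + 'i * W)^-1) (U^-1).
  move=> [x0 y0] [x1 y1] [x2 y2] [x3 y3] [x4 y4].
  rewrite (_ : 4 = 4%:C :> R[i]); last by rewrite rmorph_nat.
  by simpc => /=; ring.
move=> h; rewrite normrM ger0_norm//.
apply: le_trans (ler_wpM2l _ h) _ => //.
have UmI : (normc U ^+ 5)^-1 <= (m ^+ 5)^-1.
  by rewrite lef_pV2 ?posrE ?exprn_gt0// lerXn2r ?nnegrE// ltW.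
have W4 : normc W ^+ 4 <= t ^+ 4 * (2 * (q.1 ^+ 4 + q.2 ^+ 4)).
  by rewrite Wq exprMn ler_wpM2l// exprn_ge0.
apply: (@le_trans _ _ (20 * t ^+ 4 / m ^+ 5 * (q.1 ^+ 4 + q.2 ^+ 4))); last first.
  by apply: ler_wpM2r => //; rewrite lerDl.
have W40 : 0 <= normc W ^+ 4 by rewrite exprn_ge0// normc_ge0.
have mi : 0 <= (m ^+ 5)^-1 by rewrite invr_ge0 exprn_ge0// ltW.
have h1 : normc W ^+ 4 * (normc U ^+ 5)^-1 <= normc W ^+ 4 * (m ^+ 5)^-1 by apply: ler_wpM2l.
have h2 : normc W ^+ 4 * (m ^+ 5)^-1 <= t ^+ 4 * (2 * (q.1 ^+ 4 + q.2 ^+ 4)) * (m ^+ 5)^-1.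
  by apply: ler_wpM2r.
have := le_trans h1 h2.
move: (normc W ^+ 4) ((normc U ^+ 5)^-1) ((m ^+ 5)^-1) => A B' C'; lra.
Qed.

End poisson_function.

(** * Measures with a density, and uniqueness of measures on the line *)

Section density.
Context {R : realType} {d : measure_display} {T : measurableType d}.
Context (mu : {measure set T -> \bar R}).
Context (p : T -> R) (mp : measurable_fun setT p) (p0 : forall x, 0 <= p x).

Definition density (A : set T) : \bar R := (\int[mu]_(x in A) (p x)%:E)%E.

Let density0 : density set0 = 0%E.
Proof. by rewrite /density integral_set0. Qed.

Let density_ge0 A : (0 <= density A)%E.
Proof. by apply: integral_ge0 => x _; rewrite lee_fin. Qed.

Let density_sigma_additive : semi_sigma_additive density.
Proof.
move=> /= F mF tF mUF; rewrite /density; apply: cvg_toP.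
  apply: ereal_nondecreasing_is_cvgn => m n mn.
  apply: lee_sum_nneg_natr => // k _ _.
  by apply: integral_ge0 => /= x Fkx; rewrite lee_fin.
rewrite ge0_integral_bigcup//=.
- by apply: measurable_funTS; exact/measurable_EFinP.
- by move=> x _; rewrite lee_fin.
Qed.

HB.instance Definition _ := isMeasure.Build _ _ _ density
  density0 density_ge0 density_sigma_additive.

Definition density_measure : {measure set T -> \bar R} := density.

End density.

Section integral_density.
Context {R : realType} {d : measure_display} {T : measurableType d}.
Context (mu nu : {measure set T -> \bar R}).
Context (p : T -> R) (mp : measurable_fun setT p) (p0 : forall x, 0 <= p x).
Context (nuE : forall A, measurable A ->
  nu A = (\int[mu]_(x in A) (p x)%:E)%E).
Local Open Scope ereal_scope.

Import HBNNSimple.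

Let integral_density_nnsfun (f : {nnsfun T >-> R}) :
  \int[nu]_x (f x)%:E = \int[mu]_x ((f x)%:E * (p x)%:E).
Proof.
under [LHS]eq_integral do rewrite fimfunE -fsumEFin//.
rewrite [LHS]ge0_integral_fsum//; last 2 first.
  - by move=> r; exact/measurable_EFinP/measurableT_comp.
  - by move=> n x _; rewrite EFinM nnfun_muleindic_ge0.
under [RHS]eq_integral.
  move=> x xD; rewrite fimfunE -fsumEFin// muleC ge0_mule_fsumr; last first.
    by move=> r; rewrite EFinM nnfun_muleindic_ge0.
  over.
rewrite [RHS]ge0_integral_fsum//; last 2 first.
  - move=> r; apply: emeasurable_funM; first exact/measurable_EFinP.
    by apply/measurable_EFinP; exact/measurableT_comp.
  - by move=> n x _; rewrite EFinM mule_ge0//; [rewrite lee_fin|rewrite nnfun_muleindic_ge0].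
apply: eq_fsbigr => r rf.
rewrite [LHS]integralZl_indic_nnsfun// integral_indic//= setIT nuE//.
have r0 : (0 <= r)%R by move: rf; rewrite inE => -[x _ <-].
rewrite integral_mkcond -ge0_integralZl//.
- apply: eq_integral => x _; rewrite /= patchE indicE.
  by case: (x \in _); rewrite /= ?mulr1 ?mulr0 ?mule0//; rewrite muleC.
- by apply/(measurable_restrictT _ _).1 => //; apply: measurable_funTS; exact/measurable_EFinP.
- by move=> x _; rewrite patchE; case: ifPn => // _; rewrite lee_fin.
Qed.

(** Simple functions first, then monotone convergence on both sides. *)
Lemma integral_density (f : T -> \bar R) :
  measurable_fun setT f -> (forall x, 0 <= f x) ->
  \int[nu]_x f x = \int[mu]_x (f x * (p x)%:E).
Proof.
move=> mf f0; pose f_ := nnsfun_approx measurableT mf.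
transitivity (lim (\int[nu]_x (f_ n x)%:E @[n --> \oo])).
  rewrite -monotone_convergence//=.
  - apply: eq_integral => ? /[!inE] xD; apply/esym/cvg_lim => //=.
    exact: cvg_nnsfun_approx.
  - by move=> n; exact/measurable_EFinP/measurable_funTS.
  - by move=> n ? _; rewrite lee_fin.
  - by move=> ? _ ? ? mn; rewrite lee_fin; exact/lefP/nd_nnsfun_approx.
transitivity (lim (\int[mu]_x ((f_ n x)%:E * (p x)%:E) @[n --> \oo])).
  by apply: congr_lim; apply/funext => n /=; exact: integral_density_nnsfun.
rewrite -monotone_convergence//=.
- apply: eq_integral => x /[!inE] xD; apply/cvg_lim => //.
  apply: cvgeZr => //; exact: cvg_nnsfun_approx.
- move=> n; apply: emeasurable_funM; last exact/measurable_EFinP.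
  exact/measurable_EFinP/measurable_funTS.
- by move=> n ? _; rewrite mule_ge0 ?lee_fin.
- move=> ? _ ? ? mn; apply: lee_wpmul2r; rewrite ?lee_fin//.
  exact/lefP/nd_nnsfun_approx.
Qed.

End integral_density.

(** Open rays generate the Borel sets and are stable under intersection; the whole line is adjoined
    to them as a covering set of finite measure. *)
Lemma rays_measure_unique {R : realType} (m1 m2 : {measure set (measurableTypeR R) -> \bar R}) :
  m1 setT = m2 setT -> (m1 setT < +oo)%E ->
  (forall x : R, m1 `]x, +oo[%classic = m2 `]x, +oo[%classic) ->
  forall A : set (measurableTypeR R), measurable A -> m1 A = m2 A.
Proof.
move=> mT moo mr.
pose G : set (set (measurableTypeR R)) := [set A | A = setT \/ exists x, A = `]x, +oo[%classic].
move=> A mA; apply: (measure_unique G (fun=> setT)) => //.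
- rewrite [LHS](_ : _ = (@RGenOInfty.G R).-sigma.-measurable); last first.
    exact: RGenOInfty.measurableE.
  apply/seteqP; split; apply: smallest_sub;
    try exact: smallest_sigma_algebra.
  + by move=> B [x ->]; apply: sub_sigma_algebra; right; exists x.
  + move=> B [->|[x ->]]; first exact: measurableT.
    by apply: sub_sigma_algebra; exists x.
- move=> B C [->|[x ->]] [->|[y ->]]; rewrite ?setTI ?setIT; try (by left); try (by right; eexists).
  right; exists (Num.max x y).
  apply/seteqP; split => z /=; rewrite !in_itv/= !andbT gt_max.
    by move=> [-> ->].
  by move=> /andP[].
- by move=> _; left.
- by rewrite bigcup_const.
- by move=> B [->|[x ->]].
Qed.

(** * Symmetry, fourth moment and small intervals of the centered normal law *)

Section centered_normal.
Context {R : realType}.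
Notation mu := (@lebesgue_measure R).

(** [normal_prob] transported along the identity to the measurable structure of [R] that the walk
    uses; the values are unchanged by conversion. *)
Definition gauss (s : R) : probability R R :=
  law (@normal_prob R 0 s) (@measurable_id _ (measurableTypeR R) setT :
    measurable_fun setT (id : measurableTypeR R -> R)).

Lemma gaussE (s : R) A : gauss s A = normal_prob 0 s A.
Proof. by []. Qed.

Lemma normal_pdf_even (s x : R) : s != 0 -> normal_pdf 0 s (- x) = normal_pdf 0 s x.
Proof.
by move=> s0; rewrite !normal_pdfE// /normal_fun !subr0 sqrrN.
Qed.

Lemma gauss_even (s : R) : s != 0 -> forall A : set R, measurable A ->
  gauss s (-%R @^-1` A) = gauss s A.
Proof.
move=> s0 A mA.
have mN : measurable_fun setT (-%R : measurableTypeR R -> measurableTypeR R).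
  exact: oppr_measurable.
rewrite -[LHS]/(law (@normal_prob R 0 s) mN A) -[RHS]/(normal_prob 0 s A).
apply: (@rays_measure_unique R (law (@normal_prob R 0 s) mN) (@normal_prob R 0 s)) => //.
  by rewrite (le_lt_trans (probability_le1 _ _)) ?ltry.
move=> x; rewrite -[LHS]/(normal_prob 0 s (-%R @^-1` `]x, +oo[)).
have -> : (-%R @^-1` `]x, +oo[ = `]-oo, (- x)[)%classic.
  by apply/seteqP; split => y /=; rewrite !in_itv/= !andbT ltrNr.
have mpdf : measurable_fun setT (EFin \o @normal_pdf R 0 s).
  by apply/measurable_EFinP; exact: measurable_normal_pdf.
rewrite /normal_prob integral_itv_bndo_bndc; last exact: measurable_funTS.
rewrite ge0_integration_by_substitutionNy.
- rewrite -integral_itv_obnd_cbnd; last first.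
    apply: measurable_funTS; apply/measurable_EFinP.
    by apply: measurableT_comp => //; exact: measurable_normal_pdf.
  by apply: eq_integral => y _; rewrite /= normal_pdf_even.
- by apply: continuous_subspaceT; exact: continuous_normal_pdf.
- by move=> y _; exact: normal_pdf_ge0.
Qed.

Lemma normal_integral_density (s : R) (f : measurableTypeR R -> \bar R) :
  measurable_fun setT f -> (forall x, 0 <= f x)%E ->
  (\int[normal_prob 0 s]_x f x = \int[mu]_x (f x * (normal_pdf 0 s x)%:E))%E.
Proof.
move=> mf f0.
apply: (@integral_density R _ _ mu (@normal_prob R 0 s) (normal_pdf 0 s)) => //.
- exact: measurable_normal_pdf.
- exact: normal_pdf_ge0.
Qed.

(* [x ^+ 4 <= 64 s ^+ 4 expR (x ^+ 2 / (4 s ^+ 2))], which trades the fourth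
   power for a doubling of the variance. *)
Lemma normal_fourth_moment (s : R) : 0 < s ->
  (\int[normal_prob 0 s]_x (x ^+ 4)%:E <= (128 * s ^+ 4)%:E)%E.
Proof.
move=> s0; have s0' : s != 0 by rewrite gt_eqF.
pose u := s * Num.sqrt 2.
have q2 : 0 < Num.sqrt 2 :> R by rewrite sqrtr_gt0.
have u0 : 0 < u by rewrite mulr_gt0.
have u2 : u ^+ 2 = s ^+ 2 * 2 by rewrite exprMn sqr_sqrtr.
rewrite normal_integral_density//; last first.
- by move=> x; rewrite lee_fin exprn_even_ge0.
- by apply/measurable_EFinP; exact: measurable_funX.
have peak : normal_peak s = Num.sqrt 2 * normal_peak u.
  rewrite /normal_peak u2.
  have -> : s ^+ 2 * 2 * pi *+ 2 = (s ^+ 2 * pi *+ 2) * 2 by ring.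
  have sp : 0 <= s ^+ 2 * pi *+ 2 by rewrite mulrn_wge0// mulr_ge0 ?sqr_ge0 ?pi_ge0.
  by rewrite sqrtrM// invfM mulrCA mulfV ?mulr1// gt_eqF.
have q2le : Num.sqrt 2 <= 2 :> R.
  rewrite -[leRHS]ger0_norm// -sqrtr_sqr ler_wsqrtr//; lra.
(* With [y = x^2 / (4 s^2)] one has [x^4 = 16 s^4 y^2], and [(1 + y/2)^2 <= expR y] gives
   [y^2 expR (- y) <= 4]. The ratio of the two peaks is [Num.sqrt 2 <= 2], hence
   [128 = 16 * 4 * 2]. *)
have bound x : x ^+ 4 * normal_pdf 0 s x <= 128 * s ^+ 4 * normal_pdf 0 u x.
  rewrite !normal_pdfE ?(gt_eqF u0)// peak /normal_fun !subr0 u2.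
  pose y := x ^+ 2 / (4 * s ^+ 2).
  have -> : - x ^+ 2 / (s ^+ 2 *+ 2) = - y + - y.
    by rewrite /y; field.
  have -> : - x ^+ 2 / (s ^+ 2 * 2 *+ 2) = - y by rewrite /y; field.
  have -> : x ^+ 4 = 16 * s ^+ 4 * y ^+ 2 by rewrite /y; field.
  have y0 : 0 <= y by rewrite /y divr_ge0 ?sqr_ge0// mulr_ge0 ?sqr_ge0.
  have ey : y ^+ 2 * expR (- y) <= 4.
    rewrite expRN ler_pdivrMr ?expR_gt0//.
    have -> : expR y = expR (y / 2) ^+ 2 by rewrite -expRM_natl; congr expR; field.
    have h : 1 + y / 2 <= expR (y / 2) by exact: expR_ge1Dx.
    have : (1 + y / 2) ^+ 2 <= expR (y / 2) ^+ 2 by rewrite lerXn2r ?nnegrE ?expR_ge0//; lra.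
    nra.
  rewrite expRD.
  have p0 : 0 <= normal_peak u by exact: normal_peak_ge0.
  have e0 : 0 <= expR (- y) by exact: expR_ge0.
  have s4 : 0 <= s ^+ 4 by rewrite exprn_ge0// ltW.
  have ye0 : 0 <= y ^+ 2 * expR (- y) by rewrite mulr_ge0// sqr_ge0.
  have h1 : Num.sqrt 2 * (y ^+ 2 * expR (- y)) <= 2 * 4 by apply: ler_pM => //; exact: ltW.
  have := ler_wpM2l (mulr_ge0 (mulr_ge0 s4 p0) e0) h1.
  move: (normal_peak u) (expR (- y)) (s ^+ 4) (Num.sqrt 2) (y ^+ 2) => A B' C' D' E' H.
  by rewrite -subr_ge0; rewrite -subr_ge0 in H;
    apply: le_trans (_ : _ <= 16 * (C' * A * B' * (2 * 4) - C' * A * B' * (D' * (E' * B')))) _; [lra|lra].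
apply: (@le_trans _ _ (\int[mu]_x ((128 * s ^+ 4)%:E * (normal_pdf 0 u x)%:E))%E).
  apply: ge0_le_integral => //.
  - by move=> x _; rewrite -EFinM lee_fin mulr_ge0// ?exprn_even_ge0// normal_pdf_ge0.
  - apply: emeasurable_funM; apply/measurable_EFinP; last exact: measurable_normal_pdf.
    exact: measurable_funX.
  - apply: emeasurable_funM => //; apply/measurable_EFinP; exact: measurable_normal_pdf.
  - by move=> x _; rewrite -!EFinM lee_fin.
rewrite ge0_integralZl//.
- by rewrite integral_normal_pdf mule1.
- by apply/measurable_EFinP; exact: measurable_normal_pdf.
- by move=> x _; rewrite lee_fin normal_pdf_ge0.
- by rewrite lee_fin mulr_ge0// exprn_ge0// ltW.
Qed.

Lemma normal_itv_le (s a b : R) : s != 0 -> a <= b ->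
  (normal_prob 0 s `[a, b]%classic <= (normal_peak s * (b - a))%:E)%E.
Proof.
move=> s0 ab; rewrite /normal_prob.
apply: (@le_trans _ _ (\int[mu]_(x in `[a, b]) (normal_peak s)%:E)%E).
  apply: ge0_le_integral => //.
  - by move=> x _; rewrite lee_fin normal_pdf_ge0.
  - by apply: measurable_funTS; apply/measurable_EFinP; exact: measurable_normal_pdf.
  - by move=> x _; rewrite lee_fin normal_pdf_ub.
rewrite integral_cst//= lebesgue_measure_itv/= lte_fin; case: ltP => h.
  by rewrite -EFinD -EFinM.
by rewrite mule0 lee_fin mulr_ge0 ?normal_peak_ge0 ?subr_ge0.
Qed.

End centered_normal.

(* [x^-1] is the limit of [x / (x ^+ 2 + n.+1%:R^-1)], including at the junk
   value [0^-1 = 0]. *)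
Lemma measurable_inv {R : realType} : measurable_fun setT (@GRing.inv R).
Proof.
have d0 n (x : R) : 0 < x ^+ 2 + n.+1%:R^-1.
  by rewrite ltr_wpDl ?sqr_ge0// invr_gt0 ltr0n.
refine (@measurable_fun_cvg _ R R setT (fun n x => x / (x ^+ 2 + n.+1%:R^-1)) _ _ _).
  move=> n; apply: continuous_measurable_fun => x.
  apply: cvgM; first exact: cvg_id.
  apply: cvgV; first by rewrite gt_eqF.
  by apply: cvgD; [exact: sqr_continuous|exact: cvg_cst].
move=> x _; have [->|x0] := eqVneq x 0.
  by under eq_fun do rewrite mul0r; rewrite invr0; exact: cvg_cst.
rewrite [X in _ --> X](_ : _ = x / (x ^+ 2 + 0)); last by field.
apply: cvgM; first exact: cvg_cst.
apply: cvgV; first by rewrite addr0 expf_eq0.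
by apply: cvgD; [exact: cvg_cst|exact: cvg_harmonic].
Qed.

(** * The Poisson kernel on the circle and its primitive *)

Section poisson_kernel.
Context {R : realType}.
Implicit Types r x : R.

Definition pkernel r x := (1 - r ^+ 2) / (1 + r ^+ 2 - 2 * r * cos x).

(** For [0 <= r < 1] this is [x] minus twice the argument of [1 - r e^(ix)]. That number has
    positive real part, so the arctangent needs no change of branch and the primitive is smooth on
    the whole line. *)
Definition pkernel_prim r x := x + 2 * atan (r * sin x / (1 - r * cos x)).

Lemma one_sub_rcos_gt0 r x : 0 <= r < 1 -> 0 < 1 - r * cos x.
Proof.
move=> /andP[r0 r1]; have := cos_le1 x; have := @cos_geN1 _ x => h1 h2.
have : r * cos x <= r * 1 by rewrite ler_wpM2l.
lra.
Qed.

Lemma pkernel_den_gt0 r x : 0 <= r < 1 -> 0 < 1 + r ^+ 2 - 2 * r * cos x.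
Proof.
move=> /andP[r0 r1]; have h : r * cos x <= r * 1 by rewrite ler_wpM2l ?cos_le1.
have : 0 < (1 - r) ^+ 2 by rewrite exprn_gt0// subr_gt0.
rewrite sqrrB expr1n; lra.
Qed.

Lemma pkernel_ge0 r x : 0 <= r < 1 -> 0 <= pkernel r x.
Proof.
move=> r01; rewrite divr_ge0//; last by rewrite ltW// pkernel_den_gt0.
by case/andP: r01 => r0 r1; rewrite subr_ge0 expr_le1// ltW.
Qed.

Lemma pkernel0 x : pkernel 0 x = 1.
Proof. by rewrite /pkernel expr0n /= mulr0 mul0r !subr0 addr0 divr1. Qed.

Lemma pkernel_den_ge r x : 0 <= r < 1 ->
  (1 - r) ^+ 2 <= 1 + r ^+ 2 - 2 * r * cos x.
Proof.
move=> /andP[r0 r1]; have h : r * cos x <= r * 1 by rewrite ler_wpM2l ?cos_le1.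
rewrite sqrrB expr1n; lra.
Qed.

Lemma pkernel_le r x : 0 <= r < 1 -> pkernel r x <= ((1 - r) ^+ 2)^-1.
Proof.
move=> r01; have [r0 r1] := andP r01.
have d0 : 0 < (1 - r) ^+ 2 by rewrite exprn_gt0// subr_gt0.
rewrite /pkernel ler_pdivrMr ?pkernel_den_gt0//.
apply: (@le_trans _ _ 1); first by rewrite gerBl sqr_ge0.
rewrite mulrC ler_pdivlMr// mul1r; exact: pkernel_den_ge.
Qed.

Lemma continuous_pkernel r : 0 <= r < 1 -> continuous (pkernel r).
Proof.
move=> r01 x; apply: cvgM; first exact: cvg_cst.
apply: cvgV; first by rewrite gt_eqF// pkernel_den_gt0.
apply: cvgB; first exact: cvg_cst.
by apply: cvgM; [exact: cvg_cst|exact: continuous_cos].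
Qed.

Lemma measurable_pkernel r : 0 <= r < 1 -> measurable_fun setT (pkernel r).
Proof. by move=> r01; apply: continuous_measurable_fun; exact: continuous_pkernel. Qed.

Lemma is_derive_pkernel_prim r x : 0 <= r < 1 ->
  is_derive x 1 (pkernel_prim r) (pkernel r x).
Proof.
move=> r01; have D0 := one_sub_rcos_gt0 x r01.
have D0' : 1 - r * cos x != 0 by rewrite gt_eqF.
have dq : is_derive x 1 (fun y : R => r * sin y / (1 - r * cos y))
    ((r * cos x - r ^+ 2) / (1 - r * cos x) ^+ 2).
  apply: is_derive_eq; rewrite /GRing.scale /=.
  transitivity ((r * cos x * (1 - r * cos x) - r ^+ 2 * sin x ^+ 2) / (1 - r * cos x) ^+ 2).
    by field.
  by rewrite sin2cos2; congr (_ / _); ring.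
have da := is_derive1_comp (is_derive1_atan _) dq.
rewrite /pkernel_prim; apply: is_derive_eq; rewrite /GRing.scale /= /pkernel.
have D2 := pkernel_den_gt0 x r01.
set q := r * sin x / _; have -> : 1 + q ^+ 2 = (1 + r ^+ 2 - 2 * r * cos x) / (1 - r * cos x) ^+ 2.
  rewrite /q expr_div_n exprMn sin2cos2; field.
  by rewrite D0'.
by field; rewrite D0' gt_eqF.
Qed.

(** Uniform in [r]: this is the domination used when the radius tends to one. *)
Lemma pkernel_prim_bound r x : `|pkernel_prim r x| <= `|x| + pi.
Proof.
have := atan_ltpi2 (r * sin x / (1 - r * cos x)).
have := atan_gtNpi2 (r * sin x / (1 - r * cos x)) => h1 h2.
rewrite /pkernel_prim; apply: le_trans (ler_normD _ _) _; rewrite lerD2l.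
rewrite ler_norml; apply/andP; split; lra.
Qed.

Lemma pkernel_primN r x : pkernel_prim r (- x) = - pkernel_prim r x.
Proof. by rewrite /pkernel_prim sinN cosN mulrN mulNr atanN mulrN opprD. Qed.

Lemma pkernel_prim0 r : pkernel_prim r 0 = 0.
Proof. by rewrite /pkernel_prim sin0 mulr0 mul0r atan0 mulr0 addr0. Qed.

Lemma pkernel_prim_period r x :
  pkernel_prim r (x + pi) - pkernel_prim r (x - pi) = 2 * pi.
Proof.
have -> : x + pi = (x - pi) + pi *+ 2 by ring.
by rewrite /pkernel_prim sinD2pi cosD2pi; ring.
Qed.

Lemma sin_half_neq0 x : x != 0 -> `|x| < 2 * pi -> sin (x / 2) != 0.
Proof.
wlog x0 : x / 0 < x => [h xn0|_].
  have [/h|] := ltP 0 x; first exact.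
  rewrite le_eqVlt (negbTE xn0)/= => xlt0 xpi.
  by rewrite -[x]opprK mulNr sinN oppr_eq0 h ?oppr_gt0 ?oppr_eq0 ?normrN.
rewrite gtr0_norm// => xpi; rewrite gt_eqF// sin_gt0_pi//.
by apply/andP; split; lra.
Qed.

Lemma half_angle x : sin x = 2 * sin (x / 2) * cos (x / 2) /\
  1 - cos x = 2 * sin (x / 2) ^+ 2.
Proof.
have xE : x = (x / 2) *+ 2 by rewrite mulr2n; lra.
split; first by rewrite {1}xE sin_mulr2n mulr2n; ring.
by rewrite {1}xE cos_mulr2n sin2cos2 mulr2n; ring.
Qed.

(** At radius one the quotient is the cotangent of [x / 2], that is the tangent of [pi / 2 - x / 2],
    so the linear terms cancel. The primitive has become a step, which produces indicators of
    intervals. *)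
Lemma pkernel_prim1_pos x : 0 < x -> x < 2 * pi -> pkernel_prim 1 x = pi.
Proof.
move=> x0 xpi; have s0 : sin (x / 2) != 0.
  by apply: sin_half_neq0; rewrite ?gt_eqF// gtr0_norm.
have [sE cE] := half_angle x.
rewrite /pkernel_prim !mul1r sE cE.
have -> : 2 * sin (x / 2) * cos (x / 2) / (2 * sin (x / 2) ^+ 2) = tan (pi / 2 - x / 2).
  rewrite /tan.
  have -> : pi / 2 - x / 2 = - (x / 2 - pi / 2) by ring.
  by rewrite sinN cosN sinBpihalf cosBpihalf opprK; field.
rewrite tanK; first by lra.
by rewrite in_itv/=; apply/andP; split; lra.
Qed.

Lemma pkernel_prim1_neg x : x < 0 -> - (2 * pi) < x -> pkernel_prim 1 x = - pi.
Proof.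
by move=> x0 xpi; rewrite -[x]opprK pkernel_primN pkernel_prim1_pos//; lra.
Qed.

Definition radius (n : nat) : R := 1 - (n.+1)%:R^-1.

Lemma radius_itv n : 0 <= radius n < 1.
Proof.
have n0 : 0 < (n.+1)%:R :> R by rewrite ltr0n.
rewrite /radius subr_ge0 invf_le1// ler1n /= gtrBl invr_gt0//.
Qed.

Lemma cvg_radius : radius @ \oo --> (1 : R).
Proof.
rewrite -[X in _ --> X](subr0 (1 : R)); apply: cvgB; first exact: cvg_cst.
exact: cvg_harmonic.
Qed.

(** The denominator [1 - r * cos x] can vanish only for [r = 1] and [cos x = 1]; within [2 * pi] of
    the origin this leaves [x = 0], where every primitive is zero. *)
Lemma cvg_pkernel_prim r x : 0 <= r <= 1 -> `|x| < 2 * pi ->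
  (fun n => pkernel_prim (radius n * r) x) @ \oo --> pkernel_prim r x.
Proof.
move=> /andP[r0 r1] xpi; have [->|x0] := eqVneq x 0.
  by under eq_fun do rewrite pkernel_prim0; rewrite pkernel_prim0; exact: cvg_cst.
have cx : cos x < 1.
  have [_ cE] := half_angle x; rewrite -subr_gt0 cE.
  by rewrite mulr_gt0// exprn_even_gt0//= sin_half_neq0.
have cr : (fun n => radius n * r) @ \oo --> r.
  rewrite -[X in _ --> X]mul1r; apply: cvgM; [exact: cvg_radius|exact: cvg_cst].
rewrite /pkernel_prim; apply: cvgD; first exact: cvg_cst.
apply: cvgM; first exact: cvg_cst.
apply: (continuous_cvg _ (@continuous_atan R _)).
apply: cvgM; first by apply: cvgM; [exact: cr|exact: cvg_cst].
apply: cvgV.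
  rewrite gt_eqF// subr_gt0.
  have [c0|c0] := leP (cos x) 0; first by rewrite (le_lt_trans _ ltr01)// mulr_ge0_le0.
  by apply: le_lt_trans cx; rewrite ler_piMl// ltW.
by apply: cvgB; [exact: cvg_cst|apply: cvgM; [exact: cr|exact: cvg_cst]].
Qed.

Notation mu := (@lebesgue_measure R).

Lemma integral_pkernel r x a c : 0 <= r < 1 -> a < c ->
  (\int[mu]_(phi in `[a, c]) (pkernel r (x - phi))%:E =
   (pkernel_prim r (x - a) - pkernel_prim r (x - c))%:E)%E.
Proof.
move=> r01 ac.
pose F (phi : R) : R := - pkernel_prim r (x - phi).
have dF (phi : R) : is_derive phi 1 F (pkernel r (x - phi)).
  have dx : is_derive phi 1 (fun y : R => x - y) (-1 : R).
    by have := is_deriveB (is_derive_cst x phi (1 : R)) (is_derive_id phi (1 : R)); rewrite sub0r.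
  have := @is_derive1_comp R (pkernel_prim r) (fun y => x - y) phi _ _
    (is_derive_pkernel_prim (x - phi) r01) dx.
  by move=> /is_deriveN; rewrite mulrN1 opprK.
have cF : continuous F.
  move=> phi; apply: differentiable_continuous; apply/derivable1_diffP.
  exact: (@ex_derive _ _ _ _ _ _ _ (dF phi)).
rewrite (@continuous_FTC2 _ _ F)//.
- by rewrite /F -EFinB; congr (_%:E); ring.
- apply: continuous_subspaceT => phi; apply: (@continuous_comp _ _ _ (fun y : R => x - y) (pkernel r)).
    by apply: cvgB; [exact: cvg_cst|exact: cvg_id].
  exact: continuous_pkernel.
- split.
  + by move=> y _; exact: (@ex_derive _ _ _ _ _ _ _ (dF y)).
  + by apply: cvg_at_right_filter; exact: cF.
  + by apply: cvg_at_left_filter; exact: cF.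
- by move=> y _; rewrite derive1E (@derive_val _ _ _ _ _ _ _ (dF y)).
Qed.

End poisson_kernel.

(** * Inversion of the Poisson transform on rays *)

Section poisson_transform.
Context {R : realType} {d : measure_display} {T : measurableType d}.
Context (P : probability T R).
Notation mu := (@lebesgue_measure R).

(** Integrating a transform over its angle replaces the kernel, unbounded as the radius tends to
    one, by differences of its primitive, which stay bounded. *)
Lemma tonelli_pkernel (G : T -> R) (alpha : T -> R) (r a c : R) :
  measurable_fun setT G -> (forall w, 0 <= G w) ->
  measurable_fun setT alpha -> 0 <= r < 1 -> a < c ->
  (\int[P]_w (G w * (pkernel_prim r (alpha w - a) - pkernel_prim r (alpha w - c)))%:E
  = \int[mu]_(phi in `[a, c]) \int[P]_w (G w * pkernel r (alpha w - phi))%:E)%E.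
Proof.
move=> mG G0 ma r01 ac.
pose f (z : T * measurableTypeR R) : \bar R :=
  ((G z.1 * pkernel r (alpha z.1 - z.2)) * \1_(`[a, c]%classic) z.2)%:E.
have mf : measurable_fun setT f.
  apply/measurable_EFinP; apply: measurable_funM.
    apply: measurable_funM; first exact: (measurableT_comp mG).
    apply: (measurableT_comp (measurable_pkernel r01)).
    apply: measurable_funB; first exact: (measurableT_comp ma).
    exact: measurable_snd.
  by apply: (measurableT_comp (measurable_indic _)) => //.
have f0 z : (0 <= f z)%E.
  by rewrite lee_fin mulr_ge0 ?indicE ?ler0n// mulr_ge0 ?pkernel_ge0.
have := @fubini_tonelli _ _ _ _ R P mu f mf f0.
have -> : (\int[P]_x \int[mu]_y f (x, y))%E =
    (\int[P]_w (G w * (pkernel_prim r (alpha w - a) - pkernel_prim r (alpha w - c)))%:E)%E.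
  apply: eq_integral => w _.
  rewrite EFinM -integral_pkernel// -ge0_integralZl//.
  - rewrite [RHS]integral_mkcond; apply: eq_integral => y _.
    by rewrite /f /= patchE indicE; case: ifPn => h; rewrite /= ?mulr1 ?mulr0 ?EFinM.
  - apply: measurable_funTS; apply/measurable_EFinP.
    apply: (measurableT_comp (measurable_pkernel r01)).
    exact: measurable_funB.
  - by move=> y _; rewrite lee_fin pkernel_ge0.
  - by rewrite lee_fin.
move=> ->; rewrite [RHS]integral_mkcond; apply: eq_integral => y _.
rewrite patchE; case: ifPn => h.
  by apply: eq_integral => w _; rewrite /f /= indicE h mulr1.
rewrite -[RHS](integral0 P setT); apply: eq_integral => w _.
by rewrite /f /= indicE (negbTE h) mulr0.
Qed.

Lemma measurable_pkernel_prim (r : R) : measurable_fun setT (pkernel_prim r).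
Proof.
apply: measurable_funD => //; apply: measurable_funM => //.
apply: (measurableT_comp (continuous_measurable_fun (@continuous_atan R))).
apply: measurable_funM.
  by apply: measurable_funM => //; apply: continuous_measurable_fun; exact: continuous_sin.
apply: (measurableT_comp (@measurable_inv R)).
apply: measurable_funB => //; apply: measurable_funM => //.
by apply: continuous_measurable_fun; exact: continuous_cos.
Qed.

Context (G G' Phi alpha : T -> R) (M r : R).
Context (mG : measurable_fun setT G) (mG' : measurable_fun setT G').
Context (G0 : forall w, 0 <= G w) (G0' : forall w, 0 <= G' w).
Context (GM : forall w, G w <= M) (GM' : forall w, G' w <= M).
Context (mPhi : measurable_fun setT Phi) (malpha : measurable_fun setT alpha).
Context (Phi_itv : forall w, - pi <= Phi w < pi).
Context (alpha_itv : forall w, - pi <= alpha w < pi).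
Context (r01 : 0 <= r <= 1).
Context (transformE : forall s a : R, 0 <= s < 1 ->
  (\int[P]_w (G w * pkernel s (Phi w - a))%:E =
   \int[P]_w (G' w * pkernel (s * r) (alpha w - a))%:E)%E).

Let sub_itv (x a : R) : - pi <= x < pi -> - pi < a < pi -> `|x - a| < 2 * pi.
Proof.
move=> /andP[x1 x2] /andP[a1 a2]; rewrite ltr_norml; apply/andP; split; lra.
Qed.

Let measurable_integrand (H X : T -> R) q a c : measurable_fun setT H ->
  measurable_fun setT X ->
  measurable_fun setT (fun w => H w * (pkernel_prim q (X w - a) - pkernel_prim q (X w - c))).
Proof.
move=> mH mX; apply: measurable_funM => //; apply: measurable_funB.
  by apply: (measurableT_comp (measurable_pkernel_prim q)); exact: measurable_funB.
by apply: (measurableT_comp (measurable_pkernel_prim q)); exact: measurable_funB.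
Qed.

Let bound_integrand (H X : T -> R) (q a c : R) w : (forall w, 0 <= H w) ->
  (forall w, H w <= M) -> (forall w, - pi <= X w < pi) ->
  - pi <= a <= pi -> - pi <= c <= pi ->
  `|H w * (pkernel_prim q (X w - a) - pkernel_prim q (X w - c))| <= M * (6 * pi).
Proof.
move=> H0 HM Xpi /andP[a1 a2] /andP[c1 c2]; have /andP[X1 X2] := Xpi w.
rewrite normrM ger0_norm// ler_pM//.
apply: le_trans (ler_normB _ _) _.
have := pkernel_prim_bound q (X w - a); have := pkernel_prim_bound q (X w - c).
have : `|X w - a| <= 2 * pi by rewrite ler_norml; apply/andP; split; lra.
have : `|X w - c| <= 2 * pi by rewrite ler_norml; apply/andP; split; lra.
lra.
Qed.

Let radius_r n : 0 <= radius n * r < 1.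
Proof.
have /andP[h1 h2] := @radius_itv R n; have /andP[r0 r1] := r01.
rewrite mulr_ge0//=; apply: le_lt_trans h2; exact: ler_piMr.
Qed.

Let radius_identity n (a c : R) : a < c ->
  \int[P]_w (G w * (pkernel_prim (radius n) (Phi w - a) - pkernel_prim (radius n) (Phi w - c))) =
  \int[P]_w (G' w * (pkernel_prim (radius n * r) (alpha w - a) -
                     pkernel_prim (radius n * r) (alpha w - c))).
Proof.
move=> ac; rewrite /Rintegral; congr fine.
rewrite (tonelli_pkernel mG G0 mPhi (radius_itv n) ac).
rewrite (tonelli_pkernel mG' G0' malpha (radius_r n) ac).
by apply: eq_integral => y _; apply: transformE; exact: radius_itv.
Qed.

(** The radii tend to one in [radius_identity]. Both endpoints lie strictly inside the circle's
    parameter interval, so all differences of angles stay below [2 * pi] in absolute value, as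
    [cvg_pkernel_prim] requires. *)
Let interval_identity (a c : R) : - pi < a -> a < c -> c < pi ->
  \int[P]_w (G w * (pkernel_prim 1 (Phi w - a) - pkernel_prim 1 (Phi w - c))) =
  \int[P]_w (G' w * (pkernel_prim r (alpha w - a) - pkernel_prim r (alpha w - c))).
Proof.
move=> a1 ac c1.
have aI : - pi < a < pi by rewrite a1 (lt_trans ac).
have cI : - pi < c < pi by rewrite c1 (lt_trans a1).
have aI' : - pi <= a <= pi by case/andP: aI => ? ?; rewrite !ltW.
have cI' : - pi <= c <= pi by case/andP: cI => ? ?; rewrite !ltW.
pose u n := \int[P]_w (G w * (pkernel_prim (radius n) (Phi w - a) -
    pkernel_prim (radius n) (Phi w - c))).
suff [u1 u2] : u @ \oo --> \int[P]_w (G w * (pkernel_prim 1 (Phi w - a) - pkernel_prim 1 (Phi w - c)))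
    /\
  u @ \oo --> \int[P]_w (G' w * (pkernel_prim r (alpha w - a) - pkernel_prim r (alpha w - c))).
  by rewrite -(cvg_lim _ u1)// -(cvg_lim _ u2).
split.
- apply: (@bounded_cvg_Rintegral _ _ _ P _ _ (M * (6 * pi))).
  + by move=> n; exact: measurable_integrand.
  + exact: measurable_integrand.
  + by move=> n w; exact: bound_integrand.
  + apply: aeW => w; apply: cvgM; first exact: cvg_cst.
    have h (x : R) : `|x| < 2 * pi -> (fun n => pkernel_prim (radius n) x) @ \oo --> pkernel_prim 1 x.
      move=> xpi; have := @cvg_pkernel_prim R 1 x; under eq_fun do rewrite mulr1.
      by apply => //; rewrite ler01 lexx.
    by apply: cvgB; apply: h; exact: sub_itv.
- rewrite /u; under eq_fun do rewrite radius_identity//.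
  apply: (@bounded_cvg_Rintegral _ _ _ P _ _ (M * (6 * pi))).
  + by move=> n; exact: measurable_integrand.
  + exact: measurable_integrand.
  + by move=> n w; exact: bound_integrand.
  + apply: aeW => w; apply: cvgM; first exact: cvg_cst.
    by apply: cvgB; apply: cvg_pkernel_prim => //; exact: sub_itv.
Qed.

(** Interior endpoints tending to [a] from above and to [pi] from below. The offset 3 keeps them in
    the right order already for [n = 0], where 2 would make them coincide. *)
Let an (a : R) n := a + (pi - a) * n.+3%:R^-1.
Let cn (a : R) n := pi - (pi - a) * n.+3%:R^-1.

Let an_cn (a : R) n : - pi <= a < pi ->
  [/\ - pi < an a n, an a n < cn a n, cn a n < pi & a < an a n].
Proof.
move=> /andP[a1 a2]; rewrite /an /cn.
have n0 : 0 < n.+3%:R^-1 :> R by rewrite invr_gt0 ltr0n.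
have n3 : n.+3%:R^-1 <= 3^-1 :> R by rewrite lef_pV2 ?posrE ?ltr0n// ler_nat.
have : 0 < (pi - a) * n.+3%:R^-1 by rewrite mulr_gt0// subr_gt0.
have : (pi - a) * n.+3%:R^-1 <= (pi - a) * 3^-1.
  by rewrite ler_wpM2l// subr_ge0 ltW.
move: ((pi - a) * n.+3%:R^-1) => t h1 h2.
have h3 : (pi - a) * 3^-1 <= (pi - a) / 3 by [].
by split; lra.
Qed.

Let cvg_small (a : R) : (fun n => (pi - a) * n.+3%:R^-1) @ \oo --> (0 : R).
Proof.
rewrite -(mulr0 (pi - a)); apply: cvgM; first exact: cvg_cst.
have := @cvg_harmonic R; rewrite -(cvg_shiftn 2); apply: cvg_trans.
by apply: near_eq_cvg; near=> n; rewrite /harmonic /= addn2.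
Unshelve. all: by end_near. Qed.

Let cvg_an (a : R) : an a @ \oo --> a.
Proof.
rewrite -[X in _ --> X]addr0; apply: cvgD; [exact: cvg_cst|exact: cvg_small].
Qed.

Let cvg_cn (a : R) : cn a @ \oo --> (pi : R).
Proof.
rewrite -[X in _ --> X]subr0; apply: cvgB; [exact: cvg_cst|exact: cvg_small].
Qed.

(** The step primitive makes the difference [2 * pi] for [X w] between the endpoints and 0 for [X w]
    outside them. As [an a n] stays above [a], the value [X w = a] is excluded, which yields the
    open ray. *)
Let cvg_ray1 (H X : T -> R) (a : R) : measurable_fun setT H ->
  measurable_fun setT X -> (forall w, 0 <= H w) ->
  (forall w, H w <= M) -> (forall w, - pi <= X w < pi) -> - pi <= a < pi ->
  (fun n => \int[P]_w (H w * (pkernel_prim 1 (X w - an a n) - pkernel_prim 1 (X w - cn a n))))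
   @ \oo --> \int[P]_w (H w * ((a < X w)%R%:R * (2 * pi))).
Proof.
move=> mH mX H0 HM Xpi api; apply: (@bounded_cvg_Rintegral _ _ _ P _ _ (M * (6 * pi))).
- by move=> n; exact: measurable_integrand.
- apply: measurable_funM => //; apply: measurable_funM => //.
  rewrite (_ : (fun _ => _) = (fun w => if (a < X w)%R then 1 else 0)); last first.
    by apply/funext => w; case: ifP.
  by apply: measurable_fun_ifT => //; exact: measurable_fun_ltr.
- move=> n w; have [h1 h2 h3 h4] := an_cn n api.
  by apply: bound_integrand => //; apply/andP; split; lra.
- apply: aeW => w; apply: cvgM; first exact: cvg_cst.
  have /andP[X1 X2] := Xpi w; have /andP[a1 a2] := api.
  have Xc : \forall n \near \oo, X w < cn a n by exact: (cvgr_gt _ (@cvg_cn a)).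
  have [aX|aX] := ltP a (X w).
    have aXn : \forall n \near \oo, an a n < X w by exact: (cvgr_lt _ (@cvg_an a)).
    apply: cvg_near_cst; near=> n; have [h1 h2 h3 h4] := an_cn n api.
    have Xcn : X w < cn a n by near: n.
    have aXn' : an a n < X w by near: n.
    have -> : pkernel_prim 1 (X w - an a n) = pi by apply: pkernel_prim1_pos; lra.
    have -> : pkernel_prim 1 (X w - cn a n) = - pi by apply: pkernel_prim1_neg; lra.
    by rewrite mul1r; ring.
  apply: cvg_near_cst; near=> n; have [h1 h2 h3 h4] := an_cn n api.
  have Xcn : X w < cn a n by near: n.
  have -> : pkernel_prim 1 (X w - an a n) = - pi by apply: pkernel_prim1_neg; lra.
  have -> : pkernel_prim 1 (X w - cn a n) = - pi by apply: pkernel_prim1_neg; lra.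
  by rewrite mul0r subrr.
Unshelve. all: by end_near. Qed.

Lemma ray_identity1 (a : R) : r = 1 -> - pi <= a < pi ->
  \int[P]_w (G w * ((a < Phi w)%R%:R * (2 * pi))) =
  \int[P]_w (G' w * ((a < alpha w)%R%:R * (2 * pi))).
Proof.
move=> r1 api.
have u1 := cvg_ray1 mG mPhi G0 GM Phi_itv api.
have u2 := cvg_ray1 mG' malpha G0' GM' alpha_itv api.
rewrite -(cvg_lim _ u1)// -(cvg_lim _ u2)//; congr (lim (_ @ \oo)).
apply/funext => n; have [h1 h2 h3 h4] := an_cn n api.
by rewrite interval_identity// r1.
Qed.

(** For [r < 1] the primitive is continuous everywhere, so on the right the endpoints simply pass to
    the limit; only the left-hand side turns into an indicator. *)
Lemma ray_identity (a : R) : r < 1 -> - pi <= a < pi ->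
  \int[P]_w (G w * ((a < Phi w)%R%:R * (2 * pi))) =
  \int[P]_w (G' w * (pkernel_prim r (alpha w - a) - pkernel_prim r (alpha w - pi))).
Proof.
move=> r1 api.
have r01' : 0 <= r < 1 by case/andP: r01 => -> _.
have u1 := cvg_ray1 mG mPhi G0 GM Phi_itv api.
have : (fun n => \int[P]_w (G' w * (pkernel_prim r (alpha w - an a n) -
    pkernel_prim r (alpha w - cn a n))))
   @ \oo --> \int[P]_w (G' w * (pkernel_prim r (alpha w - a) - pkernel_prim r (alpha w - pi))).
  apply: (@bounded_cvg_Rintegral _ _ _ P _ _ (M * (6 * pi))).
  - by move=> n; exact: measurable_integrand.
  - exact: measurable_integrand.
  - move=> n w; have [h1 h2 h3 h4] := an_cn n api.
    by apply: bound_integrand => //; apply/andP; split; lra.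
  - apply: aeW => w; apply: cvgM; first exact: cvg_cst.
    have cF x : {for x, continuous (pkernel_prim r)}.
      apply: differentiable_continuous; apply/derivable1_diffP.
      exact: (@ex_derive _ _ _ _ _ _ _ (is_derive_pkernel_prim x r01')).
    apply: cvgB.
      apply: (continuous_cvg _ (cF _)); apply: cvgB; [exact: cvg_cst|exact: cvg_an].
    apply: (continuous_cvg _ (cF _)); apply: cvgB; [exact: cvg_cst|exact: cvg_cn].
move=> u2; rewrite -(cvg_lim _ u1)// -(cvg_lim _ u2)//; congr (lim (_ @ \oo)).
by apply/funext => n; have [h1 h2 h3 h4] := an_cn n api; rewrite interval_identity.
Qed.

End poisson_transform.

(** * Poisson transforms determine laws on the circle *)

Section laws_from_transforms.
Context {R : realType} {d : measure_display} {T : measurableType d}.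
Context (P : probability T R).
Notation mu := (@lebesgue_measure R).
Local Notation MR := (measurableTypeR R).

Let two_pi_gt0 : 0 < 2 * pi :> R. Proof. by rewrite mulr_gt0// pi_gt0. Qed.

Let two_pi_inv_ge0 : 0 <= (2 * pi)^-1 :> R.
Proof. by rewrite invr_ge0 ltW. Qed.

Let bint (G : T -> R) M : measurable_fun setT G -> (forall w, 0 <= G w) ->
  (forall w, G w <= M) -> P.-integrable setT (EFin \o G).
Proof.
by move=> mG G0 GM; apply: (@bounded_integrable _ _ _ P _ M) => // w; rewrite ger0_norm.
Qed.

Let ray_measure (G X : T -> R) M (x : R) : measurable_fun setT G ->
  (forall w, 0 <= G w) -> (forall w, G w <= M) -> measurable_fun setT X ->
  (\int[P]_(w in X @^-1` `]x, +oo[%classic) (G w)%:E =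
   ((2 * pi)^-1 * \int[P]_w (G w * ((x < X w)%R%:R * (2 * pi))))%:E)%E.
Proof.
move=> mG G0 GM mX.
have mi : measurable_fun setT (fun w => (x < X w)%R%:R : R).
  rewrite (_ : (fun _ => _) = (fun w => if (x < X w)%R then 1 else 0)); last first.
    by apply/funext => w; case: ifP.
  by apply: measurable_fun_ifT => //; exact: measurable_fun_ltr.
have iG : P.-integrable setT (EFin \o (fun w => G w * ((x < X w)%R%:R * (2 * pi)))).
  apply: (@bint _ (M * (1 * (2 * pi)))).
  - by apply: measurable_funM => //; exact: measurable_funM.
  - by move=> w; apply: mulr_ge0 => //; apply: mulr_ge0 => //; exact: ltW.
  - move=> w; apply: ler_pM => //; first by rewrite mulr_ge0// ltW.
    by rewrite ler_pM2r//; case: (x < X w); rewrite ?lexx ?ler01.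
rewrite EFinM /Rintegral fineK; last exact: (integrable_fin_num _ iG).
rewrite -ge0_integralZl//.
- rewrite [LHS]integral_mkcond; apply: eq_integral => w _; rewrite patchE -EFinM.
  have -> : (w \in X @^-1` `]x, +oo[%classic) = (x < X w).
    by apply/idP/idP; rewrite inE /= in_itv/= andbT.
  case: ltP => _; rewrite ?mul0r ?mulr0// mul1r mulrCA mulVf ?mulr1// gt_eqF//.
- exact: (measurable_int P iG).
- by move=> w _; rewrite lee_fin; apply: mulr_ge0 => //; apply: mulr_ge0 => //; exact: ltW.
Qed.

(** The kernel of radius zero is constant, so the transform at [s = 0] carries the total mass. *)
Let transform0 (G X : T -> R) a :
  (\int[P]_w (G w * pkernel 0 (X w - a))%:E = \int[P]_w (G w)%:E)%E.
Proof. by apply: eq_integral => w _; rewrite pkernel0 mulr1. Qed.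

(** In effect [G] and [G'] have the same conditional expectation given [Theta]. Both sides are
    finite measures in [A], with equal mass by the transform at [s = 0] and equal values on rays by
    [ray_identity1]. *)
Lemma transform_unique (G G' Theta : T -> R) (M : R) :
  measurable_fun setT G -> measurable_fun setT G' ->
  (forall w, 0 <= G w) -> (forall w, 0 <= G' w) ->
  (forall w, G w <= M) -> (forall w, G' w <= M) ->
  measurable_fun setT Theta -> (forall w, - pi <= Theta w < pi) ->
  (forall s a : R, 0 <= s < 1 ->
    (\int[P]_w (G w * pkernel s (Theta w - a))%:E =
     \int[P]_w (G' w * pkernel s (Theta w - a))%:E)%E) ->
  forall A : set R, measurable A ->
    (\int[P]_(w in Theta @^-1` A) (G w)%:E =
     \int[P]_(w in Theta @^-1` A) (G' w)%:E)%E.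
Proof.
move=> mG mG' G0 G0' GM GM' mT Tpi H A mA.
have mT' : measurable_fun setT (Theta : T -> MR) by [].
apply: (@rays_measure_unique R
  (image_measure (density_measure P mG G0) mT')
  (image_measure (density_measure P mG' G0') mT')) => //.
- rewrite /= /pushforward preimage_setT /density.
  have := H 0 0; rewrite lexx ltr01 => /(_ isT).
  by rewrite !transform0.
- rewrite /= /pushforward preimage_setT /density.
  exact: (integrable_lty measurableT (bint mG G0 GM)).
move=> x; rewrite /= /pushforward /density.
have [xpi|xpi] := ltP x (- pi).
  have -> : Theta @^-1` `]x, +oo[%classic = setT.
    apply/seteqP; split => w //= _; rewrite in_itv/= andbT (lt_le_trans xpi)//.
    by case/andP: (Tpi w).
  have := H 0 0; rewrite lexx ltr01 => /(_ isT).
  by rewrite !transform0.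
have [xpi'|xpi'] := ltP x pi; last first.
  have -> : Theta @^-1` `]x, +oo[%classic = set0.
    apply/seteqP; split => w //=; rewrite in_itv/= andbT => /lt_trans.
    by move=> h; case/andP: (Tpi w) => _ /h; rewrite ltNge xpi'.
  by rewrite !integral_set0.
rewrite (ray_measure _ mG G0 GM mT) (ray_measure _ mG' G0' GM' mT).
rewrite (@ray_identity1 _ _ _ P G G' Theta Theta M 1)//.
- by rewrite ler01 lexx.
- by move=> s a s01; rewrite mulr1; exact: H.
- by rewrite xpi.
Qed.

(** The measure with weight [G] is pushed to the circle by [Phi] and compared on rays with an
    explicit density. The centre [alpha] may be random: a constant gives the marginal laws,
    [alpha = Theta] the joint law. *)
Lemma transform_law (G Phi alpha : T -> R) (M r : R) :
  measurable_fun setT G -> (forall w, 0 <= G w) -> (forall w, G w <= M) ->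
  measurable_fun setT Phi -> (forall w, - pi <= Phi w < pi) ->
  measurable_fun setT alpha -> (forall w, - pi <= alpha w < pi) ->
  0 <= r < 1 ->
  (forall s a : R, 0 <= s < 1 ->
    (\int[P]_w (G w * pkernel s (Phi w - a))%:E =
     \int[P]_w (G w * pkernel (s * r) (alpha w - a))%:E)%E) ->
  forall S : set R, measurable S -> S `<=` `[- pi, pi[ ->
    (\int[P]_(w in Phi @^-1` S) (G w)%:E =
     \int[mu]_(phi in S) \int[P]_w (G w * (pkernel r (alpha w - phi) / (2 * pi)))%:E)%E.
Proof.
move=> mG G0 GM mPhi Phipi ma api r01 H S mS Spi.
pose f (z : T * MR) : \bar R := (G z.1 * (pkernel r (alpha z.1 - z.2) / (2 * pi)))%:E.
have mf : measurable_fun setT f.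
  apply/measurable_EFinP; apply: measurable_funM; first exact: (measurableT_comp mG).
  apply: measurable_funM => //; apply: (measurableT_comp (measurable_pkernel r01)).
  apply: measurable_funB; first exact: (measurableT_comp ma).
  exact: measurable_snd.
have f0 z : (0 <= f z)%E.
  rewrite lee_fin; apply: mulr_ge0 => //; apply: mulr_ge0 => //.
  exact: pkernel_ge0.
pose psi0 (phi : MR) : \bar R := (\int[P]_w f (w, phi))%E.
have psi0_ge0 phi : (0 <= psi0 phi)%E by apply: integral_ge0.
have mpsi0 : measurable_fun setT psi0 by exact: (measurable_fun_fubini_tonelli_G f).
have psi0_fin phi : psi0 phi \is a fin_num.
  apply: (integrable_fin_num measurableT).
  apply: (@bint _ (M * (((1 - r) ^+ 2)^-1 / (2 * pi)))).
  - apply: measurable_funM => //; apply: measurable_funM => //.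
    by apply: (measurableT_comp (measurable_pkernel r01)); exact: measurable_funB.
  - move=> w; apply: mulr_ge0 => //; apply: mulr_ge0 => //; exact: pkernel_ge0.
  - move=> w; apply: ler_pM => //; first by rewrite mulr_ge0 ?pkernel_ge0.
    by rewrite ler_pM2r ?invr_gt0// pkernel_le.
(* The candidate density, made real-valued and extended by zero to the line. Including the endpoint
   [pi], a null set, lets the integrals run over the closed intervals of [tonelli_pkernel]. *)
pose psi (phi : MR) : R := if phi \in `[- pi, pi] then fine (psi0 phi) else 0.
have mpsi : measurable_fun setT psi.
  apply: measurable_fun_ifT => //.
  - apply: measurable_and; exact: measurable_fun_ler.
  - exact: (measurableT_comp (@fine_measurable R _ measurableT) mpsi0).
have psi_ge0 phi : 0 <= psi phi by rewrite /psi; case: ifP => // _; exact: fine_ge0.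
have mPhi' : measurable_fun setT (Phi : T -> MR) by [].
have psiE a : - pi <= a < pi -> (\int[mu]_(phi in `[a, pi]) (psi phi)%:E =
    ((2 * pi)^-1 * \int[P]_w (G w *
      (pkernel_prim r (alpha w - a) - pkernel_prim r (alpha w - pi))))%:E)%E.
  move=> /andP[a1 a2].
  pose L w := G w * (pkernel_prim r (alpha w - a) - pkernel_prim r (alpha w - pi)).
  have iL : P.-integrable setT (EFin \o L).
    apply: (@bounded_integrable _ _ _ P _ (M * (6 * pi))).
      apply: measurable_funM => //; apply: measurable_funB;
        by apply: (measurableT_comp (measurable_pkernel_prim r)); exact: measurable_funB.
    move=> w; rewrite normrM ger0_norm// ler_pM//.
    apply: le_trans (ler_normB _ _) _.
    have := pkernel_prim_bound r (alpha w - a); have := pkernel_prim_bound r (alpha w - pi).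
    have /andP[p1 p2] := api w.
    have : `|alpha w - a| <= 2 * pi by rewrite ler_norml; apply/andP; split; lra.
    have : `|alpha w - pi| <= 2 * pi by rewrite ler_norml; apply/andP; split; lra.
    lra.
  have mG2 : measurable_fun setT (fun w => G w / (2 * pi)) by exact: measurable_funM.
  have G20 w : 0 <= G w / (2 * pi) by exact: mulr_ge0.
  rewrite EFinM /Rintegral fineK; last exact: (integrable_fin_num _ iL).
  rewrite -integralZl//.
  transitivity (\int[P]_w (G w / (2 * pi) *
    (pkernel_prim r (alpha w - a) - pkernel_prim r (alpha w - pi)))%:E)%E; last first.
    by apply: eq_integral => w _; rewrite -EFinM; congr (_%:E); rewrite /L; ring.
  rewrite (tonelli_pkernel P mG2 G20 ma r01 a2).
  apply: eq_integral => phi; rewrite inE /= in_itv/= => /andP[h1 h2].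
  rewrite /psi in_itv/= h2 (le_trans a1 h1)/= fineK// /psi0.
  by apply: eq_integral => w _; rewrite /f /=; congr (_%:E); ring.
pose I : set MR := `[- pi, pi]%classic.
have psi_restrict (D : set MR) : measurable D ->
    (\int[mu]_(phi in D) (psi phi)%:E = \int[mu]_(phi in D `&` I) (psi phi)%:E)%E.
  move=> mD; rewrite [RHS]integral_mkcondr; apply: eq_integral => phi _.
  rewrite patchE; case: ifPn => //; rewrite /psi notin_setE /= => /negP/negbTE.
  by move=> ->.
(* Equality of the masses: over a full period the primitive grows by [2 * pi], wherever [alpha w]
   lies. *)
have totalE : (\int[P]_w (G w)%:E = \int[mu]_(phi in I) (psi phi)%:E)%E.
  rewrite /I psiE; last by rewrite lexx /=; have := pi_gt0 R; lra.
  have -> : (fun w => G w * (pkernel_prim r (alpha w - - pi) - pkernel_prim r (alpha w - pi))) =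
      (fun w => G w * (2 * pi)).
    by apply/funext => w; rewrite opprK pkernel_prim_period.
  rewrite RintegralZr//; last exact: (bint mG G0 GM).
  rewrite mulrC mulfK ?gt_eqF// /Rintegral fineK//.
  exact: (integrable_fin_num _ (bint mG G0 GM)).
transitivity (image_measure (density_measure P mG G0) mPhi' S); first by [].
transitivity (density_measure mu mpsi psi_ge0 S); last first.
  rewrite /= /density; apply: eq_integral => phi; rewrite inE => /Spi /=.
  rewrite in_itv/= => /andP[h1 h2]; rewrite /psi in_itv/= h1 ltW//= fineK//.
have subT (x : R) : x < - pi -> `]x, +oo[%classic `&` I = I.
  move=> xpi; rewrite /I; apply/seteqP; split => y //=; first by case.
  by move=> h; split => //; move: h; rewrite !in_itv/= andbT => /andP[h _]; exact: lt_le_trans h.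
apply: (@rays_measure_unique R (image_measure (density_measure P mG G0) mPhi')
  (density_measure mu mpsi psi_ge0)) => //.
- rewrite /= /pushforward preimage_setT /density totalE [RHS]psi_restrict//.
  by rewrite setTI.
- rewrite /= /pushforward preimage_setT /density.
  exact: (integrable_lty measurableT (bint mG G0 GM)).
move=> x; rewrite /= /pushforward /density [RHS]psi_restrict//.
have [xpi|xpi] := ltP x (- pi).
  rewrite subT// -totalE; congr (integral _ _ _).
  apply/seteqP; split => w //= _; rewrite in_itv/= andbT (lt_le_trans xpi)//.
  by case/andP: (Phipi w).
have [xpi'|xpi'] := ltP x pi; last first.
  have -> : Phi @^-1` `]x, +oo[%classic = set0.
    apply/seteqP; split => w //=; rewrite in_itv/= andbT => /lt_trans.
    by move=> h; case/andP: (Phipi w) => _ /h; rewrite ltNge xpi'.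
  have -> : `]x, +oo[%classic `&` I = set0 :> set MR.
    rewrite /I; apply/seteqP; split => y //= []; rewrite !in_itv/= andbT => h /andP[_ h'].
    by have := lt_le_trans h (le_trans h' xpi'); rewrite ltxx.
  by rewrite !integral_set0.
have -> : `]x, +oo[%classic `&` I = `]x, pi]%classic :> set MR.
  rewrite /I; apply/seteqP; split => y /=; rewrite !in_itv/= andbT.
    by move=> [-> /andP[_ ->]].
  by move=> /andP[h1 h2]; rewrite h1 h2 andbT (le_trans xpi)// ltW.
rewrite integral_itv_obnd_cbnd; last by apply: measurable_funTS; exact/measurable_EFinP.
rewrite psiE ?xpi// (ray_measure _ mG G0 GM mPhi).
rewrite (@ray_identity _ _ _ P G G Phi alpha M r)//.
- by case/andP: r01 => -> /ltW ->.
- by case/andP: r01.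
- by rewrite xpi.
Qed.

End laws_from_transforms.

(** * First passages of a continuous function and their grid approximation *)

Section level_crossing.
Context {R : realType}.
Context (nu : R -> R) (cnu : continuous nu).

Lemma near_gt (c t : R) : c < nu t -> exists2 e, 0 < e & forall u, `|u - t| < e -> c < nu u.
Proof.
move=> ct; have : \forall u \near t, c < nu u
  by exact: (@cvgr_gt _ _ (nbhs t) _ nu (nu t) (@cnu t) c ct).
move=> /nbhs_ballP[e /= e0 h]; exists e => // u ut; apply: h.
by rewrite /ball /= distrC.
Qed.

Lemma near_lt (c t : R) : nu t < c -> exists2 e, 0 < e & forall u, `|u - t| < e -> nu u < c.
Proof.
move=> ct; have : \forall u \near t, nu u < c by exact: (@cvgr_lt _ _ (nbhs t) _ nu (nu t) (@cnu t) c ct).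
move=> /nbhs_ballP[e /= e0 h]; exists e => // u ut; apply: h.
by rewrite /ball /= distrC.
Qed.

Lemma level_attained r t : nu 0 <= r -> 0 <= t -> r <= nu t ->
  exists2 s, 0 <= s <= t & nu s = r.
Proof.
move=> n0 t0 rt.
have [s sI sE] : exists2 c, c \in `[0, t] & nu c = r.
  apply: IVT => //; first exact: continuous_subspaceT.
  by rewrite ge_min le_max n0 rt orbT.
by exists s => //; move: sI; rewrite in_itv.
Qed.

Definition hitting_set r : set R := [set t | 0 <= t /\ nu t = r].

(** A real infimum, significant only when the level is attained; hence the witness [t] in the lemmas
    below. *)
Definition first_hit r : R := inf (hitting_set r).

Lemma first_hit_min r t : hitting_set r t -> first_hit r <= t.
Proof. by move=> h; apply: ge_inf => //; exists 0 => s []. Qed.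

Lemma first_hit_ge0 r t : hitting_set r t -> 0 <= first_hit r.
Proof. by move=> h; apply: lb_le_inf; [exists t|move=> s []]. Qed.

Lemma first_hitP r t : hitting_set r t -> nu (first_hit r) = r.
Proof.
move=> h; have hinf : has_inf (hitting_set r).
  by split; [exists t|exists 0 => s []].
apply/eqP/negPn/negP => /eqP nr.
have [e e0 he] : exists2 e, 0 < e & forall u, `|u - first_hit r| < e -> nu u <> r.
  have [lt_nr|lt_nr|//] := ltgtP (nu (first_hit r)) r.
    have [e e0 he] := near_lt lt_nr; exists e => // u /he ur uE.
    by rewrite uE ltxx in ur.
  have [e e0 he] := near_gt lt_nr; exists e => // u /he ur uE.
  by rewrite uE ltxx in ur.
have [s [s0 sE] slt] := inf_adherent e0 hinf.
have := he s; rewrite -/(first_hit r) in slt *; apply => //.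
have := @first_hit_min r s (conj s0 sE) => hs.
by rewrite ger0_norm ?subr_ge0// ltrBlDl.
Qed.

Lemma first_hit_lt r t s : nu 0 < r -> hitting_set r t -> 0 <= s ->
  s < first_hit r -> nu s < r.
Proof.
move=> n0 h s0 sh; rewrite ltNge; apply/negP => rs.
have [s' /andP[s'0 s's] s'E] := level_attained (ltW n0) s0 rs.
have := @first_hit_min r s' (conj s'0 s'E) => hs.
by move: (lt_le_trans sh hs); rewrite ltNge s's.
Qed.

(** Strict excess is stable under small changes of time, so a fine grid detects it, while it may
    step over every time of [hitting_set]. *)
Definition exit_set c : set R := [set t | 0 <= t /\ c < nu t].

Definition exit_time c : R := inf (exit_set c).

Lemma exit_time_le c t : exit_set c t -> exit_time c <= t.
Proof. by move=> h; apply: ge_inf => //; exists 0 => s []. Qed.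

Lemma exit_time_ge0 c t : exit_set c t -> 0 <= exit_time c.
Proof. by move=> h; apply: lb_le_inf; [exists t|move=> s []]. Qed.

Definition level r (n : nat) : R := r - (n.+1)%:R^-1.

Lemma level_lt r n : level r n < r.
Proof. by rewrite /level gtrBl invr_gt0 ltr0n. Qed.

Lemma exit_set_level r t n : hitting_set r t -> exit_set (level r n) (first_hit r).
Proof.
move=> h; split; first exact: first_hit_ge0 h.
by rewrite (first_hitP h) level_lt.
Qed.

(** Up to time [first_hit r - e] the function stays below [r], hence by compactness below some
    [M < r]. Levels above [M] are therefore exceeded only later, and in any case no later than
    [first_hit r]. *)
Lemma cvg_exit_time_level r t : nu 0 < r -> hitting_set r t ->
  (fun n => exit_time (level r n)) @ \oo --> first_hit r.
Proof.
move=> n0 h; apply/cvgrPdist_le => e e0.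
have t00 := first_hit_ge0 h.
suff [M Mr hM] : exists2 M, M < r & forall s, 0 <= s -> s <= first_hit r - e -> nu s <= M.
  have : \forall n \near \oo, M < level r n.
    have cl : level r @ \oo --> r.
      rewrite -[X in _ --> X]subr0; apply: cvgB; first exact: cvg_cst.
      exact: cvg_harmonic.
    exact: (cvgr_gt _ cl).
  apply: filterS => n Mn; have le1 := exit_time_le (exit_set_level n h).
  rewrite ger0_norm ?subr_ge0// lerBlDr -lerBlDl.
  apply: lb_le_inf; first by exists (first_hit r); exact: exit_set_level h.
  move=> s [s0 hs]; rewrite leNgt; apply/negP => /ltW hs'.
  by have := lt_le_trans hs (hM _ s0 hs'); rewrite ltNge ltW.
have [he|he] := ltP (first_hit r - e) 0.
  exists (nu 0) => // s s0 hs; exfalso.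
  by have := le_lt_trans (le_trans s0 hs) he; rewrite ltxx.
have [c cI hc] := EVT_max he (continuous_subspaceT cnu).
exists (nu c); last by move=> s s0 hs; apply: hc; rewrite in_itv/= s0.
move: cI; rewrite in_itv/= => /andP[c0 ce].
by apply: (first_hit_lt n0 h c0); apply: le_lt_trans ce _; rewrite gtrBl.
Qed.

(** The mesh goes with [8 ^ k] steps: the horizon [2 ^+ k] eventually passes every exit time, while
    the number of steps times the squared mesh is [2^-1 ^+ k]. *)
Definition step (k : nat) : R := 4^-1 ^+ k.

(* The junk value is [8 ^ k], when the level is not exceeded before time [2 ^ k]. *)
Definition grid_exit c k : nat :=
  find (fun j => c < nu (j%:R * step k)) (iota 0 (8 ^ k)).

Lemma step_gt0 k : 0 < step k.
Proof. by rewrite exprn_gt0// invr_gt0. Qed.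

Lemma cvg_step : step @ \oo --> (0 : R).
Proof. by apply: cvg_expr; rewrite ger0_norm// invf_lt1// ltr1n. Qed.

Lemma horizon k : (8 ^ k)%:R * step k = 2 ^+ k.
Proof.
rewrite /step natrX -exprMn; congr (_ ^+ k).
by rewrite (_ : 8%:R = 2 * 4)// ?mulfK// -natrM.
Qed.

Lemma grid_exit_gt c k : (grid_exit c k < 8 ^ k)%N ->
  c < nu ((grid_exit c k)%:R * step k).
Proof.
move=> h; have hs : has (fun j => c < nu (j%:R * step k)) (iota 0 (8 ^ k)).
  by rewrite has_find size_iota.
by have := nth_find 0%N hs; rewrite nth_iota// add0n.
Qed.

Lemma grid_exit_le c k j : (j < 8 ^ k)%N -> c < nu (j%:R * step k) ->
  (grid_exit c k <= j)%N.
Proof.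
move=> j8 cj; rewrite leqNgt; apply/negP => h.
have := before_find 0%N h; rewrite nth_iota// add0n cj.
by [].
Qed.

(** A grid time exceeding the level is itself in [exit_set], so the approximation is from above.
    Conversely, near an exit [s] close to the infimum the level is exceeded on a whole interval,
    which contains a grid time once the mesh is small. *)
Lemma cvg_grid_exit c t : exit_set c t ->
  (fun k => (grid_exit c k)%:R * step k) @ \oo --> exit_time c.
Proof.
move=> ct; apply/cvgrPdist_le => e e0.
have hinf : has_inf (exit_set c) by split; [exists t|exists 0 => s []].
have [s [s0 sc] se] := inf_adherent e0 hinf; rewrite -/(exit_time c) in se.
have [d d0 hd] := near_gt sc.
(* Within [d'] after [s] the level is still exceeded, and the time is still less than [e] past the
   infimum. *)
pose d' := Num.min d (exit_time c + e - s).
have d'0 : 0 < d' by rewrite lt_min d0 subr_gt0.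
have n1 : \forall k \near \oo, step k < d'.
  exact: (cvgr_lt _ cvg_step).
have n2 : \forall k \near \oo, s + d' < k%:R by exact: nbhs_infty_gtr.
near=> k.
have k1 : step k < d' by near: k.
have k2 : s + d' < 2 ^+ k.
  apply: (@lt_trans _ _ k%:R); first by near: k.
  by rewrite -natrX ltr_nat ltn_expl.
have sk := step_gt0 k.
pose j := (Num.truncn (s / step k)).+1.
have /andP[j1 j2] := truncn_itv (divr_ge0 s0 (ltW sk)).
have js : s < j%:R * step k by rewrite -ltr_pdivrMr.
have js' : j%:R * step k <= s + step k.
  by rewrite -natr1 mulrDl mul1r lerD2r -ler_pdivlMr.
have jlt : j%:R * step k < s + d' by apply: le_lt_trans js' _; rewrite ltrD2l.
have j8 : (j < 8 ^ k)%N.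
  rewrite -(ltr_nat R) -(ltr_pM2r sk) horizon.
  exact: lt_trans k2.
have cj : c < nu (j%:R * step k).
  apply: hd; rewrite gtr0_norm ?subr_gt0//.
  by rewrite ltrBlDl (lt_le_trans jlt)// lerD2l /d' ge_min lexx.
have gj := grid_exit_le j8 cj.
have g8 := leq_ltn_trans gj j8.
have le1 : exit_time c <= (grid_exit c k)%:R * step k.
  apply: exit_time_le; split; first by rewrite mulr_ge0// ltW.
  exact: grid_exit_gt.
rewrite distrC ger0_norm ?subr_ge0// lerBlDl.
apply: (@le_trans _ _ (j%:R * step k)); first by rewrite ler_pM2r// ler_nat.
apply: (le_trans (ltW jlt)); rewrite -lerBrDl /d' ge_min.
by apply/orP; right; rewrite addrC.
Unshelve. all: by end_near. Qed.

(* Only countably many times occur on the right-hand side, which makes hitting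
   events measurable. *)
Lemma hitting_set_grid r : nu 0 < r ->
  (exists t, hitting_set r t) <->
  exists N : nat, forall n : nat, exists k j : nat,
    j%:R * step k <= N%:R /\ level r n < nu (j%:R * step k).
Proof.
move=> n0; split.
  move=> [t [t0 tr]].
  (* One unit above [t] for the truncation and one more for the grid point, which may lie up to a
     full step, less than 1, after [t]. *)
  exists (Num.truncn t).+2 => n.
  have /andP[_ tn] := truncn_itv t0.
  have lt : level r n < nu t by rewrite tr level_lt.
  have [d d0 hd] := near_gt lt.
  have d'0 : 0 < Num.min d 1 by rewrite lt_min d0/=.
  have n1 : \forall k \near \oo, step k < Num.min d 1.
    exact: (cvgr_lt _ cvg_step).
  have [k _ kd] := n1; have := kd k (leqnn k) => /= {}kd.
  have sk := step_gt0 k.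
  exists k, (Num.truncn (t / step k)).+1.
  have /andP[j1 j2] := truncn_itv (divr_ge0 t0 (ltW sk)).
  set j := (Num.truncn (t / step k)).+1.
  have js : t < j%:R * step k by rewrite -ltr_pdivrMr.
  have js' : j%:R * step k <= t + step k.
    by rewrite -natr1 mulrDl mul1r lerD2r -ler_pdivlMr.
  move: kd; rewrite lt_min => /andP[kd k1]; split.
    by apply: le_trans js' _; rewrite -natr1 lerD// ltW.
  apply: hd; rewrite gtr0_norm ?subr_gt0// ltrBlDl.
  by apply: le_lt_trans js' _; rewrite ltrD2l.
move=> [N H].
(* The maximum over the fixed horizon exceeds every level below [r], so it is at least [r], and the
   intermediate value theorem gives a hit. *)
have [c cI hc] := EVT_max (ler0n R N) (continuous_subspaceT cnu).
have rc : r <= nu c.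
  rewrite leNgt; apply/negP => cr.
  have cl : level r @ \oo --> r.
    rewrite -[X in _ --> X]subr0; apply: cvgB; first exact: cvg_cst.
    exact: cvg_harmonic.
  have : \forall n \near \oo, nu c < level r n by exact: (cvgr_gt _ cl).
  move=> [n _ /(_ n (leqnn n)) /= cn].
  have [k [j [jN jn]]] := H n.
  have h0 : 0 <= j%:R * step k by rewrite mulr_ge0// ltW// step_gt0.
  have hI : j%:R * step k \in `[0, N%:R] by rewrite in_itv/= h0.
  have := hc _ hI; rewrite leNgt => /negP; apply.
  exact: lt_trans jn.
move: cI; rewrite in_itv/= => /andP[c0 _].
have [s /andP[s0 _] sE] := level_attained (ltW n0) c0 rc.
by exists s.
Qed.

End level_crossing.

(** * Brownian motion sampled on a grid *)

Section brownian.
Context {R : realType} {d : measure_display} {T : measurableType d}.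
Context (P : probability T R) (B : R -> T -> R * R) (x0 : R * R).
Context (bm : is_BM2 P B x0).

Definition incr1 (h : R) (i : nat) (w : T) : R :=
  (B (i.+1%:R * h) w).1 - (B (i%:R * h) w).1.
Definition incr2 (h : R) (i : nat) (w : T) : R :=
  (B (i.+1%:R * h) w).2 - (B (i%:R * h) w).2.

Lemma brownian_iid (h : R) : 0 < h ->
  iid_pairs P (gauss (Num.sqrt h)) (incr1 h) (incr2 h).
Proof.
case: bm => _ _ mB ind h0.
have ih n : 0 <= n%:R * h by rewrite mulr_ge0// ltW.
split.
- by move=> i; apply: measurable_funB; [have [] := mB _ (ih i.+1)|have [] := mB _ (ih i)].
- by move=> i; apply: measurable_funB; [have [_ ?] := mB _ (ih i.+1)|have [_ ?] := mB _ (ih i)].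
- move=> n A C mA mC.
  have := ind n (fun i => i%:R * h) _ _ A C mA mC.
  rewrite mul0r => /(_ erefl) -> => [|i _]; last by rewrite ltr_pM2r// ltr_nat.
  apply: eq_bigr => i _; rewrite -mulrBl -natr1 addrC addKr mul1r.
  by rewrite !gaussE.
Qed.

Lemma brownian_walk (h : R) j w :
  walk (incr1 h) (incr2 h) x0 j w = B (j%:R * h) w.
Proof.
case: bm => B0 _ _ _; elim: j => [|j IH].
  by rewrite /walk !big_ord0 !addr0 mul0r B0 -surjective_pairing.
rewrite walkS IH /incr1 /incr2 !subrKC; exact: esym (surjective_pairing _).
Qed.

Lemma incr_law (h : R) j (A : set R) : 0 < h -> measurable A ->
  P [set w | A (incr1 h j w)] = gauss (Num.sqrt h) A /\
  P [set w | A (incr2 h j w)] = gauss (Num.sqrt h) A.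
Proof.
move=> h0 mA; have iid := brownian_iid h0.
have sT : (<<s cylinder (incr1 h) (incr2 h) j >>) setT
  by exact: (@measurableT _ (pastType (incr1 h) (incr2 h) j)).
have := past_independent iid sT mA measurableT.
have := past_independent iid sT measurableT mA.
rewrite !setTI [P setT]probability_setT [gauss _ setT]probability_setT !mul1e mule1 => h2 h1.
split.
  by rewrite -h1; congr (P _); apply/seteqP; split => w //= [].
by rewrite -h2; congr (P _); apply/seteqP; split => w //= [].
Qed.

Lemma incr_fourth_moment (h : R) j : 0 < h ->
  (\int[P]_w (incr1 h j w ^+ 4 + incr2 h j w ^+ 4)%:E <= (256 * h ^+ 2)%:E)%E.
Proof.
move=> h0; have [m1 m2 _] := brownian_iid h0.
have key (X : T -> measurableTypeR R) : measurable_fun setT X ->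
    (forall A : set R, measurable A -> P [set w | A (X w)] = gauss (Num.sqrt h) A) ->
    (\int[P]_w ((X w : R) ^+ 4)%:E <= (128 * h ^+ 2)%:E)%E.
  move=> mX XE.
  have m4 : measurable_fun setT (fun x : measurableTypeR R => ((x : R) ^+ 4)%:E).
    by apply/measurable_EFinP; exact: measurable_funX.
  rewrite -(@ge0_integral_law _ _ _ _ _ P X mX (fun x => ((x : R) ^+ 4)%:E))//; last first.
    by move=> x; rewrite lee_fin exprn_even_ge0.
  rewrite (eq_measure_integral (@normal_prob R 0 (Num.sqrt h))).
    have s0 : 0 < Num.sqrt h by rewrite sqrtr_gt0.
    have := normal_fourth_moment s0.
    by rewrite (exprM _ 2 2) sqr_sqrtr// ltW.
  by move=> A mA _; rewrite /law /= /distribution /pushforward; exact: XE.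
under eq_integral do rewrite EFinD.
rewrite ge0_integralD//=.
- apply: (@le_trans _ _ ((128 * h ^+ 2)%:E + (128 * h ^+ 2)%:E)%E); last first.
    by rewrite -EFinD lee_fin; lra.
  apply: leeD; first by apply: (key _ (m1 j)) => A mA; have [] := incr_law j h0 mA.
  by apply: (key _ (m2 j)) => A mA; have [] := incr_law j h0 mA.
- by move=> w _; rewrite lee_fin exprn_even_ge0.
- by apply/measurable_EFinP; exact: measurable_funX.
- by move=> w _; rewrite lee_fin exprn_even_ge0.
- by apply/measurable_EFinP; exact: measurable_funX.
Qed.

(** The absolute value reflects the path to negative times, which gives a function continuous on the
    whole line as the level-crossing lemmas require. *)
Definition radial (w : T) (t : R) : R := norm2 (B `|t| w).

Lemma norm2_continuous : continuous (@norm2 R).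
Proof.
move=> p; apply: (@continuous_comp _ _ _ (fun p : R * R => p.1 ^+ 2 + p.2 ^+ 2) Num.sqrt).
  apply: cvgD.
    apply: (@cvg_comp _ _ _ fst (fun x : R => x ^+ 2)); first exact: cvg_fst.
    exact: sqr_continuous.
  apply: (@cvg_comp _ _ _ snd (fun x : R => x ^+ 2)); first exact: cvg_snd.
  exact: sqr_continuous.
exact: sqrt_continuous.
Qed.

Lemma continuous_path w : continuous (fun t : R => B `|t| w).
Proof.
case: bm => _ cB _ _ t.
have := (@subspace_continuousP _ _ _ _).1 (cB w) (`|t| : R).
rewrite /= in_itv/= andbT normr_ge0 => /(_ isT) cBt.
apply: (@cvg_comp _ _ _ (fun x : R => `|x|) (fun t => B t w) _ _ _ _ cBt).
move=> U hU.
have h : \forall x \near t, `[0, +oo[%classic `|x| -> U `|x|.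
  exact: (@norm_continuous _ R^o t _ hU).
by apply: filterS h => x; apply; rewrite /= in_itv/= andbT.
Qed.

Lemma continuous_radial w : continuous (radial w).
Proof.
move=> t; apply: (@continuous_comp _ _ _ (fun t : R => B `|t| w) (@norm2 R)).
  exact: continuous_path.
exact: norm2_continuous.
Qed.

Lemma radialE w t : 0 <= t -> radial w t = norm2 (B t w).
Proof. by move=> t0; rewrite /radial ger0_norm. Qed.

Lemma radial0 w : radial w 0 = norm2 x0.
Proof. by case: bm => B0 _ _ _; rewrite /radial normr0 B0. Qed.

Lemma exit_index_grid c k w :
  exit_index (incr1 (step k)) (incr2 (step k)) x0 c (8 ^ k) w =
  grid_exit (radial w) c k.
Proof.
apply: eq_find => j; rewrite brownian_walk radialE// mulr_ge0// ltW//.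
exact: step_gt0.
Qed.

Lemma measurable_brownian t : 0 <= t -> measurable_fun setT (B t).
Proof.
case: bm => _ _ mB _ t0; have [m1 m2] := mB t t0.
by apply/measurable_fun_pairP.
Qed.

(** If the norm never exceeds [c] at integer times, then at each time [n.+1 ^ 2] the first
    coordinate lies in an interval of length [2 * c]. For a normal law of standard deviation [n.+1]
    this has probability of order [n.+1%:R^-1], which tends to zero. *)
Lemma brownian_large_time (c : R) : 0 <= c ->
  P (\bigcup_n [set w | c < norm2 (B n%:R w)]) = 1%E.
Proof.
move=> c0.
have mE n : measurable [set w | c < norm2 (B n%:R w)].
  have := measurableT_comp (@measurable_norm2 R) (measurable_brownian (ler0n R n)).
  move=> /(_ measurableT `]c, +oo[%classic (measurable_itv _)).
  by rewrite setTI; congr (measurable _); apply/seteqP; split => w /=; rewrite in_itv/= andbT.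
set E := \bigcup_n _.
have mEE : measurable E by apply: bigcupT_measurable.
have bound n : (P (~` E) <= (n.+1%:R^-1 * (normal_peak 1 * (2 * c)))%:E)%E.
  have n0 : 0 < (n.+1 ^ 2)%:R :> R by rewrite ltr0n expn_gt0.
  have [h1 _] := @incr_law (n.+1 ^ 2)%:R 0 `[- c - x0.1, c - x0.1]%classic n0 (measurable_itv _).
  apply: (@le_trans _ _ (gauss (Num.sqrt (n.+1 ^ 2)%:R) `[- c - x0.1, c - x0.1]%classic)).
    rewrite -h1; apply: le_measure; rewrite ?inE.
    - exact: measurableC.
    - have [m1 _ _] := brownian_iid n0.
      by have := m1 0%N measurableT `[- c - x0.1, c - x0.1]%classic (measurable_itv _); rewrite setTI.
    move=> w hw; rewrite /= in_itv/= /incr1 mul0r mul1r.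
    have [B0 _ _ _] := bm; rewrite B0.
    have : norm2 (B (n.+1 ^ 2)%:R w) <= c.
      by rewrite leNgt; apply/negP => h; apply: hw; exists (n.+1 ^ 2)%N.
    move=> h; have : `|(B (n.+1 ^ 2)%:R w).1| <= c.
      apply: le_trans h; rewrite /norm2 -sqrtr_sqr ler_wsqrtr// lerDl sqr_ge0//.
    rewrite ler_norml => /andP[g1 g2]; apply/andP; split; lra.
  rewrite gaussE; apply: le_trans (normal_itv_le _ _) _.
  - by rewrite gt_eqF// sqrtr_gt0.
  - lra.
  - rewrite lee_fin (_ : c - x0.1 - (- c - x0.1) = 2 * c); last by ring.
    rewrite natrX sqrtr_sqr ger0_norm// mulrA ler_wpM2r ?mulr_ge0//.
    rewrite /normal_peak expr1n mul1r -mulrnAr sqrtrM ?sqr_ge0//.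
    by rewrite sqrtr_sqr ger0_norm// invfM.
have cv : (fun n => (n.+1%:R^-1 * (normal_peak 1 * (2 * c)))%:E) @ \oo --> (0%E : \bar R).
  apply: cvg_EFin; first exact: nearW.
  rewrite /comp /= -(mul0r (normal_peak 1 * (2 * c))).
  by apply: cvgM; [exact: cvg_harmonic|exact: cvg_cst].
have E0 : P (~` E) = 0%E.
  apply/eqP; rewrite eq_le measure_ge0 andbT.
  by apply: (cvge_to_ge cv); exact: nearW.
by rewrite -[E]setCK probability_setC ?E0 ?sube0//; exact: measurableC.
Qed.

End brownian.

(** * Limits that exist on an event of full probability *)

Section limits_on_full_sets.
Context {R : realType} {d : measure_display} {T : measurableType d}.
Context (P : probability T R) (D : set T) (mD : measurable D).

(** Almost sure convergence alone does not make the limit measurable when the measure is not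
    complete. Replacing the sequence by the constant [v] off [D] makes it converge everywhere to
    [F]. *)
Lemma measurable_limit_on (f_ : nat -> T -> R) (F : T -> R) (v : R) :
  (forall n, measurable_fun setT (f_ n)) ->
  (forall w, D w -> f_ ^~ w @ \oo --> F w) ->
  (forall w, ~ D w -> F w = v) -> measurable_fun setT F.
Proof.
move=> mf fF Fv.
apply: (@measurable_fun_cvg _ _ _ setT (fun n w => \1_D w * (f_ n w - v) + v)).
  move=> n; apply: measurable_funD => //; apply: measurable_funM.
    exact: measurable_indic.
  exact: measurable_funB.
move=> w _; have [wD|wD] := pselect (D w).
  rewrite indicE mem_set//; under eq_fun do rewrite mul1r subrK.
  exact: fF.
rewrite indicE memNset//; under eq_fun do rewrite mul0r add0r.
by rewrite Fv//; exact: cvg_cst.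
Qed.

Lemma Rintegral_limit_on (f_ : nat -> T -> R) (F : T -> R) (M v : R) :
  P D = 1%E -> (forall n, measurable_fun setT (f_ n)) ->
  (forall n w, `|f_ n w| <= M) ->
  (forall w, D w -> f_ ^~ w @ \oo --> F w) ->
  (forall w, ~ D w -> F w = v) ->
  (fun n => \int[P]_w f_ n w) @ \oo --> \int[P]_w F w.
Proof.
move=> PD mf fM fF Fv; apply: (@bounded_cvg_Rintegral _ _ _ P _ _ M) => //.
  exact: measurable_limit_on fF Fv.
exists (~` D); split; first exact: measurableC.
  by rewrite probability_setC// PD subee.
by move=> w /= h hD; apply: h; exact: fF.
Qed.

End limits_on_full_sets.

(** * Optional stopping at hitting times of circles *)

Section optional_stopping.
Context {R : realType} {d : measure_display} {T : measurableType d}.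
Context (P : probability T R) (B : R -> T -> R * R) (x0 : R * R).
Context (bm : is_BM2 P B x0) (b : R) (x0b : norm2 x0 < b).

Notation rad := (radial B).

Definition hits (r : R) : set T := [set w | exists t, hitting_set (rad w) r t].

Lemma measurable_hits (r : R) : norm2 x0 < r -> measurable (hits r).
Proof.
move=> x0r.
have -> : hits r = \bigcup_N \bigcap_n \bigcup_k \bigcup_j
    [set w | j%:R * step k <= N%:R :> R /\ level r n < rad w (j%:R * step k)].
  apply/seteqP; split => w.
    move=> hw; have n0 : rad w 0 < r by rewrite (radial0 bm).
    have [N HN] := (hitting_set_grid (continuous_radial bm (w := w)) n0).1 hw.
    exists N => // n _; have [k [j kj]] := HN n.
    by exists k => //; exists j.
  move=> [N _ HN].
  have n0 : rad w 0 < r by rewrite (radial0 bm).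
  apply: (hitting_set_grid (continuous_radial bm (w := w)) n0).2.
  by exists N => n; have [k _ [j _ kj]] := HN n I; exists k, j.
apply: bigcupT_measurable => N; apply: bigcapT_measurable => n.
apply: bigcupT_measurable => k; apply: bigcupT_measurable => j.
have t0 : 0 <= j%:R * step k :> R by rewrite mulr_ge0// ltW// step_gt0.
have [jN|jN] := leP (j%:R * step k) (N%:R : R); last first.
  by rewrite (_ : [set _ | _] = set0)//; apply/seteqP; split => w //= [].
have := measurableT_comp (@measurable_norm2 R) (measurable_brownian bm t0).
move=> /(_ measurableT `]level r n, +oo[%classic (measurable_itv _)).
rewrite setTI; congr (measurable _); apply/seteqP; split => w /=.
  by rewrite in_itv/= andbT radialE.
by rewrite in_itv/= andbT radialE// => -[].
Qed.

Lemma probability_hits (r : R) : norm2 x0 < r -> P (hits r) = 1%E.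
Proof.
move=> x0r; apply/eqP; rewrite eq_le probability_le1; last exact: measurable_hits.
have r0 : 0 <= r by rewrite ltW// (le_lt_trans (norm2_ge0 x0)).
rewrite -(brownian_large_time bm r0); apply: le_measure; rewrite ?inE.
- apply: bigcupT_measurable => n.
  have := measurableT_comp (@measurable_norm2 R) (measurable_brownian bm (ler0n R n)).
  move=> /(_ measurableT `]r, +oo[%classic (measurable_itv _)).
  by rewrite setTI; congr (measurable _); apply/seteqP; split => w /=; rewrite in_itv/= andbT.
- exact: measurable_hits.
move=> w [n _ /= rn].
have n0 : rad w 0 <= r by rewrite (radial0 bm) ltW.
have rn' : r <= rad w n%:R by rewrite radialE// ltW.
have [s /andP[s0 _] sE] := level_attained (continuous_radial bm (w := w)) n0 (ler0n R n) rn'.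
by exists s.
Qed.

Definition grid_position (c : R) (k : nat) (w : T) : R * R :=
  B ((grid_exit (rad w) c k)%:R * step k) w.

Lemma grid_position_walk c k w : grid_position c k w =
  walk (incr1 B (step k)) (incr2 B (step k)) x0
    (exit_index (incr1 B (step k)) (incr2 B (step k)) x0 c (8 ^ k) w) w.
Proof. by rewrite (exit_index_grid bm) (brownian_walk bm). Qed.

Lemma measurable_grid_position c k : measurable_fun setT (grid_position c k).
Proof.
rewrite (funext (grid_position_walk c k)).
exact: (measurable_walk_exit_index (brownian_iid bm (step_gt0 k))).
Qed.

Lemma grid_expectation (f g : R * R -> R) (M Mg C c1 c2 : R) k :
  measurable_fun setT f -> (forall p, `|f p| <= M) ->
  measurable_fun setT g -> (forall p, `|g p| <= Mg) -> 0 <= C -> c1 <= c2 ->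
  (forall p q, norm2 p <= c2 ->
     `|four_point f p q| <= C * (q.1 ^+ 4 + q.2 ^+ 4)) ->
  `|\int[P]_w (g (grid_position c1 k w) *
     (f (grid_position c2 k w) - f (grid_position c1 k w)))|
  <= 2^-1 ^+ k * (Mg * C * 256).
Proof.
move=> mf fM mg gM C0 c12 fC.
have iid := brownian_iid bm (step_gt0 k).
have ge : Num.sqrt (step k) != 0 :> R by rewrite gt_eqF// sqrtr_gt0 step_gt0.
have := exit_expectation iid (gauss_even ge) x0 (8 ^ k) mf fM mg gM C0 c12 fC
  (fun j => incr_fourth_moment bm j (step_gt0 k)).
under eq_Rintegral do rewrite -!grid_position_walk.
move=> h; apply: (le_trans h); rewrite le_eqVlt; apply/orP; left; apply/eqP.
(* There are [8 ^ k] steps, each costing a multiple of the squared mesh [16^-1 ^+ k]. *)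
have -> : 2^-1 ^+ k = (8 ^ k)%:R * step k ^+ 2 :> R.
  rewrite /step -exprM mulnC exprM natrX -exprMn; congr (_ ^+ k).
  by field.
ring.
Qed.

Lemma radial_le_first_hit w t : hits b w -> 0 <= t -> t <= first_hit (rad w) b ->
  norm2 (B t w) <= b.
Proof.
move=> [t' ht'] t0; rewrite -radialE// le_eqVlt => /predU1P[->|tb].
  by rewrite (first_hitP (continuous_radial bm (w := w)) ht').
apply: ltW; apply: (first_hit_lt (continuous_radial bm (w := w)) _ ht' t0 tb).
by rewrite (radial0 bm).
Qed.

Lemma exit_set_first_hit c w : hits b w -> c < b ->
  exit_set (rad w) c (first_hit (rad w) b).
Proof.
move=> [t ht] cb; split; first exact: first_hit_ge0 ht.
by rewrite (first_hitP (continuous_radial bm (w := w)) ht).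
Qed.

(** Two successive limits under bounded convergence: for fixed levels the mesh tends to zero, then
    the levels vary with [n]. The margin [b < rho] makes [f] and [g] continuous at every position up
    to the hit of [b]. The levels are left general so that [tau1] can be either a hitting time or
    the initial time. *)
Lemma optional_stopping (f g : R * R -> R) (M Mg C rho : R) (c1 c2 : nat -> R)
    (tau1 tau2 : T -> R) (D : set T) :
  measurable D -> P D = 1%E -> D `<=` hits b ->
  measurable_fun setT f -> (forall p, `|f p| <= M) ->
  measurable_fun setT g -> (forall p, `|g p| <= Mg) -> 0 <= C -> b < rho ->
  (forall p, norm2 p < rho -> {for p, continuous f}) ->
  (forall p, norm2 p < rho -> {for p, continuous g}) ->
  (forall p q, norm2 p <= b ->
     `|four_point f p q| <= C * (q.1 ^+ 4 + q.2 ^+ 4)) ->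
  (forall n, c1 n <= c2 n) -> (forall n, c2 n < b) ->
  (forall w, D w -> (fun n => exit_time (rad w) (c1 n)) @ \oo --> tau1 w) ->
  (forall w, D w -> (fun n => exit_time (rad w) (c2 n)) @ \oo --> tau2 w) ->
  \int[P]_w (\1_D w *
    (g (B (tau1 w) w) * (f (B (tau2 w) w) - f (B (tau1 w) w)))) = 0.
Proof.
move=> mD PD Db mf fM mg gM C0 brho cf cg fC c12 c2b cv1 cv2.
have Mg0 : 0 <= Mg by exact: le_trans (gM (0, 0)).
pose H p1 p2 := g p1 * (f p2 - f p1).
have HM p1 p2 : `|H p1 p2| <= Mg * (M + M).
  by rewrite normrM ler_pM// (le_trans (ler_normB _ _))// lerD.
have mH (Y1 Y2 : T -> R * R) : measurable_fun setT Y1 -> measurable_fun setT Y2 ->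
    measurable_fun setT (fun w => H (Y1 w) (Y2 w)).
  move=> m1 m2; apply: measurable_funM; first exact: (measurableT_comp mg).
  apply: measurable_funB; first exact: (measurableT_comp mf m2).
  exact: (measurableT_comp mf m1).
(* Only the limit times have to lie before the hit of [b]; the approximating positions may still be
   outside the disc. *)
have cvH w (s1 s2 : nat -> R) (t1 t2 : R) : D w ->
    0 <= t1 -> t1 <= first_hit (rad w) b -> 0 <= t2 -> t2 <= first_hit (rad w) b ->
    (forall n, 0 <= s1 n) -> (forall n, 0 <= s2 n) ->
    s1 @ \oo --> t1 -> s2 @ \oo --> t2 ->
    (fun n => H (B (s1 n) w) (B (s2 n) w)) @ \oo --> H (B t1 w) (B t2 w).
  move=> Dw t10 t1b t20 t2b s10 s20 st1 st2.
  have cB (s : nat -> R) (t : R) : 0 <= t -> (forall n, 0 <= s n) -> s @ \oo --> t ->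
      (fun n => B (s n) w) @ \oo --> B t w.
    move=> t0 s0 st.
    have -> : (fun n => B (s n) w) = (fun n => B `|s n| w).
      by apply/funext => n; rewrite ger0_norm.
    have h : (fun n => B `|s n| w) @ \oo --> B `|t| w.
      exact: (continuous_cvg _ (@continuous_path _ _ _ P B x0 bm w t) st).
    by rewrite ger0_norm in h.
  have n1 := le_lt_trans (radial_le_first_hit (Db _ Dw) t10 t1b) brho.
  have n2 := le_lt_trans (radial_le_first_hit (Db _ Dw) t20 t2b) brho.
  apply: cvgM; first exact: (continuous_cvg _ (cg _ n1) (cB _ _ t10 s10 st1)).
  apply: cvgB; first exact: (continuous_cvg _ (cf _ n2) (cB _ _ t20 s20 st2)).
  exact: (continuous_cvg _ (cf _ n1) (cB _ _ t10 s10 st1)).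
have exit_itv w c : D w -> c < b ->
    0 <= exit_time (rad w) c <= first_hit (rad w) b.
  move=> Dw cb; have h := exit_set_first_hit (Db _ Dw) cb.
  by rewrite (exit_time_ge0 h) (exit_time_le h).
have c1b n : c1 n < b by exact: le_lt_trans (c2b n).
pose F n w := \1_D w * H (B (exit_time (rad w) (c1 n)) w) (B (exit_time (rad w) (c2 n)) w).
have grid0 n w : D w ->
    (fun k => H (grid_position (c1 n) k w) (grid_position (c2 n) k w)) @ \oo --> F n w.
  move=> Dw; rewrite /F indicE mem_set// mul1r.
  have /andP[e1 e1'] := exit_itv _ _ Dw (c1b n).
  have /andP[e2 e2'] := exit_itv _ _ Dw (c2b n).
  apply: (cvH w (fun k => (grid_exit (rad w) (c1 n) k)%:R * step k)
    (fun k => (grid_exit (rad w) (c2 n) k)%:R * step k)) => //.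
  - by move=> k; rewrite mulr_ge0// ltW// step_gt0.
  - by move=> k; rewrite mulr_ge0// ltW// step_gt0.
  - exact: (cvg_grid_exit (continuous_radial bm (w := w)) (exit_set_first_hit (Db _ Dw) (c1b n))).
  - exact: (cvg_grid_exit (continuous_radial bm (w := w)) (exit_set_first_hit (Db _ Dw) (c2b n))).
have notD n w : ~ D w -> F n w = 0 by move=> nD; rewrite /F indicE memNset// mul0r.
have mgrid n k : measurable_fun setT
    (fun w => H (grid_position (c1 n) k w) (grid_position (c2 n) k w)).
  by apply: mH; exact: measurable_grid_position.
have mF n : measurable_fun setT (F n).
  exact: (measurable_limit_on mD (mgrid n) (grid0 n) (notD n)).
have F0 n : \int[P]_w F n w = 0.
  (* The grid expectations have two limits: the integral of [F n] by bounded convergence, and zero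
     by the estimate of order [2^-1 ^+ k]. *)
  have u1 := Rintegral_limit_on mD PD (mgrid n) (fun k w => HM _ _) (grid0 n) (notD n).
  have p2 : (fun k => 2^-1 ^+ k * (Mg * C * 256)) @ \oo --> (0 : R).
    rewrite -(mul0r (Mg * C * 256)); apply: cvgM; last exact: cvg_cst.
    by apply: cvg_expr; rewrite ger0_norm// invf_lt1// ltr1n.
  have p1 : (fun k => - (2^-1 ^+ k * (Mg * C * 256))) @ \oo --> (0 : R).
    by rewrite -oppr0; exact: cvgN.
  have fC' p q : norm2 p <= c2 n -> `|four_point f p q| <= C * (q.1 ^+ 4 + q.2 ^+ 4).
    by move=> h; apply: fC; rewrite (le_trans h)// ltW.
  have u2 : (fun k => \int[P]_w H (grid_position (c1 n) k w) (grid_position (c2 n) k w))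
      @ \oo --> (0 : R).
    apply: (squeeze_cvgr _ p1 p2); apply: nearW => k; rewrite -ler_norml.
    exact: (grid_expectation k mf fM mg gM C0 (c12 n) fC').
  by rewrite -(cvg_lim _ u1)// (cvg_lim _ u2).
have FM n w : `|F n w| <= Mg * (M + M).
  rewrite /F indicE; case: (_ \in _); rewrite ?mul1r// mul0r normr0.
  exact: le_trans (HM (0, 0) (0, 0)).
have FF w : D w -> F ^~ w @ \oo --> \1_D w * H (B (tau1 w) w) (B (tau2 w) w).
  move=> Dw; rewrite /F indicE mem_set// mul1r; under eq_fun do rewrite mul1r.
  have e1 n : 0 <= exit_time (rad w) (c1 n) by have /andP[] := exit_itv _ _ Dw (c1b n).
  have e2 n : 0 <= exit_time (rad w) (c2 n) by have /andP[] := exit_itv _ _ Dw (c2b n).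
  apply: cvH => //; [| | | |exact: cv1|exact: cv2].
  - apply: (cvgr_to_ge (cv1 w Dw)); exact: nearW.
  - apply: (cvgr_to_le (cv1 w Dw)); apply: nearW => n.
    by have /andP[] := exit_itv _ _ Dw (c1b n).
  - apply: (cvgr_to_ge (cv2 w Dw)); exact: nearW.
  - apply: (cvgr_to_le (cv2 w Dw)); apply: nearW => n.
    by have /andP[] := exit_itv _ _ Dw (c2b n).
have FnD w : ~ D w -> \1_D w * H (B (tau1 w) w) (B (tau2 w) w) = 0.
  by move=> nD; rewrite indicE memNset// mul0r.
have u := Rintegral_limit_on mD PD mF FM FF FnD.
rewrite -(cvg_lim _ u)//; under eq_fun do rewrite F0.
by rewrite lim_cst.
Qed.

End optional_stopping.

(** * A measurable formula for the angle *)

Section angles.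
Context {R : realType}.

(** The half-angle formula, the tangent of half the angle being [p.2 / (r + p.1)], with value [- pi]
    at the excluded point. Unlike the choice in [angle_of], it is visibly measurable. *)
Definition polar_angle (r : R) (p : R * R) : R :=
  if p.1 == - r then - pi else 2 * atan (p.2 / (r + p.1)).

Lemma norm2_polar (r th : R) : 0 <= r -> norm2 (r * cos th, r * sin th) = r.
Proof.
move=> r0; rewrite /norm2 /= !exprMn -mulrDr cos2Dsin2 mulr1 sqrtr_sqr.
exact: ger0_norm.
Qed.

Lemma norm2_sqr (p : R * R) : p.1 ^+ 2 + p.2 ^+ 2 = norm2 p ^+ 2.
Proof. by rewrite /norm2 sqr_sqrtr// addr_ge0 ?sqr_ge0. Qed.

Lemma polar_angle_itv r p : - pi <= polar_angle r p < pi.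
Proof.
rewrite /polar_angle; case: ifP => _.
  by rewrite lexx /=; have := pi_gt0 R; lra.
have := atan_ltpi2 (p.2 / (r + p.1)); have := atan_gtNpi2 (p.2 / (r + p.1)).
by move=> h1 h2; apply/andP; split; lra.
Qed.

(** With [a] the arctangent, [p.2 ^+ 2 = (r - p.1) * (r + p.1)] gives
    [cos a ^+ 2 = (r + p.1) / (2 * r)]; the duplication formulas then return both coordinates. *)
Lemma polar_angleK (r : R) p : 0 < r -> norm2 p = r ->
  p = (r * cos (polar_angle r p), r * sin (polar_angle r p)).
Proof.
move=> r0 pr; have p2 := norm2_sqr p; rewrite pr in p2.
rewrite /polar_angle; case: ifPn => [/eqP p1|p1].
  have p20 : p.2 = 0.
    by apply/eqP; rewrite -sqrf_eq0; apply/eqP; move: p2; rewrite p1 sqrrN; lra.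
  by rewrite [LHS]surjective_pairing p1 p20 cosN sinN cospi sinpi oppr0 mulr0 mulrN1.
set q := p.2 / (r + p.1).
have rp : r + p.1 != 0 by rewrite addrC addr_eq0.
have a1 := cos_atan q; set a := atan q in a1 *.
have q2 : 1 + q ^+ 2 = 2 * r / (r + p.1).
  rewrite /q expr_div_n; apply: (mulIf (expf_neq0 2 rp)).
  rewrite mulrDl divfK ?expf_neq0// mul1r.
  rewrite (_ : p.2 ^+ 2 = r ^+ 2 - p.1 ^+ 2); last by rewrite -p2; ring.
  by field.
have qpos : 0 < 1 + q ^+ 2 by rewrite ltr_pwDl// sqr_ge0.
have ca : cos a ^+ 2 = (r + p.1) / (2 * r).
  rewrite a1 exprVn sqr_sqrtr ?(ltW qpos)// q2 invf_div//.
have ca0 : cos a != 0 by rewrite a1 invr_eq0 gt_eqF// sqrtr_gt0.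
have sa : sin a = q * cos a.
  by have := atanK q; rewrite -/a /tan => <-; rewrite divfK.
have tw : 2 * a = a *+ 2 by rewrite mulr2n; ring.
have r0' : r != 0 by rewrite gt_eqF.
rewrite tw cos_mulr2n sin_mulr2n sa [LHS]surjective_pairing; congr pair.
  by rewrite ca; field.
rewrite mulrCA -expr2 ca /q; field.
by rewrite r0' rp.
Qed.

Lemma cos_sin_inj (x y : R) : - pi <= x < pi -> - pi <= y < pi ->
  cos x = cos y -> sin x = sin y -> x = y.
Proof.
move=> /andP[x1 x2] /andP[y1 y2] cxy sxy; apply/eqP/negPn/negP => xy.
have cE : cos (x - y) = 1.
  by rewrite cosB cxy sxy -!expr2 cos2Dsin2.
have [_ hE] := half_angle (x - y).
have : sin ((x - y) / 2) != 0.
  apply: sin_half_neq0; first by rewrite subr_eq0.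
  by rewrite ltr_norml; apply/andP; split; lra.
apply/negP; rewrite negbK -sqrf_eq0; apply/eqP; move: hE; rewrite cE subrr; lra.
Qed.

(** The set from which [angle_of] chooses has a single element on the circle, because cosine and
    sine separate points of a half-open period. *)
Lemma angle_of_polar (r : R) p : 0 < r -> norm2 p = r ->
  angle_of p = polar_angle r p.
Proof.
move=> r0 pr; rewrite /angle_of; apply: xget_subset1.
  by split; [exact: polar_angle_itv|rewrite pr; exact: polar_angleK].
move=> x y [x1 x2] [y1 y2].
have n0 : norm2 p != 0 by rewrite pr gt_eqF.
case: (etrans (esym x2) y2) => /(mulfI n0) h1 /(mulfI n0) h2.
exact: cos_sin_inj.
Qed.

Lemma measurable_polar_angle (r : R) : measurable_fun setT (polar_angle r).
Proof.
apply: measurable_fun_ifT => //.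
  exact: measurable_fun_eqr.
apply: measurable_funM => //.
apply: (measurableT_comp (continuous_measurable_fun (@continuous_atan R))).
apply: measurable_funM => //.
by apply: (measurableT_comp (@measurable_inv R)); exact: measurable_funD.
Qed.

Lemma poisson_polar (t a r th : R) :
  poisson t a (r * cos th, r * sin th) = pkernel (t * r) (th - a).
Proof.
have e : (r * cos th) ^+ 2 + (r * sin th) ^+ 2 = r ^+ 2.
  by rewrite !exprMn -mulrDr cos2Dsin2 mulr1.
by rewrite /poisson /pkernel /= e cosB; congr ((1 - _) / (1 + _ - _)); ring.
Qed.

End angles.

(** * Continuity and measurability of the test functions *)

Section test_functions.
Context {R : realType}.

Let continuous_sqsum : continuous (fun p : R * R => p.1 ^+ 2 + p.2 ^+ 2).
Proof.
move=> p; apply: cvgD.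
  apply: (@cvg_comp _ _ _ fst (fun x : R => x ^+ 2)); first exact: cvg_fst.
  exact: sqr_continuous.
apply: (@cvg_comp _ _ _ snd (fun x : R => x ^+ 2)); first exact: cvg_snd.
exact: sqr_continuous.
Qed.

Let continuous_lin (a : R) : continuous (fun p : R * R => p.1 * cos a + p.2 * sin a).
Proof.
move=> p; apply: cvgD; apply: cvgM; try exact: cvg_cst.
  exact: cvg_fst.
exact: cvg_snd.
Qed.

Let measurable_sqsum : measurable_fun setT (fun p : R * R => p.1 ^+ 2 + p.2 ^+ 2).
Proof. by apply: measurable_funD; apply: measurable_funX. Qed.

Let measurable_lin (a : R) :
  measurable_fun setT (fun p : R * R => p.1 * cos a + p.2 * sin a).
Proof. by apply: measurable_funD; apply: measurable_funM. Qed.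

Lemma measurable_poisson_cut (r t a : R) : measurable_fun setT (poisson_cut r t a).
Proof.
apply: measurable_fun_ifT => //.
  by apply: measurable_fun_ler => //; exact: measurable_norm2.
apply: measurable_funM.
  by apply: measurable_funB => //; exact: measurable_funM.
apply: (measurableT_comp (@measurable_inv R)).
apply: measurable_funB; last exact: measurable_funM.
by apply: measurable_funD => //; exact: measurable_funM.
Qed.

Lemma continuous_poisson_cut (r t a : R) p : 0 <= t -> t * r < 1 ->
  norm2 p < r -> {for p, continuous (poisson_cut r t a)}.
Proof.
move=> t0 tr pr.
have pr' : t * norm2 p < 1 by apply: le_lt_trans tr; rewrite ler_wpM2l// ltW.
have cp : {for p, continuous (poisson t a)}.
  apply: cvgM.
    apply: cvgB; first exact: cvg_cst.
    by apply: cvgM; [exact: cvg_cst|exact: continuous_sqsum].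
  apply: cvgV; first by rewrite gt_eqF// poisson_den_gt0.
  apply: cvgB.
    apply: cvgD; first exact: cvg_cst.
    by apply: cvgM; [exact: cvg_cst|exact: continuous_sqsum].
  by apply: cvgM; [exact: cvg_cst|exact: continuous_lin].
have e : poisson_cut r t a p = poisson t a p by rewrite /poisson_cut ltW.
rewrite /prop_for /continuous_at e; apply: cvg_trans cp; apply: near_eq_cvg.
have : \forall q \near p, norm2 q < r.
  exact: (@cvgr_lt _ _ (nbhs p) _ (@norm2 R) (norm2 p) (@norm2_continuous R p) r pr).
by apply: filterS => q qr; rewrite /poisson_cut ltW.
Qed.

(* On the unit circle the denominator is [1 + s ^+ 2 - 2 * s * cos (th - a)],
   which is at least [(1 - s) ^+ 2]; the maximum keeps the function continuous
   and bounded on the whole plane. *)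
Definition circle_kernel (s a : R) (p : R * R) : R :=
  let u := 1 + s ^+ 2 - 2 * s * (p.1 * cos a + p.2 * sin a) in
  (1 - s ^+ 2) / (((u + (1 - s) ^+ 2) + `|u - (1 - s) ^+ 2|) / 2).

Let max_ge (u v : R) : v <= (u + v + `|u - v|) / 2.
Proof. by have := ler_norm (v - u); rewrite distrC; lra. Qed.

Lemma circle_kernelE (s a th : R) : 0 <= s < 1 ->
  circle_kernel s a (cos th, sin th) = pkernel s (th - a).
Proof.
move=> s01; rewrite /circle_kernel /pkernel /= -cosB ger0_norm.
  by congr (_ / _); field.
by rewrite subr_ge0 pkernel_den_ge.
Qed.

Lemma circle_kernel_bounded (s a : R) p : 0 <= s < 1 ->
  `|circle_kernel s a p| <= ((1 - s) ^+ 2)^-1.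
Proof.
move=> /andP[s0 s1]; rewrite /circle_kernel.
set u := 1 + s ^+ 2 - _; set v := (1 - s) ^+ 2.
have v0 : 0 < v by rewrite exprn_gt0// subr_gt0.
have uv := max_ge u v; have m0 := lt_le_trans v0 uv.
have s2 : 0 <= 1 - s ^+ 2 by rewrite subr_ge0 expr_le1// ltW.
rewrite ger0_norm; last by rewrite divr_ge0// ltW.
rewrite ler_pdivrMr// mulrC; apply: (@le_trans _ _ 1); first by rewrite gerBl sqr_ge0.
by rewrite ler_pdivlMr// mul1r.
Qed.

Lemma continuous_circle_kernel (s a : R) : 0 <= s < 1 ->
  continuous (circle_kernel s a).
Proof.
move=> /andP[s0 s1] p.
have v0 : 0 < (1 - s) ^+ 2 by rewrite exprn_gt0// subr_gt0.
have cu : {for p, continuous (fun p : R * R => 1 + s ^+ 2 - 2 * s * (p.1 * cos a + p.2 * sin a))}.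
  apply: cvgB; first exact: cvg_cst.
  by apply: cvgM; [exact: cvg_cst|exact: continuous_lin].
apply: cvgM; first exact: cvg_cst.
apply: cvgV; first by rewrite gt_eqF// (lt_le_trans v0)// max_ge.
apply: cvgM; last exact: cvg_cst.
apply: cvgD; first by apply: cvgD; [exact: cu|exact: cvg_cst].
by apply: cvg_norm; apply: cvgB; [exact: cu|exact: cvg_cst].
Qed.

Lemma measurable_circle_kernel (s a : R) : measurable_fun setT (circle_kernel s a).
Proof.
have mu : measurable_fun setT (fun p : R * R => 1 + s ^+ 2 - 2 * s * (p.1 * cos a + p.2 * sin a)).
  by apply: measurable_funB => //; exact: measurable_funM.
apply: measurable_funM => //; apply: (measurableT_comp (@measurable_inv R)).
apply: measurable_funM => //; apply: measurable_funD; first exact: measurable_funD.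
by apply: measurableT_comp => //; exact: measurable_funB.
Qed.

End test_functions.

(** * Exit positions, exit angles and their Poisson transforms *)

Section disc_exit.
Context {R : realType} {d : measure_display} {T : measurableType d}.
Context (P : probability T R) (B : R -> T -> R * R) (x0 : R * R).
Context (bm : is_BM2 P B x0) (b : R) (x0b : norm2 x0 < b).

Notation rad := (radial B).

Let D := hits B b.
Let mD : measurable D. Proof. exact: (measurable_hits bm). Qed.
Let PD : P D = 1%E. Proof. exact: (probability_hits bm). Qed.

Lemma hits_sub r : norm2 x0 < r -> r <= b -> D `<=` hits B r.
Proof.
move=> x0r rb w [t [t0 tb]].
have n0 : rad w 0 <= r by rewrite (radial0 bm) ltW.
have rt : r <= rad w t by rewrite tb.
have [s /andP[s0 _] sE] := level_attained (continuous_radial bm (w := w)) n0 t0 rt.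
by exists s.
Qed.

(* The position at the hitting time of the circle of radius [r], patched on the
   null event where the circle of radius [b] is never reached. *)
Definition exit_position (r : R) (w : T) : R * R :=
  if w \in D then B (first_hit (rad w) r) w else (r, 0).

Lemma exit_positionE r w : D w ->
  exit_position r w = B (first_hit (rad w) r) w.
Proof. by move=> Dw; rewrite /exit_position mem_set. Qed.

Lemma norm2_exit_position r w : norm2 x0 < r -> r <= b ->
  norm2 (exit_position r w) = r.
Proof.
move=> x0r rb; rewrite /exit_position; case: ifPn => [|_].
  rewrite inE => /(hits_sub x0r rb)[t ht].
  rewrite -radialE; last exact: first_hit_ge0 ht.
  exact: (first_hitP (continuous_radial bm (w := w)) ht).
rewrite /norm2 /= expr0n /= addr0 sqrtr_sqr ger0_norm//.
by rewrite ltW// (le_lt_trans (norm2_ge0 x0)).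
Qed.

Lemma cvg_exit_time_first_hit r w : norm2 x0 < r -> r <= b -> D w ->
  (fun n => exit_time (rad w) (level r n)) @ \oo --> first_hit (rad w) r.
Proof.
move=> x0r rb Dw; have [t ht] := hits_sub x0r rb Dw.
apply: (cvg_exit_time_level (continuous_radial bm (w := w)) _ ht).
by rewrite (radial0 bm).
Qed.

(** A double limit of grid positions, over the mesh and then over the levels; it is taken
    coordinatewise, as the limit lemma is for real functions. *)
Lemma measurable_exit_position r : norm2 x0 < r -> r <= b ->
  measurable_fun setT (exit_position r).
Proof.
move=> x0r rb.
have key (p : R * R -> R) : continuous p -> measurable_fun setT p ->
    measurable_fun setT (fun w => p (exit_position r w)).
  move=> cp mp.
  pose G n w := if w \in D then p (B (exit_time (rad w) (level r n)) w) else p (r, 0).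
  have cB w (s : nat -> R) (t : R) : 0 <= t -> (forall n, 0 <= s n) ->
      s @ \oo --> t -> (fun n => p (B (s n) w)) @ \oo --> p (B t w).
    move=> t0 s0 st; apply: (continuous_cvg _ (cp _)).
    have -> : (fun n => B (s n) w) = (fun n => B `|s n| w).
      by apply/funext => n; rewrite ger0_norm.
    have h : (fun n => B `|s n| w) @ \oo --> B `|t| w.
      exact: (continuous_cvg _ (@continuous_path _ _ _ P B x0 bm w t) st).
    by rewrite ger0_norm in h.
  have ex w n : D w -> exit_set (rad w) (level r n) (first_hit (rad w) r).
    move=> Dw; have [t ht] := hits_sub x0r rb Dw.
    exact: (exit_set_level (continuous_radial bm (w := w)) n ht).
  have mG n : measurable_fun setT (G n).
    apply: (@measurable_limit_on _ _ _ D mD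
      (fun k w => p (grid_position B (level r n) k w)) _ (p (r, 0))).
    - move=> k; exact: (measurableT_comp mp (measurable_grid_position bm _ _)).
    - move=> w Dw; rewrite /G mem_set//; apply: cB.
      + exact: exit_time_ge0 (ex w n Dw).
      + by move=> k; rewrite mulr_ge0// ltW// step_gt0.
      + exact: (cvg_grid_exit (continuous_radial bm (w := w)) (ex w n Dw)).
    - by move=> w nD; rewrite /G memNset.
  apply: (@measurable_limit_on _ _ _ D mD G _ (p (r, 0))) => //.
    move=> w Dw; rewrite /G mem_set// exit_positionE//; apply: cB.
    - by have [t ht] := hits_sub x0r rb Dw; exact: first_hit_ge0 ht.
    - by move=> n; exact: exit_time_ge0 (ex w n Dw).
    - exact: cvg_exit_time_first_hit.
  by move=> w nD; rewrite /exit_position memNset.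
apply/measurable_fun_pairP; split; apply: key => //.
  by move=> p; exact: cvg_fst.
by move=> p; exact: cvg_snd.
Qed.

Definition exit_angle (r : R) (w : T) : R := polar_angle r (exit_position r w).

Lemma measurable_exit_angle r : norm2 x0 < r -> r <= b ->
  measurable_fun setT (exit_angle r).
Proof.
move=> x0r rb.
exact: (measurableT_comp (measurable_polar_angle r) (measurable_exit_position x0r rb)).
Qed.

Lemma exit_angle_itv r w : - pi <= exit_angle r w < pi.
Proof. exact: polar_angle_itv. Qed.

Lemma exit_position_polar r w : norm2 x0 < r -> r <= b ->
  exit_position r w = (r * cos (exit_angle r w), r * sin (exit_angle r w)).
Proof.
move=> x0r rb; apply: polar_angleK; last exact: norm2_exit_position.
by rewrite (le_lt_trans (norm2_ge0 x0)).
Qed.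

Lemma Rintegral_on_hits (h : T -> R) (M : R) : measurable_fun setT h ->
  (forall w, `|h w| <= M) -> \int[P]_w (\1_D w * h w) = \int[P]_w h w.
Proof.
move=> mh hM.
have := @Rintegral_limit_on _ _ _ P D mD (fun=> h) (fun w => \1_D w * h w) M 0 PD
  (fun=> mh) (fun n w => hM w).
have c1 w : D w -> (fun n : nat => h w) @ \oo --> \1_D w * h w.
  by move=> Dw; rewrite indicE mem_set// mul1r; exact: cvg_cst.
have c2 w : ~ D w -> \1_D w * h w = 0 by move=> nD; rewrite indicE memNset// mul0r.
by move=> /(_ c1 c2) u; rewrite -(cvg_lim _ u)// lim_cst.
Qed.

(** Room for a cut radius between the circle and the pole at distance [1 / t]; the shift is chosen
    so that [t = 0] needs no separate treatment. *)
Lemma margin (t r : R) : 0 <= t -> t * r < 1 -> exists2 q, r < q & t * q < 1.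
Proof.
move=> t0 tr; have e0 : 0 < 1 - t * r by lra.
have t1 : 0 < t + 1 by lra.
exists (r + (1 - t * r) / (t + 1)); first by rewrite ltrDl divr_gt0.
have -> : t * (r + (1 - t * r) / (t + 1)) = 1 - (1 - t * r) / (t + 1).
  by field; rewrite gt_eqF.
by rewrite gtrBl divr_gt0.
Qed.

Lemma poisson_cut_exit (q t a r : R) w : norm2 x0 < r -> r <= b -> r < q ->
  poisson_cut q t a (exit_position r w) = pkernel (t * r) (exit_angle r w - a).
Proof.
move=> x0r rb rq; rewrite /poisson_cut norm2_exit_position// (ltW rq).
by rewrite {1}exit_position_polar// poisson_polar.
Qed.

Let pkernel_norm_le (s x : R) : 0 <= s < 1 -> `|pkernel s x| <= ((1 - s) ^+ 2)^-1.
Proof. by move=> s01; rewrite ger0_norm ?pkernel_ge0// pkernel_le. Qed.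

Lemma measurable_pkernel_exit (r s a : R) : norm2 x0 < r -> r <= b -> 0 <= s < 1 ->
  measurable_fun setT (fun w => pkernel s (exit_angle r w - a)).
Proof.
move=> x0r rb s01; apply: (measurableT_comp (measurable_pkernel s01)).
by apply: measurable_funB => //; exact: measurable_exit_angle.
Qed.

Lemma eq_integral_of_sub (u v : T -> R) (M : R) :
  measurable_fun setT u -> measurable_fun setT v ->
  (forall w, `|u w| <= M) -> (forall w, `|v w| <= M) ->
  \int[P]_w (\1_D w * (u w - v w)) = 0 ->
  (\int[P]_w (u w)%:E = \int[P]_w (v w)%:E)%E.
Proof.
move=> mu' mv uM vM.
have iu := bounded_integrable P mu' uM; have iv := bounded_integrable P mv vM.
rewrite (@Rintegral_on_hits _ (M + M)); first last.
- by move=> w; rewrite (le_trans (ler_normB _ _))// lerD.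
- exact: measurable_funB.
rewrite RintegralB// => /subr0_eq; rewrite /Rintegral => e.
rewrite -[LHS]fineK ?integrable_fin_num// -[RHS]fineK ?integrable_fin_num//.
by rewrite e.
Qed.

(* Harmonic measure: the Poisson kernel integrates the bounded harmonic
   functions of the disc of radius [r]. *)
Lemma exit_angle_transform (r s a mu1 rho1 : R) : norm2 x0 < r -> r <= b ->
  0 <= rho1 -> x0 = (rho1 * cos mu1, rho1 * sin mu1) -> 0 <= s < 1 ->
  (\int[P]_w (pkernel s (exit_angle r w - a))%:E =
   \int[P]_w (pkernel (s * (rho1 / r)) (mu1 - a))%:E)%E.
Proof.
move=> x0r rb rho10 x0E s01; have [s0 s1] := andP s01.
have r0 : 0 < r by rewrite (le_lt_trans (norm2_ge0 x0)).
have rho1E : norm2 x0 = rho1 by rewrite x0E norm2_polar.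
have q01 : 0 <= s * (rho1 / r) < 1.
  have h2 : 0 <= rho1 / r by rewrite divr_ge0// ltW.
  have h3 : rho1 / r <= 1 by rewrite ler_pdivrMr// mul1r -rho1E ltW.
  by rewrite mulr_ge0//= (le_lt_trans _ s1)// ler_piMr.
(* On the circle of radius [r] the Poisson function is then the kernel of radius [s], and at the
   starting point that of radius [s * (rho1 / r)]. *)
pose t := s / r.
have t0 : 0 <= t by rewrite divr_ge0// ltW.
have tr : t * r < 1 by rewrite /t divfK ?gt_eqF.
have [q rq tq] := margin t0 tr.
have [C C0 hC] := poisson_cut_four_point a t0 rq tq.
have fM p := poisson_cut_bounded a p t0 tq.
have cf p : norm2 p < q -> {for p, continuous (poisson_cut q t a)}.
  exact: continuous_poisson_cut.
(* A negative level is exceeded at once, so the general lemma also covers stopping at the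
   deterministic time zero. *)
have exit0 w : exit_time (rad w) (-1) = 0.
  have h : exit_set (rad w) (-1) 0.
    by split => //; rewrite (radial0 bm); apply: lt_le_trans (norm2_ge0 x0); exact: ltrN10.
  by apply/eqP; rewrite eq_le (exit_time_le h) (exit_time_ge0 h).
have cc n : -1 <= level r n.
  rewrite /level lerBrDl; apply: (@le_trans _ _ (-1 + 1)); last by rewrite addrC subrr ltW.
  by rewrite addrC lerD2l invf_le1// ler1n.
have gM (p : R * R) : `|1 : R| <= 1 by rewrite normr1.
have cg p : norm2 p < q -> {for p, continuous (fun=> 1 : R)} by move=> _; exact: cvg_cst.
have H := @optional_stopping _ _ _ P B x0 bm r x0r (poisson_cut q t a) (fun=> 1)
  _ _ C q (fun=> -1) (level r) (fun=> 0) (fun w => first_hit (rad w) r) D mD PD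
  (hits_sub x0r rb) (measurable_poisson_cut q t a) fM (measurable_cst _) gM C0 rq
  cf cg hC cc (level_lt r).
apply: (@eq_integral_of_sub _ _ (((1 - s) ^+ 2)^-1 + ((1 - s * (rho1 / r)) ^+ 2)^-1)).
- exact: measurable_pkernel_exit.
- exact: measurable_cst.
- by move=> w; rewrite (le_trans (pkernel_norm_le _ s01))// lerDl invr_ge0 sqr_ge0.
- by move=> w; rewrite (le_trans (pkernel_norm_le _ q01))// lerDr invr_ge0 sqr_ge0.
rewrite -[RHS]H; first last.
- by move=> w Dw; exact: cvg_exit_time_first_hit.
- by move=> w Dw; rewrite exit0; exact: cvg_cst.
apply: eq_Rintegral => w _; rewrite indicE; case: (boolP (w \in D)) => Dw; last first.
  by rewrite !mul0r.
rewrite !mul1r -exit_positionE; last by rewrite inE in Dw.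
have [B0 _ _ _] := bm.
rewrite poisson_cut_exit// B0 /poisson_cut (le_trans (ltW x0r) (ltW rq)).
rewrite x0E poisson_polar /t divfK ?gt_eqF//; congr (_ - pkernel _ _).
by rewrite mulrAC mulrA.
Qed.

(** The substitute for the strong Markov property on the unit circle: optional stopping between the
    two circles, with a kernel of the first exit angle as weight. The Poisson function with
    [t = s / b] is the kernel of radius [s] on the outer circle and of radius [s / b] on the unit
    circle. *)
Lemma exit_angles_transform (s a s' a' : R) : norm2 x0 < 1 -> 1 < b ->
  0 <= s < 1 -> 0 <= s' < 1 ->
  (\int[P]_w (pkernel s' (exit_angle 1 w - a') * pkernel s (exit_angle b w - a))%:E =
   \int[P]_w (pkernel s' (exit_angle 1 w - a') * pkernel (s / b) (exit_angle 1 w - a))%:E)%E.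
Proof.
move=> x01 b1 s01 s01'; have [s0 s1] := andP s01.
have b0 : 0 < b by exact: lt_trans b1.
pose t := s / b.
have t0 : 0 <= t by rewrite divr_ge0// ltW.
have tr : t * b < 1 by rewrite /t divfK ?gt_eqF.
have t01 : 0 <= t < 1 by rewrite t0 (le_lt_trans _ tr)// ler_peMr// ltW.
have [q rq tq] := margin t0 tr.
have [C C0 hC] := poisson_cut_four_point a t0 rq tq.
have fM p := poisson_cut_bounded a p t0 tq.
have gM p := circle_kernel_bounded a' p s01'.
have cf p : norm2 p < q -> {for p, continuous (poisson_cut q t a)}.
  exact: continuous_poisson_cut.
have cg p : norm2 p < q -> {for p, continuous (circle_kernel s' a')}.
  by move=> _; exact: continuous_circle_kernel.
have cc n : level 1 n <= level b n by rewrite lerD2r ltW.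
have H := @optional_stopping _ _ _ P B x0 bm b x0b (poisson_cut q t a)
  (circle_kernel s' a') _ _ C q (level 1) (level b)
  (fun w => first_hit (rad w) 1) (fun w => first_hit (rad w) b) D mD PD
  (@subset_refl _ D) (measurable_poisson_cut q t a) fM (measurable_circle_kernel s' a')
  gM C0 rq cf cg hC cc (level_lt b).
have b1' := ltW b1.
pose M1 := ((1 - s') ^+ 2)^-1; pose M2 := ((1 - s) ^+ 2)^-1; pose M3 := ((1 - t) ^+ 2)^-1.
have m1 := measurable_pkernel_exit a' x01 b1' s01'.
have M2_0 : 0 <= M2 by rewrite invr_ge0 sqr_ge0.
have M3_0 : 0 <= M3 by rewrite invr_ge0 sqr_ge0.
apply: (@eq_integral_of_sub _ _ (M1 * (M2 + M3))).
- by apply: measurable_funM => //; exact: measurable_pkernel_exit.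
- by apply: measurable_funM => //; exact: measurable_pkernel_exit.
- move=> w; rewrite normrM ler_pM ?pkernel_norm_le//.
  by rewrite (le_trans (pkernel_norm_le _ s01))// lerDl.
- move=> w; rewrite normrM ler_pM ?pkernel_norm_le//.
  by rewrite (le_trans (pkernel_norm_le _ t01))// lerDr.
rewrite -[RHS]H; first last.
- by move=> w Dw; exact: cvg_exit_time_first_hit.
- by move=> w Dw; exact: cvg_exit_time_first_hit.
apply: eq_Rintegral => w _; rewrite indicE; case: (boolP (w \in D)) => Dw; last first.
  by rewrite !mul0r.
rewrite !mul1r -!exit_positionE; [|by rewrite inE in Dw..].
rewrite !poisson_cut_exit// ?(lt_trans b1)// mulr1 [t * b]divfK ?gt_eqF//.
rewrite -mulrBr; congr (_ * _).
by rewrite exit_position_polar// !mul1r circle_kernelE.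
Qed.

End disc_exit.

(** * The conditional density as a quotient of Poisson densities *)

Section conditional_density_formula.
Context {R : realType}.
Implicit Types r x : R.

Lemma pkernel_gt0 r x : 0 <= r < 1 -> 0 < pkernel r x.
Proof.
move=> r01; rewrite divr_gt0 ?pkernel_den_gt0//.
by case/andP: r01 => r0 r1; rewrite subr_gt0 expr_lt1.
Qed.

(* Density at [x] of the law with Poisson transform
   [s, a |-> pkernel (s * r) (c - a)]. *)
Definition poisson_density (r c x : R) := pkernel r (c - x) / (2 * pi).

Lemma poisson_density_gt0 r c x : 0 <= r < 1 -> 0 < poisson_density r c x.
Proof. by move=> r01; rewrite divr_gt0 ?pkernel_gt0// mulr_gt0// pi_gt0. Qed.

Lemma poisson_density_ge0 r c x : 0 <= r < 1 -> 0 <= poisson_density r c x.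
Proof. by move=> r01; rewrite ltW// poisson_density_gt0. Qed.

(* Bayes' rule: the joint density of the two exit angles divided by the
   marginal density of the second one. *)
Lemma cond_densE (rho1 mu1 rho2 phi th : R) :
  0 <= rho1 < 1 -> 0 <= rho2 < 1 ->
  cond_dens rho1 mu1 rho2 phi th =
  poisson_density rho2 th phi * poisson_density rho1 mu1 th
  / poisson_density (rho1 * rho2) mu1 phi.
Proof.
move=> r1 r2; have r12 : 0 <= rho1 * rho2 < 1.
  by have [? ?] := andP r1; have [? ?] := andP r2; rewrite mulr_ge0// mulr_ilt1.
have sq r : 0 <= r < 1 -> 1 - r ^+ 2 != 0.
  by case/andP=> r0 r1'; rewrite gt_eqF// subr_gt0 expr_lt1.
have := sq _ r12; rewrite exprMn => n12.
have pi0 : pi != 0 :> R by rewrite gt_eqF// pi_gt0.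
have d12 := pkernel_den_gt0 (mu1 - phi) r12.
have d1 := pkernel_den_gt0 (th - mu1) r1.
have d2 := pkernel_den_gt0 (th - phi) r2.
rewrite /cond_dens /poisson_density /pkernel -(cosN (mu1 - th)) opprB.
rewrite mulrA exprMn in d12 *; move: d12 d1 d2.
set a := cos _; set b := cos _; set c := cos _ => d12 d1 d2.
move: (@pi R) pi0 => p p0; field; rewrite p0 exprMn n12 /=.
by apply/and3P; split; rewrite gt_eqF.
Qed.

Lemma cond_dens_ge0 (rho1 mu1 rho2 phi th : R) :
  0 <= rho1 < 1 -> 0 <= rho2 < 1 -> 0 <= cond_dens rho1 mu1 rho2 phi th.
Proof.
move=> r1 r2; rewrite cond_densE//; apply: divr_ge0.
  by apply: mulr_ge0; exact: poisson_density_ge0.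
apply: poisson_density_ge0.
by have [? ?] := andP r1; have [? ?] := andP r2; rewrite mulr_ge0// mulr_ilt1.
Qed.

End conditional_density_formula.

(** * The joint law of the two exit angles *)

Section joint_law.
Context {R : realType} {d : measure_display} {T : measurableType d}.
Context (P : probability T R).
Notation mu := (@lebesgue_measure R).
Local Notation MR := (measurableTypeR R).

Let measurable_poisson_density d' (T' : measurableType d') (r : R) (f g : T' -> R) :
  0 <= r < 1 -> measurable_fun setT f -> measurable_fun setT g ->
  measurable_fun setT (fun x => poisson_density r (f x) (g x)).
Proof.
move=> r01 mf mg; apply: measurable_funM => //.
by apply: (measurableT_comp (measurable_pkernel r01)); exact: measurable_funB.
Qed.

Let measurable_cond_dens d' (T' : measurableType d') (rho1 mu1 rho2 : R)
    (f g : T' -> R) : 0 <= rho1 < 1 -> 0 <= rho2 < 1 ->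
  measurable_fun setT f -> measurable_fun setT g ->
  measurable_fun setT (fun x => cond_dens rho1 mu1 rho2 (f x) (g x)).
Proof.
move=> r1 r2 mf mg; under eq_fun do rewrite cond_densE//.
have r12 : 0 <= rho1 * rho2 < 1.
  by have [? ?] := andP r1; have [? ?] := andP r2; rewrite mulr_ge0// mulr_ilt1.
apply: measurable_funM; first by apply: measurable_funM; exact: measurable_poisson_density.
by apply: (measurableT_comp (@measurable_inv R)); exact: measurable_poisson_density.
Qed.

Lemma measurable_cond_prob (rho1 mu1 rho2 : R) (A : set R) :
  0 <= rho1 < 1 -> 0 <= rho2 < 1 -> measurable A ->
  measurable_fun setT (fun phi : R =>
    \int[mu]_(th in A) (cond_dens rho1 mu1 rho2 phi th)%:E)%E.
Proof.
move=> r1 r2 mA.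
pose F (z : MR * MR) : \bar R := ((cond_dens rho1 mu1 rho2 z.1 z.2) * \1_A z.2)%:E.
have mF : measurable_fun setT F.
  apply/measurable_EFinP; apply: measurable_funM; last first.
    by apply: (measurableT_comp (measurable_indic _)).
  by apply: measurable_cond_dens.
have F0 z : (0 <= F z)%E by rewrite lee_fin mulr_ge0 ?indicE// cond_dens_ge0.
have := @measurable_fun_fubini_tonelli_F _ _ _ _ _ mu F mF F0.
congr (measurable_fun _ _); apply/funext => phi.
rewrite [RHS]integral_mkcond; apply: eq_integral => th _.
by rewrite patchE /F indicE /=; case: (_ \in _); rewrite ?mulr1 ?mulr0.
Qed.

Section marginal.
Context (X : T -> R) (mX : measurable_fun setT X) (X_itv : forall w, - pi <= X w < pi).
Context (r c : R) (r01 : 0 <= r < 1) (c_itv : - pi <= c < pi).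
Context (transformE : forall s a : R, 0 <= s < 1 ->
  (\int[P]_w (pkernel s (X w - a))%:E = \int[P]_w (pkernel (s * r) (c - a))%:E)%E).

Let X_law (S : set R) : measurable S -> S `<=` `[- pi, pi[ ->
  P (X @^-1` S) = (\int[mu]_(x in S) (poisson_density r c x)%:E)%E.
Proof.
move=> mS Spi.
have m1 : measurable_fun setT (fun _ : T => 1 : R) by exact: measurable_cst.
have := @transform_law _ _ _ P (fun=> 1) X (fun=> c) 1 r m1 (fun=> ler01)
  (fun=> lexx 1) mX X_itv (measurable_cst _) (fun=> c_itv) r01 _ S mS Spi.
rewrite integral_cst ?mul1e//; last by rewrite -[_ @^-1` _]setTI; exact: mX.
move=> ->.
  apply: eq_integral => x _; rewrite integral_cst//= mul1r.
  by rewrite [P setT]probability_setT mule1.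
move=> s a s01; have := transformE a s01.
move=> e; transitivity (\int[P]_w (pkernel s (X w - a))%:E)%E; last rewrite e;
  by apply: eq_integral => w _; rewrite mul1r.
Qed.

(** By the transform, [X] has a Poisson density on [[- pi, pi[]. Cutting this density to zero
    outside gives a density of its law on the whole line, to which [integral_density] applies. *)
Lemma expectation_of_transform (f : R -> \bar R) (S : set R) :
  measurable_fun setT f -> (forall x, 0 <= f x)%E ->
  measurable S -> S `<=` `[- pi, pi[ ->
  (\int[P]_(w in X @^-1` S) f (X w) =
   \int[mu]_(x in S) (f x * (poisson_density r c x)%:E))%E.
Proof.
move=> mf f0 mS Spi.
pose I : set MR := `[- pi, pi[%classic.
have mI : measurable I by exact: measurable_itv.
pose p (x : MR) : R := poisson_density r c x * \1_I x.
have mp : measurable_fun setT p.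
  apply: measurable_funM; first exact: measurable_poisson_density.
  exact: (measurable_indic mI).
have p0 x : 0 <= p x by rewrite mulr_ge0 ?indicE ?ler0n// poisson_density_ge0.
have mX' : measurable_fun setT (X : T -> MR) by [].
have nuE (A : set MR) : measurable A -> law P mX' A = (\int[mu]_(x in A) (p x)%:E)%E.
  move=> mA; rewrite lawE.
  have -> : X @^-1` A = X @^-1` (A `&` I).
    apply/seteqP; split => w /=; last by case.
    by move=> Aw; split => //; rewrite /I /= in_itv/=; exact: X_itv.
  rewrite X_law; [|exact: measurableI|by move=> x []].
  rewrite integral_mkcondr; apply: eq_integral => x _.
  by rewrite patchE /p indicE; case: (x \in I); rewrite ?mulr1 ?mulr0.
have mfS : measurable_fun setT (f \_ S : MR -> \bar R).
  by apply/(measurable_restrictT _ _).1 => //; exact: measurable_funTS.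
have fS0 x : (0 <= (f \_ S) x)%E by rewrite patchE; case: ifP.
transitivity (\int[law P mX']_x (f \_ S) x)%E.
  rewrite ge0_integral_law// [LHS]integral_mkcond; apply: eq_integral => w _.
  rewrite !patchE; have -> : (w \in X @^-1` S) = (X w \in S) by apply/idP/idP; rewrite !inE.
  by [].
rewrite (integral_density mp p0 nuE mfS fS0) [RHS]integral_mkcond.
apply: eq_integral => x _; rewrite !patchE; case: ifPn => xS; last by rewrite mul0e.
congr (_ * _%:E)%E; rewrite /p indicE mem_set ?mulr1//.
by apply: Spi; rewrite inE in xS.
Qed.

End marginal.

(** The test kernel in [Theta] is first exchanged for the indicator of [A]; the law of [Phi] under
    that weight then has a density that averages a Poisson density centred at [Theta]. Inserting the
    density of [Theta] gives the joint density, and Bayes' rule concludes. *)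
Lemma conditional_density (Theta Phi : T -> R) (rho1 mu1 rho2 : R) :
  0 <= rho1 < 1 -> 0 <= rho2 < 1 -> - pi <= mu1 < pi ->
  measurable_fun setT Theta -> (forall w, - pi <= Theta w < pi) ->
  measurable_fun setT Phi -> (forall w, - pi <= Phi w < pi) ->
  (forall s a : R, 0 <= s < 1 ->
    (\int[P]_w (pkernel s (Theta w - a))%:E =
     \int[P]_w (pkernel (s * rho1) (mu1 - a))%:E)%E) ->
  (forall s a : R, 0 <= s < 1 ->
    (\int[P]_w (pkernel s (Phi w - a))%:E =
     \int[P]_w (pkernel (s * (rho1 * rho2)) (mu1 - a))%:E)%E) ->
  (forall s a s' a' : R, 0 <= s < 1 -> 0 <= s' < 1 ->
    (\int[P]_w (pkernel s' (Theta w - a') * pkernel s (Phi w - a))%:E =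
     \int[P]_w (pkernel s' (Theta w - a') * pkernel (s * rho2) (Theta w - a))%:E)%E) ->
  forall A S : set R, measurable A -> A `<=` `[- pi, pi[ ->
    measurable S -> S `<=` `[- pi, pi[ ->
  P (Theta @^-1` A `&` Phi @^-1` S) =
  (\int[P]_(w in Phi @^-1` S) \int[mu]_(th in A)
     (cond_dens rho1 mu1 rho2 (Phi w) th)%:E)%E.
Proof.
move=> r1 r2 mu1_itv mTheta Theta_itv mPhi Phi_itv K1 K2 K3 A S mA Api mS Spi.
have r12 : 0 <= rho1 * rho2 < 1.
  by have [? ?] := andP r1; have [? ?] := andP r2; rewrite mulr_ge0// mulr_ilt1.
have mTA : measurable (Theta @^-1` A) by rewrite -[_ @^-1` _]setTI; exact: mTheta.
have mPS : measurable (Phi @^-1` S) by rewrite -[_ @^-1` _]setTI; exact: mPhi.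
pose G w : R := \1_(Theta @^-1` A) w.
have mG : measurable_fun setT G by exact: measurable_indic.
have G0 w : 0 <= G w by rewrite /G indicE ler0n.
have G1 w : G w <= 1 by rewrite /G indicE; case: (_ \in _).
have integralG (h : T -> R) : (\int[P]_w (G w * h w)%:E =
    \int[P]_(w in Theta @^-1` A) (h w)%:E)%E.
  rewrite [RHS]integral_mkcond; apply: eq_integral => w _.
  by rewrite patchE /G indicE; case: (_ \in _); rewrite ?mul1r ?mul0r.
(* The kernels of [Theta] occurring in the third hypothesis determine measures on the circle, so
   they may be replaced by the indicator of the event [Theta] in [A]. *)
have KG s a : 0 <= s < 1 -> (\int[P]_w (G w * pkernel s (Phi w - a))%:E =
    \int[P]_w (G w * pkernel (s * rho2) (Theta w - a))%:E)%E.
  move=> s01; have q01 : 0 <= s * rho2 < 1.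
    by have [? ?] := andP s01; have [? ?] := andP r2; rewrite mulr_ge0// mulr_ilt1.
  rewrite !integralG.
  apply: (@transform_unique _ _ _ P (fun w => pkernel s (Phi w - a))
    (fun w => pkernel (s * rho2) (Theta w - a)) Theta
    (Num.max ((1 - s) ^+ 2)^-1 ((1 - s * rho2) ^+ 2)^-1)) => //.
  - by apply: (measurableT_comp (measurable_pkernel s01)); exact: measurable_funB.
  - by apply: (measurableT_comp (measurable_pkernel q01)); exact: measurable_funB.
  - by move=> w; exact: pkernel_ge0.
  - by move=> w; exact: pkernel_ge0.
  - by move=> w; rewrite le_max pkernel_le.
  - by move=> w; rewrite le_max pkernel_le// orbT.
  move=> s' a' s01'; under eq_integral do rewrite mulrC.
  by rewrite K3//; apply: eq_integral => w _; rewrite mulrC.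
have -> : P (Theta @^-1` A `&` Phi @^-1` S) = (\int[P]_(w in Phi @^-1` S) (G w)%:E)%E.
  by rewrite integral_indic.
rewrite (@transform_law _ _ _ P G Phi Theta 1 rho2 mG G0 G1 mPhi Phi_itv mTheta
  Theta_itv r2 KG S mS Spi).
pose f phi := (\int[mu]_(th in A) (cond_dens rho1 mu1 rho2 phi th)%:E)%E.
have mf : measurable_fun setT f by exact: measurable_cond_prob.
have f0 phi : (0 <= f phi)%E.
  by apply: integral_ge0 => th _; rewrite lee_fin cond_dens_ge0.
(* The expectation over [Phi] brings in its marginal density, which cancels the denominator in
   [cond_densE]. *)
rewrite [RHS](expectation_of_transform mPhi Phi_itv r12 mu1_itv K2 mf f0 mS Spi).
apply: eq_integral => phi _; rewrite integralG.
rewrite (expectation_of_transform mTheta Theta_itv r1 mu1_itv K1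
  (f := fun th => (poisson_density rho2 th phi)%:E) _ _ mA Api); first last.
- by move=> th; rewrite lee_fin poisson_density_ge0.
- by apply/measurable_EFinP; exact: measurable_poisson_density.
rewrite /f -ge0_integralZr//; first last.
- by rewrite lee_fin poisson_density_ge0.
- by move=> th _; rewrite lee_fin cond_dens_ge0.
- apply: measurable_funTS; apply/measurable_EFinP.
  exact: measurable_cond_dens.
apply: eq_integral => th _; rewrite -!EFinM; congr (_%:E).
by rewrite cond_densE// divfK// gt_eqF// poisson_density_gt0.
Qed.

End joint_law.

(** * Agreement with the hitting times and angles of the statement *)

Section hitting_times.
Context {R : realType} {d : measure_display} {T : measurableType d}.
Context (B : R -> T -> R * R) (r : R) (w : T).

Let hitting_setE : [set t : R | 0 <= t /\ norm2 (B t w) = r] =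
  hitting_set (radial B w) r.
Proof.
by apply/seteqP; split => t /= [t0 tr]; split => //; move: tr; rewrite radialE.
Qed.

Lemma hit_timeE : hits B r w -> hit_time B r w = (first_hit (radial B w) r)%:E.
Proof.
by move=> [t ht]; rewrite /hit_time hitting_setE ereal_inf_EFin//; [exists 0 => s []|exists t].
Qed.

Lemma hit_time_lty : (hit_time B r w < +oo)%E <-> hits B r w.
Proof.
split=> [|/hit_timeE ->]; last exact: ltry.
rewrite /hit_time hitting_setE => /ereal_inf_lt[_ [t ht _] _].
by exists t.
Qed.

End hitting_times.

Lemma angle_of_hit_pos (R : realType) (d : measure_display) (T : measurableType d)
    (P : probability T R) (B : R -> T -> R * R) (x0 : R * R) (b r : R) (w : T) :
  is_BM2 P B x0 -> norm2 x0 < b -> norm2 x0 < r -> r <= b -> hits B b w ->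
  angle_of (hit_pos B r w) = exit_angle B b r w.
Proof.
move=> bm x0b x0r rb hw.
rewrite /hit_pos hit_timeE/=; last exact: (hits_sub bm x0r rb).
rewrite -(exit_positionE _ hw) (@angle_of_polar _ r)//.
  exact: le_lt_trans (norm2_ge0 x0) x0r.
exact: (norm2_exit_position bm w x0r rb).
Qed.

Unset Implicit Arguments.

(* Theta := angle of B_{tau_1}, Phi := angle of B_{tau_2}; conditioning on
   B_{tau_2} is conditioning on Phi.  The conclusion says that
   theta |-> cond_dens rho1 mu1 rho2 Phi theta is a (regular) conditional
   density of Theta given Phi: for all Borel A, S in [-pi, pi),
   P(Theta in A, Phi in S) = E[ 1_{Phi in S} * int_A f(theta; Phi) dtheta ]. *)
Theorem theorem1 (R : realType) (d : measure_display) (T : measurableType d)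
    (P : probability T R) (B : R -> T -> R * R) (rho1 mu1 rho2 : R) :
  0 <= rho1 < 1 -> -pi <= mu1 < pi -> 0 < rho2 < 1 ->
  is_BM2 P B (rho1 * cos mu1, rho1 * sin mu1) ->
  forall (A S : set R),
    measurable A -> A `<=` `[-pi, pi[ ->
    measurable S -> S `<=` `[-pi, pi[ ->
    P [set w | (hit_time B 1 w < +oo)%E /\ (hit_time B rho2^-1 w < +oo)%E
               /\ A (angle_of (hit_pos B 1 w))
               /\ S (angle_of (hit_pos B rho2^-1 w))]
    = (\int[P]_(w in [set w | (hit_time B rho2^-1 w < +oo)%E
                              /\ S (angle_of (hit_pos B rho2^-1 w))])
         (\int[lebesgue_measure]_(th in A)
            (cond_dens rho1 mu1 rho2 (angle_of (hit_pos B rho2^-1 w)) th)%:E))%E.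
Proof.
move=> r1 mu1_itv r2 bm A S mA Api mS Spi.
have [r10 r11] := andP r1; have [r20 r21] := andP r2.
have r2' : 0 <= rho2 < 1 by rewrite ltW.
have x0E := norm2_polar mu1 r10; set x0 := (_, _) in bm x0E.
pose b := rho2^-1; rewrite -/b.
have b1 : 1 < b by rewrite /b invf_gt1.
have x01 : norm2 x0 < 1 by rewrite x0E.
have x0b : norm2 x0 < b by exact: lt_trans b1.
(* These versions are measurable on all of [T]; they agree with the angles of the statement on the
   full event where radius [b] is reached. *)
pose Theta := exit_angle B b 1; pose Phi := exit_angle B b b.
have mTheta : measurable_fun setT Theta.
  exact: (measurable_exit_angle bm x0b x01 (ltW b1)).
have mPhi : measurable_fun setT Phi.
  exact: (measurable_exit_angle bm x0b x0b (lexx b)).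
have K1 s a : 0 <= s < 1 -> (\int[P]_w (pkernel s (Theta w - a))%:E =
    \int[P]_w (pkernel (s * rho1) (mu1 - a))%:E)%E.
  move=> s01; have := exit_angle_transform bm x0b a x01 (ltW b1) r10 erefl s01.
  by rewrite divr1.
have K2 s a : 0 <= s < 1 -> (\int[P]_w (pkernel s (Phi w - a))%:E =
    \int[P]_w (pkernel (s * (rho1 * rho2)) (mu1 - a))%:E)%E.
  move=> s01; have := exit_angle_transform bm x0b a x0b (lexx b) r10 erefl s01.
  by rewrite /b invrK.
have K3 s a s' a' : 0 <= s < 1 -> 0 <= s' < 1 ->
    (\int[P]_w (pkernel s' (Theta w - a') * pkernel s (Phi w - a))%:E =
     \int[P]_w (pkernel s' (Theta w - a') * pkernel (s * rho2) (Theta w - a))%:E)%E.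
  move=> s01 s01'; have := exit_angles_transform bm x0b a a' x01 b1 s01 s01'.
  by rewrite /b invrK.
have main := conditional_density r1 r2' mu1_itv mTheta (exit_angle_itv B b 1) mPhi
  (exit_angle_itv B b b) K1 K2 K3 mA Api mS Spi.
pose D := hits B b.
have mD : measurable D by exact: (measurable_hits bm x0b).
have D1 : P D = 1%E by exact: (probability_hits bm x0b).
have DC0 : P (~` D) = 0%E by rewrite probability_setC// D1 subee.
have angle1 w : D w -> angle_of (hit_pos B 1 w) = Theta w.
  exact: (angle_of_hit_pos bm x0b x01 (ltW b1)).
have angleb w : D w -> angle_of (hit_pos B b w) = Phi w.
  exact: (angle_of_hit_pos bm x0b x0b (lexx b)).
have mE : measurable (Theta @^-1` A `&` Phi @^-1` S).
  by apply: measurableI; rewrite -[_ @^-1` _]setTI; [exact: mTheta|exact: mPhi].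
have mF : measurable (Phi @^-1` S) by rewrite -[_ @^-1` _]setTI; exact: mPhi.
(* A path that reaches radius [b] has crossed the unit circle, so finiteness of both hitting times
   amounts to [D]. *)
have -> : [set w | (hit_time B 1 w < +oo)%E /\ (hit_time B b w < +oo)%E
    /\ A (angle_of (hit_pos B 1 w)) /\ S (angle_of (hit_pos B b w))] =
    (Theta @^-1` A `&` Phi @^-1` S) `&` D.
  apply/seteqP; split => w /=.
    by move=> [_ [/hit_time_lty Dw]]; rewrite angle1// angleb.
  move=> [[Aw Sw] Dw]; rewrite angle1// angleb//; split; last by split=> //; exact/hit_time_lty.
  by apply/hit_time_lty; exact: (hits_sub bm x01 (ltW b1)).
(* Intersection with [D] is written as removal of a null set, the form in which
   [ge0_negligible_integral] discards it. *)
have -> : [set w | (hit_time B b w < +oo)%E /\ S (angle_of (hit_pos B b w))] =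
    Phi @^-1` S `\` ~` D.
  rewrite setDE setCK; apply/seteqP; split => w /=.
    by move=> [/hit_time_lty Dw]; rewrite angleb.
  by move=> [Sw Dw]; rewrite angleb//; split=> //; exact/hit_time_lty.
transitivity (P (Theta @^-1` A `&` Phi @^-1` S)).
  apply/esym; rewrite (measureDI P mE mD).
  rewrite [X in (X + _)%E](_ : _ = 0%E) ?add0e//.
  apply: subset_measure0 DC0; [exact: measurableD|exact: measurableC|].
  by move=> w [].
rewrite main.
pose h w := (\int[@lebesgue_measure R]_(th in A)
  (cond_dens rho1 mu1 rho2 (Phi w) th)%:E)%E.
have mh : measurable_fun setT h.
  exact: (measurableT_comp (measurable_cond_prob mu1 r1 r2' mA) mPhi).
have h0 w : (0 <= h w)%E.
  by apply: integral_ge0 => th _; rewrite lee_fin; exact: cond_dens_ge0.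
transitivity (\int[P]_(w in Phi @^-1` S `\` ~` D) h w)%E.
  exact: (@ge0_negligible_integral _ _ _ P _ _ h (measurableC mD) mF
    (measurable_funTS mh) (fun w _ => h0 w) DC0).
by apply: eq_integral => w; rewrite inE => -[_ /contrapT Dw]; rewrite angleb.
Qed.
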